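(* For every $n\in\mathbb N=\{1,2,\ldots\}$, every $k\in\{1,\ldots,n\}$ and every real $\beta>\frac{n-1}{2}$, $$\tilde{\mathbb J}_{n,k}(\beta)=\sum_{\ell=0}^{n-k}(-1)^\ell\sum_{n=n_0>n_1>\ldots>n_\ell\ge k}\tilde{\mathbb I}_{n,n_1}(2\beta-n+1)\,\tilde{\mathbb I}_{n_1,n_2}(2\beta-n+1)\cdots\tilde{\mathbb I}_{n_{\ell-1},n_\ell}(2\beta-n+1)\binom{n_\ell}{k},$$ where the second sum is over all integer tuples $(n_0,n_1,\ldots,n_\ell)$ with $n=n_0>n_1>\ldots>n_\ell\ge k$ (for $\ell=0$ the product of $\tilde{\mathbb I}$'s is empty and the term is $\binom nk$).
   Context: Angles. For a polyhedral cone $C$, its solid angle is $\alpha(C)=\mathbb P[U\in C]$, where $U$ is uniformly distributed on the unit sphere of the smallest linear subspace containing $C$. For a polytope $P\subset\mathbb R^d$ and a face $F$ of $P$, the tangent cone is $T(F,P)=\{y\in\mathbb R^d:\exists\varepsilon>0,\ f_0+\varepsilon y\in P\}$ with $f_0$ any point in the relative interior of $F$, and the internal angle of $P$ at $F$ is $\alpha(T(F,P))$ (equal to $1$ if $F=P$). Beta' densities on $\mathbb R^d$: $\tilde f_{d,\beta}(x)=\tilde c_{d,\beta}(1+\|x\|^2)^{-\beta}$ for $\beta>d/2$, with $\tilde c_{d,\beta}=\frac{\Gamma(\beta)}{\pi^{d/2}\Gamma(\beta-\frac d2)}$. For $\beta>\frac{n-1}2$, let $\tilde X_1,\dots,\tilde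 X_n$ be i.i.d. in $\mathbb R^{n-1}$ with density $\tilde f_{n-1,\beta}$; $\tilde J_{n,k}(\beta)$ is the expected internal angle of the simplex $[\tilde X_1,\dots,\tilde X_n]$ (convex hull) at its face $[\tilde X_1,\dots,\tilde X_k]$. By definition $\tilde J_{n,n}(\beta)=1$ (including $n=1$). Put $\tilde{\mathbb J}_{n,k}(\beta)=\binom nk\tilde J_{n,k}(\beta)$. For $1\le k\le n$ put $\tilde{\mathbb I}_{n,k}(\alpha)=\binom nk\tilde I_{n,k}(\alpha)$, where for $\alpha>0$ $$\tilde I_{n,k}(\alpha)=\int_{-\pi/2}^{\pi/2}\tilde c_{1,\frac{\alpha k+1}2}(\cos\varphi)^{\alpha k-1}\left(\int_{-\pi/2}^{\varphi}\tilde c_{1,\frac{\alpha+1}2}(\cos\theta)^{\alpha-1} d\theta\right)^{n-k}d\varphi .$$ *)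

(* Defs.v *)
From HB Require Import structures.
From mathcomp Require Import all_boot all_order all_algebra.
From mathcomp Require Import all_classical all_reals all_analysis.

Set Implicit Arguments.
Unset Strict Implicit.
Unset Printing Implicit Defensive.
Import Order.TTheory GRing.Theory Num.Theory.
Import numFieldNormedType.Exports.
Local Open Scope classical_set_scope.
Local Open Scope ring_scope.

(* The space R^d is 'rV[R]_d. The norm `|x| that the library puts on matrices
   is the sup norm, hence the Euclidean norm below. *)
Definition dotp (R : realType) (d : nat) (x y : 'rV[R]_d) : R :=
  \sum_(i < d) x 0 i * y 0 i.

Definition enorm (R : realType) (d : nat) (x : 'rV[R]_d) : R :=
  Num.sqrt (dotp x x).

(* The Borel sigma-algebra of R^d, generated by the coordinate maps. *)
Definition measure_rV_display : measure_display.
Proof. exact: default_measure_display. Qed.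

Section measurable_rV.
Context {R : realType} (d : nat).

Let coors : 'I_d -> 'rV[R]_d -> measurableTypeR R := fun i x => x 0 i.

Let rV_set0 : g_sigma_preimage coors set0.
Proof. exact: sigma_algebra0. Qed.

Let rV_setC A : g_sigma_preimage coors A -> g_sigma_preimage coors (~` A).
Proof. exact: sigma_algebraC. Qed.

Let rV_bigcup (F : (set 'rV[R]_d)^nat) :
  (forall i, g_sigma_preimage coors (F i)) ->
  g_sigma_preimage coors (\bigcup_i (F i)).
Proof. exact: sigma_algebra_bigcup. Qed.

HB.instance Definition _ := @isMeasurable.Build measure_rV_display
  'rV[R]_d (g_sigma_preimage coors) rV_set0 rV_setC rV_bigcup.

Lemma measurable_coord (i : 'I_d) :
  measurable_fun [set: 'rV[R]_d] (fun x : 'rV[R]_d => x 0 i).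
Proof.
move=> _ Y mY; rewrite setTI; apply: sub_sigma_algebra => /=.
rewrite -bigcup_seq/=; exists i => /=; first by rewrite mem_index_enum.
by exists Y => //; rewrite setTI.
Qed.

Lemma measurable_fun_rV d' (T : measurableType d') (f : T -> 'rV[R]_d) :
  (forall i, measurable_fun [set: T] (fun t => f t 0 i)) ->
  measurable_fun [set: T] f.
Proof.
move=> mf _ B mB; rewrite setTI.
suff : g_sigma_preimage coors `<=` [set B | measurable (f @^-1` B)].
  exact.
apply: smallest_sub; first split.
- by rewrite /= preimage_set0.
- by move=> A /= mA; rewrite setTD preimage_setC; exact: measurableC.
- move=> F mF /=; rewrite preimage_bigcup.
  by apply: bigcupT_measurable => i; exact: mF.
- rewrite -bigcup_seq => A [i _] [C mC <-] /=.
  by rewrite setTI -[X in measurable X]setTI; exact: (mf i).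
Qed.

End measurable_rV.

(* Lebesgue measure on R^d, by the identification R^(1+d) = R x R^d. *)
Section lebesgue_step.
Context {R : realType} (d : nat).

Definition cons_rV (z : measurableTypeR R * 'rV[R]_d) : 'rV[R]_d.+1 :=
  row_mx (const_mx z.1 : 'rV[R]_1) z.2.

Definition uncons_rV (x : 'rV[R]_d.+1) : measurableTypeR R * 'rV[R]_d :=
  (x 0 ord0, \row_i x 0 (lift ord0 i)).

Lemma cons_rVK : cancel cons_rV uncons_rV.
Proof.
case=> a v; rewrite /uncons_rV /cons_rV; congr pair.
- rewrite (_ : ord0 = lshift d (ord0 : 'I_1)); last exact/val_inj.
  by exact: etrans (row_mxEl _ _ _ _) (mxE _ _ _ _).
- apply/rowP => i; rewrite mxE.
  rewrite (_ : lift ord0 i = rshift 1 i); last exact/val_inj.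
  exact: row_mxEr.
Qed.

Lemma measurable_cons_rV : measurable_fun setT cons_rV.
Proof.
apply: measurable_fun_rV => i.
case: (splitP (i : 'I_(1 + d))) => j ij.
- have -> : (fun t => cons_rV t 0 i) = fst.
    apply/funext => z; rewrite (_ : i = lshift d j); last exact/val_inj.
    by rewrite /cons_rV; exact: etrans (row_mxEl _ _ _ _) (mxE _ _ _ _).
  exact: measurable_fst.
- have -> : (fun t => cons_rV t 0 i) = (fun x : 'rV[R]_d => x 0 j) \o snd.
    apply/funext => z; rewrite (_ : i = rshift 1 j); last exact/val_inj.
    exact: row_mxEr.
  apply: (measurableT_comp (measurable_coord j)).
  exact: measurable_snd.
Qed.

Lemma measurable_uncons_rV : measurable_fun setT uncons_rV.
Proof.
apply/measurable_fun_pairP; split; first exact: measurable_coord.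
apply: measurable_fun_rV => i; under eq_fun do rewrite /= mxE.
exact: measurable_coord.
Qed.

Variable m : {sigma_finite_measure set 'rV[R]_d -> \bar R}.

Definition lebesgue_cons : set 'rV[R]_d.+1 -> \bar R :=
  pushforward (@lebesgue_measure R \x m)%E cons_rV.

Let lebesgue_cons0 : lebesgue_cons set0 = 0%E.
Proof. by rewrite /lebesgue_cons /pushforward preimage_set0 measure0. Qed.

Let lebesgue_cons_ge0 A : (0 <= lebesgue_cons A)%E.
Proof.
rewrite /lebesgue_cons /pushforward.
exact: (measure_ge0 (_ : {measure set _ -> \bar R})).
Qed.

Let lebesgue_cons_sigma_additive : semi_sigma_additive lebesgue_cons.
Proof.
move=> F mF tF mUF; rewrite /lebesgue_cons /pushforward preimage_bigcup.
apply: measure_semi_sigma_additive.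
- by move=> i; rewrite -[X in measurable X]setTI; exact: measurable_cons_rV.
- apply/trivIsetP => /= i j _ _ ij; rewrite -preimage_setI.
  by move/trivIsetP : tF => /(_ _ _ _ _ ij) ->//; rewrite preimage_set0.
- rewrite -preimage_bigcup -[X in measurable X]setTI.
  exact: measurable_cons_rV.
Qed.

HB.instance Definition _ := isMeasure.Build _ _ _ lebesgue_cons
  lebesgue_cons0 lebesgue_cons_ge0 lebesgue_cons_sigma_additive.

Let lebesgue_cons_sigma_finite : sigma_finite setT lebesgue_cons.
Proof.
have /sigma_finiteP[F [TF ndF Foo]] := sigma_finiteT (@lebesgue_measure R).
have /sigma_finiteP[G [TG ndG Goo]] := sigma_finiteT m.
exists (fun i => uncons_rV @^-1` (F i `*` G i)).
  rewrite -preimage_bigcup (_ : \bigcup_i _ = setT) ?preimage_setT//.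
  rewrite -setXTT TF TG predeqE => -[x y]; split.
    by move=> [i _ []/= ? ?]; split; exists i.
  move=> [/= [i _ Fix] [j _ Gjy]]; exists (maxn i j) => //; split.
  - by move: x Fix; exact/subsetPset/ndF/leq_maxl.
  - by move: y Gjy; exact/subsetPset/ndG/leq_maxr.
move=> i; have [mFi Fioo] := Foo i; have [mGi Gioo] := Goo i; split.
  rewrite -[X in measurable X]setTI; apply: measurable_uncons_rV => //.
  exact: measurableX.
rewrite /lebesgue_cons /pushforward -comp_preimage.
rewrite (_ : uncons_rV \o cons_rV = id); last first.
  by apply/funext => z /=; rewrite cons_rVK.
by rewrite preimage_id product_measure1E// lte_mul_pinfty// ge0_fin_numE.
Qed.

HB.instance Definition _ :=
  Measure_isSigmaFinite.Build _ _ _ lebesgue_cons lebesgue_cons_sigma_finite.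

End lebesgue_step.

Fixpoint lebesgue_rV (R : realType) (d : nat) :
    {sigma_finite_measure set 'rV[R]_d -> \bar R} :=
  match d with
  | 0 => \d_(0 : 'rV[R]_0)
  | d'.+1 => lebesgue_cons (lebesgue_rV R d')
  end.

Definition conv_hull (R : realType) (d : nat) (A : set 'rV[R]_d) :
    set 'rV[R]_d :=
  [set x | exists m (a : 'I_m -> R) (y : 'I_m -> 'rV[R]_d),
    [/\ forall i, 0 <= a i, \sum_(i < m) a i = 1, forall i, A (y i) &
        x = \sum_(i < m) a i *: y i]].

Definition aff_hull (R : realType) (d : nat) (A : set 'rV[R]_d) :
    set 'rV[R]_d :=
  [set x | exists m (a : 'I_m -> R) (y : 'I_m -> 'rV[R]_d),
    [/\ \sum_(i < m) a i = 1, forall i, A (y i) &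
        x = \sum_(i < m) a i *: y i]].

Definition relint (R : realType) (d : nat) (A : set 'rV[R]_d) :
    set 'rV[R]_d :=
  [set x | A x /\ exists2 r : R, 0 < r &
    forall y, aff_hull A y -> enorm (y - x) < r -> A y].

Definition tangent_cone (R : realType) (d : nat) (F P : set 'rV[R]_d) :
    set 'rV[R]_d :=
  [set y | exists2 f0, relint F f0 &
    exists2 e : R, 0 < e & P (f0 + e *: y)].

Definition is_lspan (R : realType) (d : nat) (C : set 'rV[R]_d)
    (L : {vspace 'rV[R]_d}) : Prop :=
  (forall x, C x -> x \in L) /\
  forall L' : {vspace 'rV[R]_d}, (forall x, C x -> x \in L') -> (L <= L')%VS.

Definition lspan (R : realType) (d : nat) (C : set 'rV[R]_d) :
    {vspace 'rV[R]_d} := xget fullv [set L | is_lspan C L].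

Definition orthonormal_basis (R : realType) (d : nat)
    (L : {vspace 'rV[R]_d}) : (\dim L).-tuple 'rV[R]_d :=
  xget (vbasis L) [set e : (\dim L).-tuple 'rV[R]_d | basis_of L e /\
    forall i j, dotp (tnth e i) (tnth e j) = (i == j)%:R].

(* The uniform distribution on the unit sphere of R^m: the law of x / ||x||
   for x uniformly distributed in the unit ball. *)
Definition sphere_unif (R : realType) (m : nat) (A : set 'rV[R]_m) : R :=
  fine (lebesgue_rV R m [set x | enorm x <= 1 /\ A ((enorm x)^-1 *: x)]) /
  fine (lebesgue_rV R m [set x | enorm x <= 1]).

(* The unit sphere of the linear hull of C is the isometric image of the unit
   sphere of R^m, m = dim, under the coordinates in an orthonormal basis. *)
Definition solid_angle (R : realType) (d : nat) (C : set 'rV[R]_d) : R :=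
  let L := lspan C in
  sphere_unif [set u : 'rV[R]_(\dim L) |
    C (\sum_(i < \dim L) u 0 i *: tnth (orthonormal_basis L) i)].

Definition internal_angle (R : realType) (d : nat) (F P : set 'rV[R]_d) : R :=
  if `[< F = P >] then 1 else solid_angle (tangent_cone F P).

Definition mutually_independent d d' (T : measurableType d)
    (T' : measurableType d') (R : realType) (P : probability T R) (n : nat)
    (X : 'I_n -> {RV P >-> T'}) : Prop :=
  forall B : 'I_n -> set T', (forall i, measurable (B i)) ->
  P (\bigcap_i (X i @^-1` B i)) = (\prod_(i < n) P (X i @^-1` B i))%E.

Definition has_density d (T : measurableType d) (R : realType)
    (P : probability T R) (m : nat) (X : {RV P >-> 'rV[R]_m})
    (f : 'rV[R]_m -> R) : Prop :=
  forall B : set 'rV[R]_m, measurable B ->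
  P (X @^-1` B) = (\int[lebesgue_rV R m]_(x in B) (f x)%:E)%E.

Definition Gamma (R : realType) (s : R) : R :=
  \int[lebesgue_measure]_(t in `]0, +oo[) (t `^ (s - 1) * expR (- t)).

Definition beta'_const (R : realType) (d : nat) (beta : R) : R :=
  Gamma beta / (pi `^ (d%:R / 2) * Gamma (beta - d%:R / 2)).

Definition beta'_density (R : realType) (d : nat) (beta : R)
    (x : 'rV[R]_d) : R :=
  beta'_const d beta * (1 + enorm x ^+ 2) `^ (- beta).

(* The expected internal angle of the simplex [X_1, ..., X_n] at its face
   [X_1, ..., X_k], where X_1, ..., X_n are X 0, ..., X (n-1). *)
Definition expected_internal_angle d (T : measurableType d) (R : realType)
    (P : probability T R) (n m : nat) (X : 'I_n -> {RV P >-> 'rV[R]_m})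
    (k : nat) : \bar R :=
  'E_P[fun w => internal_angle
    (conv_hull [set X i w | i in [set i : 'I_n | (i < k)%N]])
    (conv_hull [set X i w | i in [set: 'I_n]])]%E.

Definition tildeI (R : realType) (n k : nat) (alpha : R) : R :=
  \int[lebesgue_measure]_(phi in `[- (pi / 2), pi / 2])
    (beta'_const 1 ((alpha * k%:R + 1) / 2) * cos phi `^ (alpha * k%:R - 1) *
     (\int[lebesgue_measure]_(theta in `[- (pi / 2), phi])
        (beta'_const 1 ((alpha + 1) / 2) * cos theta `^ (alpha - 1)))
     ^+ (n - k)).

Definition bbI (R : realType) (n k : nat) (alpha : R) : R :=
  'C(n, k)%:R * tildeI n k alpha.

(* s encodes the tuple (n_0, ..., n_l) with n = n_0 > n_1 > ... > n_l >= k. *)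
Definition is_chain (n k l : nat) (s : {ffun 'I_l.+1 -> 'I_n.+1}) : bool :=
  [&& s ord0 == n :> nat,
      [forall i : 'I_l, (s (lift ord0 i) < s (widen_ord (leqnSn l) i))%N] &
      (k <= s ord_max)%N].

(* Main.v *)
(* A beta' density is a Gamma mixture of centered Gaussian densities; let w_i be
   the inverse variance (the weight) of the i-th vertex.  For fixed weights, the
   tangent cone of the simplex at its face on the first k vertices is a linear
   image of the set of t in R^n with t_i >= (weighted mean of t) for all i >= k.
   This set is invariant under positive affine changes of scale, and the image
   of a t depends in law only on the weighted variance of t, since w-orthogonal
   reflections fixing the constants preserve the Gaussian law of the vertices.
   Hence the expected internal angle is the probability that t_i exceeds the
   weighted mean for all i >= k, now for n independent random weights and beta'
   distributed numbers t_i (prob_above n k).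

   For every t there is exactly one index set G containing the first k indices
   such that t_i is at least the weighted mean of t over G for the other
   i in G, and below it for i outside G.  Summing the probabilities of these
   events over G gives
     sum_m 'C(n-k, m-k) * prob_above m k * tildeI n m = 1,
   a unitriangular system whose inversion produces the sum over chains. *)

Require Import Defs.
From HB Require Import structures.
From mathcomp Require Import all_boot all_order all_algebra all_fingroup.
From mathcomp Require Import all_classical all_reals all_analysis.
From mathcomp Require Import measurable_realfun ring lra zify.

Set Implicit Arguments.
Unset Strict Implicit.
Unset Printing Implicit Defensive.
Import Order.TTheory GRing.Theory Num.Theory.
Import numFieldNormedType.Exports.
Local Open Scope classical_set_scope.
Local Open Scope ring_scope.

(** * Lebesgue integrals over row vectors *)

(** No Jacobian is ever computed. The scale factor of a linear bijection is a ratio of two volumes,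
    by uniqueness of Lebesgue measure up to a constant, and the Gaussian average attached to t stays
    an unknown function theta of its weighted variance. It disappears by comparison: for a function
    of t invariant under positive affine changes of scale, the variance is distributed by a multiple
    of the Haar measure dN/N, so replacing theta by a Gaussian weight changes the integral by a
    factor that is the same for all cones. The whole space, where everything is explicit, gives this
    factor.

    Origin of the exponents, with d = n - 1: the d-dimensional Gaussian norm takes d/2 off beta, so
    the weights are Gamma of shape beta - d/2. The same weights with one-dimensional Gaussians t_i
    give beta' numbers of exponent p = beta - (d - 1)/2, and 2p - 1 = 2 beta - n + 1 is the argument
    of [tildeI]. The weighted mean of m of the t_i is independent of the event that they exceed it
    and is beta' of exponent ((2p - 1)m + 1)/2; this independence is why the probability of each
    cell factors. *)

Section line_integral.
Context {R : realType}.
Local Open Scope ereal_scope.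
Notation mu := (@lebesgue_measure R).

Lemma ge0_integral_shift (a : R) (f : R -> \bar R) :
  measurable_fun setT f -> (forall x, 0 <= f x) ->
  \int[mu]_x f (x + a)%R = \int[mu]_x f x.
Proof.
move=> mf f0.
have ms : measurable_fun setT (fun x : measurableTypeR R => (x + a)%R : measurableTypeR R).
  exact: measurable_funD.
transitivity (\int[pushforward mu (fun x : measurableTypeR R => (x + a)%R : measurableTypeR R)]_x
  f x).
  by rewrite ge0_integral_pushforward.
apply: eq_measure_integral => A mA _.
apply/esym/lebesgue_measure_unique => //= _ [[u v]] _ <-.
rewrite /pushforward /=.
rewrite (_ : _ @^-1` _ = `](u - a)%R, (v - a)%R]%classic).
  by rewrite !lebesgue_measure_itv/= !lte_fin ltrD2r !EFinB -!EFinB opprB addrA subrK.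
by apply/seteqP; split => x /=; rewrite !in_itv/= ltrBlDr lerBrDr.
Qed.

Lemma ge0_integral_scale (c : R) (f : R -> \bar R) : (0 < c)%R ->
  measurable_fun setT f -> (forall x, 0 <= f x) ->
  \int[mu]_x f (c * x)%R = (c^-1)%:E * \int[mu]_x f x.
Proof.
move=> c0 mf f0.
have ms : measurable_fun setT (fun x : measurableTypeR R => (c * x)%R : measurableTypeR R).
  exact: measurable_funM.
pose m0 := [the measure _ _ of pushforward mu (fun x : measurableTypeR R => (c * x)%R :
  measurableTypeR R)].
pose m := m0 ms.
have cge : (0 <= c)%R by exact: ltW.
pose c' : {nonneg R} := NngNum cge.
have -> : \int[mu]_x f x = \int[mscale c' m]_x f x.
  apply: eq_measure_integral => A mA _.
  apply/lebesgue_measure_unique => //= _ [[u v]] _ <-.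
  rewrite /mscale /m /= /pushforward /=.
  rewrite (_ : _ @^-1` _ = `](u / c)%R, (v / c)%R]%classic).
    rewrite !lebesgue_measure_itv/= !lte_fin ltr_pM2r ?invr_gt0//.
    case: ifP => _; last by rewrite mule0.
    by rewrite -!EFinB -EFinM mulrBr !mulrA ![(c * _)%R]mulrC !mulfK ?gt_eqF.
  by apply/seteqP; split => x /=; rewrite !in_itv/= ltr_pdivrMr// ler_pdivlMr// ![(x * c)%R]mulrC.
rewrite ge0_integral_mscale//= ge0_integral_pushforward// muleA -EFinM mulVf ?mul1e ?gt_eqF//.
Qed.

End line_integral.

Section lebesgue_rV_integral.
Context {R : realType}.
Local Open Scope ereal_scope.
Notation mu := (@lebesgue_measure R).
Notation lam := (lebesgue_rV R).

Lemma ge0_integral_lebesgue_cons (N : nat) (f : 'rV[R]_N.+1 -> \bar R) :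
  measurable_fun setT f -> (forall x, 0 <= f x) ->
  \int[lam N.+1]_x f x = \int[mu]_a \int[lam N]_v f (cons_rV (a, v)).
Proof.
move=> mf f0.
have mc := @measurable_cons_rV R N.
transitivity (\int[pushforward (mu \x lam N) (@cons_rV R N)]_x f x).
  by apply: eq_measure_integral => A mA _.
rewrite ge0_integral_pushforward// preimage_setT fubini_tonelli1//; first exact: measurableT_comp.
by move=> x; exact: f0.
Qed.

Lemma cons_rV0 (N : nat) (a : R) (v : 'rV[R]_N) : cons_rV (a, v) 0%R ord0 = a.
Proof. by have /(congr1 fst) := cons_rVK (a, v). Qed.

Lemma cons_rVS (N : nat) (a : R) (v : 'rV[R]_N) (i : 'I_N) :
  cons_rV (a, v) 0%R (lift ord0 i) = v 0%R i.
Proof.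
by have /(congr1 snd) /= /rowP /(_ i) := cons_rVK (a, v); rewrite mxE.
Qed.

Lemma measurable_coordT d (T : measurableType d) (N : nat)
    (g : T -> 'rV[R]_N) (i : 'I_N) :
  measurable_fun setT g -> measurable_fun setT (fun t => g t 0%R i).
Proof. by move=> mg; apply: (measurableT_comp (measurable_coord i) mg). Qed.

Lemma ge0_integral_prod (N : nat) (h : 'I_N -> R -> R) :
  (forall i, measurable_fun setT (h i)) -> (forall i x, (0 <= h i x)%R) ->
  \int[lam N]_x (\prod_(i < N) h i (x 0%R i))%:E =
  \prod_(i < N) \int[mu]_x (h i x)%:E.
Proof.
elim: N h => [h _ _|N IH h mh h0].
  rewrite big_ord0; under eq_integral do rewrite big_ord0.
  by rewrite integral_cst//= diracT mule1.
rewrite ge0_integral_lebesgue_cons; last 2 first.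
- apply/measurable_EFinP/measurable_prod => i _.
  exact: measurableT_comp (mh i) (measurable_coord i).
- by move=> x; rewrite lee_fin prodr_ge0.
rewrite big_ord_recl/= -[X in _ = _ * X](IH (fun i => h (lift ord0 i)))//.
have I0 : 0 <= \int[lam N]_x (\prod_(i < N) h (lift ord0 i) (x 0%R i))%:E.
  by apply: integral_ge0 => x _; rewrite lee_fin prodr_ge0.
rewrite -ge0_integralZr//; last 2 first.
- by apply/measurable_EFinP; exact: mh.
- by move=> x _; rewrite lee_fin.
apply: eq_integral => a _; rewrite -ge0_integralZl//; last 3 first.
- apply/measurable_EFinP/measurable_prod => i _.
  exact: measurableT_comp (mh _) (measurable_coord i).
- by move=> x _; rewrite lee_fin prodr_ge0.
- by rewrite lee_fin.
apply: eq_integral => v _; rewrite big_ord_recl/= cons_rV0 EFinM.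
by under eq_bigr do rewrite cons_rVS.
Qed.

Definition box (N : nat) (B : 'I_N -> set R) : set 'rV[R]_N :=
  [set x | forall i, B i (x 0%R i)].

Lemma measurable_box (N : nat) (B : 'I_N -> set R) :
  (forall i, measurable (B i)) -> measurable (box B).
Proof.
move=> mB; rewrite (_ : box B = \bigcap_i ((fun x : 'rV[R]_N => x 0%R i) @^-1` B i)).
  apply: fin_bigcap_measurable => // i _.
  by rewrite -[X in measurable X]setTI; exact: measurable_coord.
by apply/seteqP; split => x //= Bx i; [move=> _; exact: Bx|exact: Bx].
Qed.

Lemma lebesgue_rV_box (N : nat) (B : 'I_N -> set R) :
  (forall i, measurable (B i)) -> lam N (box B) = \prod_(i < N) mu (B i).
Proof.
move=> mB; have mbox := measurable_box mB.
rewrite -[LHS]mul1e -integral_cst// integral_mkcond.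
transitivity (\int[lam N]_x (\prod_(i < N) \1_(B i) (x 0%R i))%:E).
  apply: eq_integral => x _; rewrite patchE.
  case: ifPn => [/set_mem Bx|/negP xB].
    by rewrite big1// => i _; rewrite indicE mem_set.
  case: (pselect (exists i, ~ B i (x 0%R i))) => [[i Bi]|H].
    by rewrite (bigD1 i)//= indicE memNset ?mul0r.
  exfalso; apply: xB; apply: mem_set => i.
  by apply: contrapT => Bi; apply: H; exists i.
rewrite (ge0_integral_prod (h := fun i => \1_(B i)))//.
by apply: eq_bigr => i _; rewrite integral_indic ?setIT//; exact: mB.
Qed.

(** Boxes are stable under intersection and generate the sigma-algebra; the cubes exhaust the space,
    so their finite measure supplies what uniqueness on a generating family requires. *)
Lemma rV_measure_unique (N : nat) (m1 m2 : {measure set 'rV[R]_N -> \bar R}) :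
  (forall B : 'I_N -> set R, (forall i, measurable (B i)) -> m1 (box B) = m2 (box B)) ->
  (forall K : nat, m1 (box (fun=> `[(- K%:R)%R, K%:R%R]%classic)) < +oo) ->
  forall A, measurable A -> m1 A = m2 A.
Proof.
move=> m12 mfin A mA.
pose G := [set X : set 'rV[R]_N | exists2 B : 'I_N -> set R,
  (forall i, measurable (B i)) & X = box B].
apply: (measure_unique G (fun K : nat => box (fun=> `[(- K%:R)%R, K%:R%R]%classic))) => //.
- apply/seteqP; split.
    apply: smallest_sub; first exact: smallest_sigma_algebra.
    rewrite -bigcup_seq => X [i _] [C mC <-] /=.
    rewrite setTI; apply: sub_sigma_algebra => /=.
    exists (fun j => if j == i then C else setT).
      by move=> j; case: ifP.
    apply/seteqP; split => x /=.
      by move=> Cx j; case: ifPn => [/eqP ->|].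
    by move=> /(_ i); rewrite eqxx.
  apply: smallest_sub; first exact: sigma_algebra_measurable.
  by move=> X [B mB ->]; exact: measurable_box.
- move=> _ _ [B mB ->] [C mC ->]; exists (fun i => B i `&` C i).
    by move=> i; exact: measurableI.
  by apply/seteqP; split => x /= => [[? ?] i //|xBC]; split => i; have [] := xBC i.
- by move=> K; exists (fun=> `[(- K%:R)%R, K%:R%R]%classic).
- apply/seteqP; split => // x _.
  exists (Num.truncn (\sum_i `|x 0%R i|)).+1 => // i /=.
  rewrite in_itv/= -ler_norml.
  apply: (le_trans _ (ltW (truncnS_gt _))).
  by rewrite (bigD1 i)//= lerDl sumr_ge0.
- by move=> _ [B mB ->]; exact: m12.
Qed.

Lemma lebesgue_rV_cube_fin (N K : nat) :
  lam N (box (fun=> `[(- K%:R)%R, K%:R%R]%classic)) < +oo.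
Proof.
rewrite lebesgue_rV_box//.
rewrite (eq_bigr (fun=> (K%:R + K%:R)%:E)); last first.
  move=> i _; rewrite lebesgue_measure_itv/= lte_fin.
  case: ifPn; first by rewrite -EFinB opprK.
  rewrite -leNgt => K0; congr EFin.
  have K00 : (K%:R = 0 :> R)%R.
    apply/eqP; rewrite eq_le ler0n andbT; move: K0; rewrite -subr_ge0 -opprD oppr_ge0.
    by move=> /(le_trans _)->//; rewrite lerDl.
  by rewrite K00 addr0.
by rewrite prodEFin ltry.
Qed.

Lemma lebesgue_rV_unique (N : nat) (m : {measure set 'rV[R]_N -> \bar R}) :
  (forall B : 'I_N -> set R, (forall i, measurable (B i)) ->
     \prod_(i < N) mu (B i) = m (box B)) ->
  forall A, measurable A -> lam N A = m A.
Proof.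
move=> H; apply: rV_measure_unique; last exact: lebesgue_rV_cube_fin.
by move=> B mB; rewrite -H//; exact: lebesgue_rV_box.
Qed.

Lemma ge0_integral_rV_unique (N : nat) (m : {measure set 'rV[R]_N -> \bar R})
    (f : 'rV[R]_N -> \bar R) :
  (forall B : 'I_N -> set R, (forall i, measurable (B i)) ->
     \prod_(i < N) mu (B i) = m (box B)) ->
  \int[lam N]_x f x = \int[m]_x f x.
Proof.
by move=> H; apply: eq_measure_integral => A mA _; exact: lebesgue_rV_unique.
Qed.

End lebesgue_rV_integral.

Section tonelli.
Local Open Scope ereal_scope.
Context d1 d2 (T1 : measurableType d1) (T2 : measurableType d2) (R : realType).
Variables (m1 : {sigma_finite_measure set T1 -> \bar R}).
Variables (m2 : {sigma_finite_measure set T2 -> \bar R}).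
Variable f : T1 -> T2 -> \bar R.
Hypothesis mf : measurable_fun setT (fun z => f z.1 z.2).
Hypothesis f0 : forall x y, 0 <= f x y.

(** In curried form, iterated integrals are exchanged by rewriting, with no product measure in the
    goal. *)
Lemma tonelli : \int[m1]_x \int[m2]_y f x y = \int[m2]_y \int[m1]_x f x y.
Proof. by rewrite (fubini_tonelli (fun z => f z.1 z.2)). Qed.

Lemma measurable_tonelli1 : measurable_fun setT (fun x => \int[m2]_y f x y).
Proof.
by apply: (measurable_fun_fubini_tonelli_F (fun z => f z.1 z.2)).
Qed.

Lemma measurable_section1 x : measurable_fun setT (f x).
Proof. exact: measurableT_comp mf (pair1_measurable x). Qed.

End tonelli.

(** * Measures given by a density or as an image *)

Section density.
Local Open Scope ereal_scope.
Context d (T : measurableType d) (R : realType).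
Variables (m : {measure set T -> \bar R}) (g : T -> \bar R).
Hypotheses (mg : measurable_fun setT g) (g0 : forall x, 0 <= g x).

Definition density_measure (mg : measurable_fun setT g) (g0 : forall x, 0 <= g x) :
  set T -> \bar R := fun A => \int[m]_(x in A) g x.

Let density0 : density_measure mg g0 set0 = 0.
Proof. exact: integral_set0. Qed.

Let density_ge0 A : 0 <= density_measure mg g0 A.
Proof. exact: integral_ge0. Qed.

Let density_sigma_additive : semi_sigma_additive (density_measure mg g0).
Proof.
move=> F mF tF mUF; rewrite /density_measure ge0_integral_bigcup//; last first.
  exact: measurable_funTS.
by apply: is_cvg_ereal_nneg_natsum_cond => i _ _; exact: integral_ge0.
Qed.

HB.instance Definition _ := isMeasure.Build _ _ _ (density_measure mg g0)
  density0 density_ge0 density_sigma_additive.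

End density.

Section image.
Context d1 d2 (T1 : measurableType d1) (T2 : measurableType d2) (R : realType).

Definition image_measure (m : {measure set T1 -> \bar R}) (f : T1 -> T2)
    (mf : measurable_fun setT f) : {measure set T2 -> \bar R}.
Proof. by pose m0 := [the measure T2 R of pushforward m f]; exact: (m0 mf). Defined.

End image.

(** * Translations, dilations and additive maps of Lebesgue measure *)

Section lebesgue_rV_invariance.
Context {R : realType}.
Local Open Scope ereal_scope.
Notation mu := (@lebesgue_measure R).
Notation lam := (lebesgue_rV R).

Lemma measurable_rVD d (T : measurableType d) (N : nat) (f g : T -> 'rV[R]_N) :
  measurable_fun setT f -> measurable_fun setT g ->
  measurable_fun setT (fun t => f t + g t)%R.
Proof.
move=> mf mg; apply: measurable_fun_rV => i; under eq_fun do rewrite mxE.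
by apply: measurable_funD; exact: measurable_coordT.
Qed.

Lemma measurable_rVN d (T : measurableType d) (N : nat) (f : T -> 'rV[R]_N) :
  measurable_fun setT f -> measurable_fun setT (fun t => - f t)%R.
Proof.
move=> mf; apply: measurable_fun_rV => i; under eq_fun do rewrite mxE.
by apply: measurable_funN; exact: measurable_coordT.
Qed.

Lemma measurable_rVZ d (T : measurableType d) (N : nat) (c : T -> R)
    (f : T -> 'rV[R]_N) :
  measurable_fun setT c -> measurable_fun setT f ->
  measurable_fun setT (fun t => c t *: f t)%R.
Proof.
move=> mc mf; apply: measurable_fun_rV => i; under eq_fun do rewrite mxE.
by apply: measurable_funM => //; exact: measurable_coordT.
Qed.

Lemma cons_rVD (N : nat) (a b : R) (u v : 'rV[R]_N) :
  cons_rV (a + b, u + v)%R = (cons_rV (a, u) + cons_rV (b, v))%R.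
Proof.
apply/rowP => i; rewrite [RHS]mxE; case: (unliftP ord0 i) => [j|] ->.
  by rewrite !cons_rVS [LHS]mxE.
by rewrite !cons_rV0.
Qed.

Lemma cons_rVZ (N : nat) (c a : R) (u : 'rV[R]_N) :
  cons_rV (c * a, c *: u)%R = (c *: cons_rV (a, u))%R.
Proof.
apply/rowP => i; rewrite [RHS]mxE; case: (unliftP ord0 i) => [j|] ->.
  by rewrite !cons_rVS [LHS]mxE.
by rewrite !cons_rV0.
Qed.

Lemma uncons_rVK (N : nat) : cancel (@uncons_rV R N) (@cons_rV R N).
Proof.
move=> x; apply/rowP => i; case: (unliftP ord0 i) => [j|] ->.
  by rewrite cons_rVS mxE.
by rewrite cons_rV0.
Qed.

Lemma ge0_integral_rV_shift (N : nat) (v : 'rV[R]_N) (f : 'rV[R]_N -> \bar R) :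
  measurable_fun setT f -> (forall x, 0 <= f x) ->
  \int[lam N]_x f (x + v)%R = \int[lam N]_x f x.
Proof.
elim: N v f => [|N IH] v f mf f0.
  by apply: eq_integral => x _; congr f; apply/rowP => -[].
have mfc : measurable_fun setT (fun z : R * 'rV[R]_N => f (cons_rV (z.1, z.2))).
  apply: measurableT_comp => //.
  by apply: measurableT_comp (@measurable_cons_rV R N) _; apply: measurable_fun_pair.
rewrite ge0_integral_lebesgue_cons; [|by apply: measurableT_comp mf _; exact: measurable_rVD|by []].
rewrite (ge0_integral_lebesgue_cons mf f0).
rewrite -[v]uncons_rVK; case: (uncons_rV v) => a u.
under eq_integral => b _.
  under eq_integral do rewrite -cons_rVD.
  rewrite (IH u (fun w => f (cons_rV (b + a, w)%R)))//; last first.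
    exact: (measurable_section1 (f := fun b w => f (cons_rV (b, w))) mfc).
  over.
rewrite (ge0_integral_shift a (f := fun b => \int[lam N]_x f (cons_rV (b, x))))//.
  exact: (measurable_tonelli1 (f := fun b w => f (cons_rV (b, w))) _ mfc).
by move=> b; exact: integral_ge0.
Qed.

Lemma ge0_integral_rV_scale (N : nat) (c : R) (f : 'rV[R]_N -> \bar R) :
  (0 < c)%R -> measurable_fun setT f -> (forall x, 0 <= f x) ->
  \int[lam N]_x f (c *: x)%R = (c ^- N)%:E * \int[lam N]_x f x.
Proof.
move=> c0; elim: N f => [|N IH] f mf f0.
  rewrite invr1 mul1e.
  by apply: eq_integral => x _; congr f; apply/rowP => -[].
have mfc : measurable_fun setT (fun z : R * 'rV[R]_N => f (cons_rV (z.1, z.2))).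
  apply: measurableT_comp => //.
  by apply: measurableT_comp (@measurable_cons_rV R N) _; apply: measurable_fun_pair.
rewrite ge0_integral_lebesgue_cons; [|by apply: measurableT_comp mf _; exact: measurable_rVZ|by []].
rewrite (ge0_integral_lebesgue_cons mf f0).
have : measurable_fun setT (fun b => \int[lam N]_x f (cons_rV (b, x))).
  exact: (measurable_tonelli1 (f := fun b w => f (cons_rV (b, w))) _ mfc).
have : forall b, 0 <= \int[lam N]_x f (cons_rV (b, x)).
  by move=> b; exact: integral_ge0.
have : forall b, \int[lam N]_x f (c *: cons_rV (b, x))%R =
    (c ^- N)%:E * \int[lam N]_x f (cons_rV (c * b, x)%R).
  move=> b; under eq_integral do rewrite -cons_rVZ.
  rewrite (IH (fun w => f (cons_rV (c * b, w)%R)))//.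
  exact: (measurable_section1 (f := fun b w => f (cons_rV (b, w))) mfc).
under eq_integral do over.
set F := fun b => \int[lam N]_x f (cons_rV (b, x)).
move=> FE; under eq_integral do rewrite FE -/(F _).
clear FE; rewrite -/F => F00 mF; have F0 b : 0 <= F b by exact: F00.
clear F00; clearbody F; rewrite ge0_integralZl; last 4 first.
- by [].
- by apply: measurableT_comp mF _; exact: measurable_funM.
- by move=> x _; exact: F0.
- by rewrite lee_fin invr_ge0 exprn_ge0// ltW.
by rewrite (ge0_integral_scale (f := F))// muleA -EFinM exprS invfM mulrC.
Qed.

Section additive_map.
Variables (N : nat) (phi psi : 'rV[R]_N -> 'rV[R]_N).
Hypothesis phiD : {morph phi : x y / (x + y)%R}.
Hypothesis mphi : measurable_fun setT phi.
Hypothesis psiK : cancel psi phi.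

(* Uniqueness of Haar measure: expand the product of the two integrals, shift
   [y] by [- phi x], exchange the integrals, and shift [x] by [psi y]. *)
Lemma ge0_integral_additive (f g : 'rV[R]_N -> \bar R) :
  measurable_fun setT f -> (forall x, 0 <= f x) ->
  measurable_fun setT g -> (forall x, 0 <= g x) ->
  (\int[lam N]_x f (phi x)) * (\int[lam N]_x g x) =
  (\int[lam N]_x f x) * (\int[lam N]_x g (- phi x)%R).
Proof.
move=> mf f0 mg g0.
have mfphi := measurableT_comp mf mphi.
have mgphi : measurable_fun setT (fun x => g (- phi x)%R).
  by apply: measurableT_comp mg _; exact: measurable_rVN.
have If := integral_ge0 (D := setT) (lam N) (fun x _ => f0 x).
have Ig := integral_ge0 (D := setT) (lam N) (fun x _ => g0 x).
rewrite -ge0_integralZr// -ge0_integralZl//.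
transitivity (\int[lam N]_x \int[lam N]_y (f (phi x) * g (y - phi x)%R)).
  apply: eq_integral => x _.
  rewrite -(ge0_integral_rV_shift (- phi x)%R)// ge0_integralZl//.
  by apply: measurableT_comp mg _; exact: measurable_rVD.
rewrite tonelli; last 2 first.
- apply: emeasurable_funM; first exact: measurableT_comp mfphi _.
  apply: measurableT_comp mg _; apply: measurable_rVD => //.
  by apply: measurable_rVN; exact: measurableT_comp mphi _.
- by move=> x y; exact: mule_ge0.
transitivity (\int[lam N]_y \int[lam N]_x (f (phi x + y)%R * g (- phi x)%R)).
  apply: eq_integral => y _.
  rewrite -[LHS](ge0_integral_rV_shift (psi y)); last 2 first.
  - apply: emeasurable_funM => //.
    by apply: measurableT_comp mg _; apply: measurable_rVD => //; exact: measurable_rVN.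
  - by move=> x; exact: mule_ge0.
  by apply: eq_integral => x _; rewrite phiD psiK opprD addrCA subrr addr0.
rewrite tonelli; last 2 first.
- apply: emeasurable_funM; last exact: measurableT_comp mgphi _.
  by apply: measurableT_comp mf _; apply: measurable_rVD => //; exact: measurableT_comp mphi _.
- by move=> x y; exact: mule_ge0.
apply: eq_integral => x _.
rewrite ge0_integralZr//; last first.
  by apply: measurableT_comp mf _; apply: measurable_rVD.
by under eq_integral do rewrite addrC; rewrite ge0_integral_rV_shift.
Qed.

Variable S : set 'rV[R]_N.
Hypotheses (mS : measurable S) (SN : forall x, S (- x)%R <-> S x).
Hypotheses (lamS_gt0 : 0 < lam N S) (lamS_fin : lam N S < +oo).

Let mSphi : measurable (phi @^-1` S).
Proof. by rewrite -[X in measurable X]setTI; exact: mphi. Qed.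

(** With the indicator of a symmetric set for [g], the other two integrals become volumes: the scale
    factor of [phi] is a ratio of the volumes of one test set and its preimage. *)
Lemma ge0_integral_additive_mul (f : 'rV[R]_N -> \bar R) :
  measurable_fun setT f -> (forall x, 0 <= f x) ->
  (\int[lam N]_x f (phi x)) * lam N S =
  (\int[lam N]_x f x) * lam N (phi @^-1` S).
Proof.
move=> mf f0.
have := ge0_integral_additive (g := EFin \o \1_S) mf f0 _ _.
rewrite (_ : \int[lam N]_x (EFin \o \1_S) x = lam N S); last by rewrite integral_indic ?setIT.
move=> -> //.
  congr (_ * _); rewrite -(setIT (phi @^-1` S)) -integral_indic//.
  apply: eq_integral => x _ /=; rewrite !indicE; congr (_%:R%:E).
  by congr nat_of_bool; apply/idP/idP => /set_mem/SN/mem_set.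
- exact/measurable_EFinP/measurable_indic.
- by move=> x; rewrite lee_fin.
Qed.

(** A map that preserves one set of positive finite volume has scale factor 1. *)
Lemma ge0_integral_additive_inv (f : 'rV[R]_N -> \bar R) :
  (forall x, S (phi x) <-> S x) ->
  measurable_fun setT f -> (forall x, 0 <= f x) ->
  \int[lam N]_x f (phi x) = \int[lam N]_x f x.
Proof.
move=> Sphi mf f0; have := ge0_integral_additive_mul mf f0.
rewrite (_ : phi @^-1` S = S); last by apply/seteqP; split => x /Sphi.
have lfin : lam N S \is a fin_num by rewrite ge0_fin_numE// ltW.
rewrite -(fineK lfin); move/(congr1 (fun z => z * (fine (lam N S))^-1%:E)).
rewrite -!muleA -!EFinM divff ?mule1// gt_eqF//.
by rewrite fine_gt0// lamS_gt0.
Qed.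

Hypothesis phiK : cancel phi psi.
Hypothesis mpsi : measurable_fun setT psi.

(** For [f] the indicator of the image of [S], the previous identity writes the square of the volume
    of [S] as the volume of the preimage times a nonnegative number. The square is positive and
    finite, so the volume of the preimage is neither zero nor infinite. *)
Lemma lebesgue_rV_preim_additive :
  0 < lam N (phi @^-1` S) /\ lam N (phi @^-1` S) < +oo.
Proof.
have := @ge0_integral_additive_mul (fun x => (\1_S (psi x))%:E).
have mi : measurable_fun setT (fun x => (\1_S (psi x) : R)%:E).
  by apply/measurable_EFinP; apply: (measurableT_comp _ mpsi); exact: measurable_indic.
move=> /(_ mi) H.
have {}H : lam N S * lam N S =
    \int[lam N]_x (\1_S (psi x))%:E * lam N (phi @^-1` S).
  rewrite -H//; congr (_ * _); rewrite -[in LHS](setIT S) -integral_indic//.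
  by apply: eq_integral => x _ /=; rewrite phiK.
have SS0 : 0 < lam N S * lam N S by exact: mule_gt0.
have SSfin : lam N S * lam N S < +oo.
  have lfin : lam N S \is a fin_num by rewrite ge0_fin_numE// ltW.
  by rewrite -(fineK lfin) -EFinM ltry.
split.
  rewrite lt0e measure_ge0 andbT; apply/eqP => p0.
  by move: SS0; rewrite H p0 mule0 ltxx.
rewrite ltey; apply/eqP => py; move: SSfin; rewrite H py.
have I0 : 0 <= \int[lam N]_x (\1_S (psi x))%:E.
  by apply: integral_ge0 => x _; rewrite lee_fin.
have [I00|I0'] := eqVneq (\int[lam N]_x (\1_S (psi x))%:E) 0.
  by move: SS0; rewrite H I00 mul0e ltxx.
by rewrite gt0_muley ?ltxx// lt0e I0' I0.
Qed.

End additive_map.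

Lemma lebesgue_rV_bounded_nbhs (N : nat) (S : set 'rV[R]_N) (delta K : R) :
  measurable S -> (0 < delta)%R ->
  (forall x : 'rV[R]_N, (forall i, `|x 0 i| <= delta)%R -> S x) ->
  (forall x : 'rV[R]_N, S x -> forall i, (`|x 0 i| <= K)%R) ->
  0 < lam N S /\ lam N S < +oo.
Proof.
move=> mS d0 dS SK.
have mitv (r : R) : measurable (`[(- r)%R, r]%classic : set R) by exact: measurable_itv.
have itvE (r : R) : (0 < r)%R -> mu `[(- r)%R, r]%classic = (r + r)%:E.
  move=> r0; rewrite lebesgue_measure_itv/= lte_fin gtrN//.
  by rewrite -EFinB opprK.
split.
  apply: (@lt_le_trans _ _ (lam N (box (fun=> `[(- delta)%R, delta]%classic)))).
    rewrite lebesgue_rV_box// (eq_bigr (fun=> (delta + delta)%:E)); last by move=> i _;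
      rewrite itvE.
    by rewrite prodEFin lte_fin prodr_gt0// => i _; rewrite addr_gt0.
  apply: le_measure; rewrite ?inE//; first exact: measurable_box.
  by move=> x bx; apply: dS => i; have /= := bx i; rewrite in_itv/= ler_norml.
pose K' := (`|K| + 1)%R.
have K'0 : (0 < K')%R by rewrite ltr_wpDl.
apply: (@le_lt_trans _ _ (lam N (box (fun=> `[(- K')%R, K']%classic)))).
  apply: le_measure; rewrite ?inE//; first exact: measurable_box.
  move=> x Sx i /=; rewrite in_itv/= -ler_norml.
  by rewrite (le_trans (SK _ Sx i))// (le_trans (ler_norm _))// lerDl.
rewrite lebesgue_rV_box// (eq_bigr (fun=> (K' + K')%:E)); last by move=> i _; rewrite itvE.
by rewrite prodEFin ltry.
Qed.

Lemma ge0_integral_row_mx (a b : nat) (f : 'rV[R]_(a + b) -> \bar R) :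
  measurable_fun setT f -> (forall x, 0 <= f x) ->
  \int[lam (a + b)%N]_x f x = \int[lam a]_x \int[lam b]_y f (row_mx x y).
Proof.
move=> mf f0.
have mrow : measurable_fun setT
    (fun z : 'rV[R]_a * 'rV[R]_b => row_mx z.1 z.2 : 'rV[R]_(a + b)).
  apply: measurable_fun_rV => i; case: (splitP i) => j ij.
  - rewrite (_ : i = lshift b j); last exact/val_inj.
    by under eq_fun do rewrite row_mxEl; exact: measurable_coordT.
  - rewrite (_ : i = rshift a j); last exact/val_inj.
    by under eq_fun do rewrite row_mxEr; exact: measurable_coordT.
transitivity (\int[image_measure (lam a \x lam b) mrow]_x f x).
  apply: ge0_integral_rV_unique => B mB; rewrite /image_measure/= /pushforward.
  rewrite (_ : _ @^-1` _ = box (fun i => B (lshift b i)) `*` box (fun j => B (rshift a j))).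
    rewrite product_measure1E//; [|exact: measurable_box..].
    by rewrite big_split_ord/=; congr (_ * _); apply/esym; exact: lebesgue_rV_box.
  apply/seteqP; split => -[x y] /=.
    by move=> H; split => i; [have := H (lshift b i); rewrite row_mxEl|
      have := H (rshift a i); rewrite row_mxEr].
  move=> [Bx By] i; case: (splitP i) => j ij.
  - by rewrite (_ : i = lshift b j); [rewrite row_mxEl|exact/val_inj].
  - by rewrite (_ : i = rshift a j); [rewrite row_mxEr|exact/val_inj].
rewrite ge0_integral_pushforward// preimage_setT fubini_tonelli1//.
  exact: measurableT_comp.
by move=> x; exact: f0.
Qed.

End lebesgue_rV_invariance.

(** * Gamma mixtures *)

Section gamma_integrals.
Context {R : realType}.
Notation mu := (@lebesgue_measure R).

(** The unnormalised Gamma density of shape [p] and rate [c], extended by zero to [t <= 0] so that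
    all integrals run over the whole line. *)
Definition gammaw (p c t : R) : R :=
  (0 < t)%R%:R * (t `^ (p - 1) * expR (- (c * t))).

Lemma gammaw_ge0 p c t : 0 <= gammaw p c t.
Proof. by rewrite mulr_ge0// mulr_ge0 ?powR_ge0 ?expR_ge0. Qed.

Lemma measurable_bool_real d (T : measurableType d) (b : T -> bool) :
  measurable_fun setT b -> measurable_fun setT (fun x => (b x)%:R : R).
Proof.
by move=> mb; apply: (measurableT_comp (f := fun b : bool => b%:R : R)).
Qed.

Lemma measurable_fun_powR d (T : measurableType d) (p : R) (f : T -> R) :
  measurable_fun setT f -> measurable_fun setT (fun x => f x `^ p).
Proof. by move=> mf; apply: (measurableT_comp (measurable_powR p) mf). Qed.

Lemma measurable_gammaw d (T : measurableType d) (p : R) (c t : T -> R) :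
  measurable_fun setT c -> measurable_fun setT t ->
  measurable_fun setT (fun x => gammaw p (c x) (t x)).
Proof.
move=> mc mt; apply: measurable_funM.
  by apply: measurable_bool_real; exact: measurable_fun_ltr.
apply: measurable_funM; first exact: measurable_fun_powR.
apply: measurableT_comp => //.
by apply: measurable_funN; exact: measurable_funM.
Qed.

(** The integrand is singular at 0 when [p < 1]: exhaust by the intervals from [n.+1%:R^-1] to 1,
    apply the fundamental theorem on each, and pass to the limit. *)
Lemma integral_powR_01 (p : R) : 0 < p ->
  (\int[mu]_(t in `]0%R, 1%R]) (t `^ (p - 1))%:E <= p^-1%:E)%E.
Proof.
move=> p0.
pose F (n : nat) : set R := `[n.+1%:R^-1, 1]%classic.
have FE : `]0%R, 1%R]%classic = \bigcup_n F n.
  apply/seteqP; split => x /=.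
    rewrite in_itv/= => /andP[x0 x1]; exists (Num.truncn x^-1) => //.
    rewrite /F/= in_itv/= x1 andbT -[leRHS]invrK lef_pV2 ?posrE ?invr_gt0//.
    exact/ltW/truncnS_gt.
  by move=> [n _]; rewrite /F/= !in_itv/= => /andP[nx ->]; rewrite andbT (lt_le_trans _ nx).
have mp : measurable_fun setT (fun t : R => (t `^ (p - 1))%:E).
  by apply/measurable_EFinP; exact: measurable_powR.
have cvgF : (\int[mu]_(t in F n) (t `^ (p - 1))%:E @[n --> \oo] -->
   \int[mu]_(t in \bigcup_n F n) (t `^ (p - 1))%:E)%E.
  apply: ge0_nondecreasing_set_cvg_integral.
  - apply/nondecreasing_seqP => n; rewrite subsetEset => x; rewrite /F/= !in_itv/=.
    move=> /andP[nx ->]; rewrite andbT (le_trans _ nx)// lef_pV2 ?posrE// ler_nat.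
    exact: leqW.
  - by move=> n; exact: measurable_itv.
  - by move=> n; exact: measurable_funTS.
  - by move=> n x _; rewrite lee_fin powR_ge0.
rewrite FE; apply: cvge_le cvgF; apply: nearW => n.
have n0 : 0 < n.+1%:R^-1 :> R by [].
have dpow (x : R) : 0 < x -> is_derive x 1 (fun t => t `^ p / p) (x `^ (p - 1)).
  move=> x0; have xin : x \in `]0, +oo[ by rewrite in_itv/= x0.
  have dx := @derivable_powR R 1 p x xin.
  have D1 : is_derive x 1 (fun t : R => t `^ p) (p * x `^ (p - 1)).
    by apply: DeriveDef => //; rewrite -derive1E; exact: powR_derive1.
  rewrite (_ : (fun t => t `^ p / p) = p^-1 \*: (fun t : R => t `^ p)).
    by apply: is_derive_eq; rewrite /GRing.scale/= mulrA mulVf ?mul1r// gt_eqF.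
  by apply/funext => t; rewrite mulrC.
have cpow (q x : R) : 0 < x -> {for x, continuous (fun t : R => t `^ q)}.
  move=> x0; apply: differentiable_continuous; apply/derivable1_diffP.
  by apply: derivable_powR; rewrite in_itv/= x0.
case: n n0 => [|n] n0.
  rewrite /F invr1 set_itv1 integral_set1 lee_fin invr_ge0 ltW//.
have n1 : (n.+2%:R^-1 < 1 :> R) by rewrite invf_lt1// ltr1n.
rewrite (continuous_FTC2 (F := fun t => t `^ p / p))//.
- rewrite powR1 mul1r -EFinB lee_fin gerDl oppr_le0.
  by rewrite divr_ge0 ?powR_ge0// ltW.
- apply: continuous_in_subspaceT => x /set_mem/=; rewrite in_itv/= => /andP[nx _].
  by apply: cpow; exact: lt_le_trans nx.
- have c x : 0 < x -> {for x, continuous (fun t => t `^ p / p)}.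
    by move=> x0; apply: cvgM; [exact: cpow|exact: cvg_cst].
  split.
  + move=> x; rewrite in_itv/= => /andP[nx _].
    by have [] := dpow x (lt_trans n0 nx).
  + by apply: cvg_at_right_filter; exact: c.
  + by apply: cvg_at_left_filter; exact: c.
- move=> x; rewrite in_itv/= => /andP[nx _].
  by rewrite derive1E; have [_] := dpow x (lt_trans n0 nx).
Qed.

Lemma powR_le_expR (p t : R) : 1 <= t ->
  t `^ (p - 1) <= expR (`|p - 1| * ln (2 * (`|p - 1| + 1))) * expR (t / 2).
Proof.
move=> t1; have t0 : 0 < t by exact: lt_le_trans t1.
rewrite /powR gt_eqF// -expRD ler_expR.
set a := `|p - 1|; have a0 : 0 <= a by exact: normr_ge0.
have M0 : 0 < 2 * (a + 1) by rewrite mulr_gt0// ltr_wpDl.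
have lnt0 : 0 <= ln t by rewrite ln_ge0.
apply: (@le_trans _ _ (a * ln t)); first by rewrite ler_wpM2r// ler_norm.
(* Write [t] as [t / M] times [M] with [M = 2 * (a + 1)]; then a ln(t/M) is at most a t/M, hence at
   most t/2. *)
rewrite -[in ln t](divfK (lt0r_neq0 M0) t) lnM ?posrE ?divr_gt0// addrC mulrDr lerD2l.
apply: (@le_trans _ _ (a * (t / (2 * (a + 1))))).
  rewrite ler_wpM2l// ltW// ln_sublinear// divr_gt0//.
rewrite invfM mulrA mulrCA mulrA.
rewrite ler_pdivrMr ?ltr_wpDl//.
by nra.
Qed.

Lemma integral_gammaw1_fin (p : R) : 0 < p ->
  (\int[mu]_t (gammaw p 1 t)%:E < +oo)%E.
Proof.
move=> p0.
set C := expR (`|p - 1| * ln (2 * (`|p - 1| + 1))).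
have C0 : 0 <= C by exact: expR_ge0.
(* The dominating function: the power on the interval from 0 to 1, and beyond it an exponential
   density of rate 1/2, whose normalisation the factor 2 undoes. *)
pose g t : \bar R := (((fun t => (t `^ (p - 1))%:E) \_ `]0%R, 1%R]) t +
  (C * 2)%:E * (exponential_pdf (2^-1) t)%:E)%E.
have me : measurable_fun setT (fun t : R => (exponential_pdf (2^-1) t)%:E).
  by apply/measurable_EFinP; exact: measurable_exponential_pdf.
have m1 : measurable_fun setT ((fun t : R => (t `^ (p - 1))%:E) \_ `]0%R, 1%R]).
  apply/(measurable_restrictT _ (measurable_itv _)).
  by apply: measurable_funTS; apply/measurable_EFinP; exact: measurable_powR.
have m2 : measurable_fun setT (fun t : R => (C * 2)%:E * (exponential_pdf (2^-1) t)%:E)%E.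
  exact: measurable_funeM.
have r1 t : (0 <= ((fun t => (t `^ (p - 1))%:E) \_ `]0%R, 1%R]) t)%E.
  by rewrite patchE; case: ifP => // _; rewrite lee_fin powR_ge0.
have e0 t : 0 <= exponential_pdf (2^-1 : R) t by rewrite exponential_pdf_ge0.
apply: (@le_lt_trans _ _ (\int[mu]_t g t)%E).
  apply: ge0_le_integral => //.
  - by move=> t _; rewrite lee_fin gammaw_ge0.
  - by apply/measurable_EFinP; exact: measurable_gammaw.
  - exact: emeasurable_funD.
  move=> t _; rewrite /g patchE.
  have [t0|t0] := ltP 0 t; last first.
    rewrite /gammaw ltNge t0/= mul0r adde_ge0//.
      by case: ifP => // _; rewrite lee_fin powR_ge0.
    by rewrite lee_fin mulr_ge0// mulr_ge0.
  rewrite /gammaw t0 mul1r mul1r.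
  have [t1|t1] := leP t 1.
    rewrite ifT; last by rewrite inE/= in_itv/= t0.
    rewrite -EFinM -EFinD lee_fin ler_wpDr//; first by rewrite mulr_ge0// mulr_ge0.
    by rewrite ler_piMr ?powR_ge0// -expR0 ler_expR oppr_le0 ltW.
  rewrite ifF; last by apply: memNset => /=; rewrite in_itv/= => /andP[_]; rewrite leNgt t1.
  rewrite add0e -EFinM lee_fin exponential_pdfE; last exact: ltW.
  rewrite mulrA mulfK ?pnatr_eq0//.
  apply: (@le_trans _ _ (C * expR (t / 2) * expR (- t))).
    by rewrite ler_wpM2r ?expR_ge0//; apply: powR_le_expR; exact: ltW.
  rewrite -mulrA -expRD ler_wpM2l// ler_expR mulNr [X in _ - X]splitr opprD.
  by rewrite addrA (mulrC _ t) subrr add0r.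
rewrite ge0_integralD//; last by move=> t _; rewrite -EFinM lee_fin mulr_ge0// mulr_ge0.
rewrite ge0_integralZl//; last 2 first.
- by move=> t _; rewrite lee_fin.
- by rewrite lee_fin mulr_ge0.
rewrite integral_exponential_pdf// mule1 -integral_mkcond.
by apply: lte_add_pinfty; [exact: le_lt_trans (integral_powR_01 p0) (ltry _)|exact: ltry].
Qed.

(** [Gamma] is a real-valued integral, that is, the finite part of an extended one; finiteness makes
    the two agree. *)
Lemma integral_gammaw1 (p : R) : 0 < p ->
  (\int[mu]_t (gammaw p 1 t)%:E)%E = (Gamma p)%:E.
Proof.
move=> p0; rewrite /Gamma /Rintegral.
rewrite (_ : (\int[mu]_(t in `]0%R, +oo[) _)%E = (\int[mu]_t (gammaw p 1 t)%:E)%E).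
  rewrite fineK// ge0_fin_numE ?integral_gammaw1_fin//.
  by apply: integral_ge0 => t _; rewrite lee_fin gammaw_ge0.
rewrite integral_mkcond; apply: eq_integral => t _; rewrite patchE /gammaw.
have [t0|t0] := ltP 0 t.
  by rewrite ifT ?mul1r// inE/= in_itv/= t0.
by rewrite mul0r ifF//; apply: memNset; rewrite /= in_itv/= andbT ltNge t0.
Qed.

(** On [1, 2] the integrand is bounded below by a positive constant. *)
Lemma Gamma_gt0 (p : R) : 0 < p -> 0 < Gamma p.
Proof.
move=> p0; rewrite -lte_fin -integral_gammaw1//.
apply: (@lt_le_trans _ _ (\int[mu]_(t in `[1%R, 2%R]) (expR (- `|p - 1| * 2 - 2))%:E)%E).
  rewrite integral_cst//= lebesgue_measure_itv/= lte_fin ltr1n/= -EFinB -EFinM.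
  by rewrite lte_fin mulr_gt0 ?expR_gt0// subr_gt0 ltr1n.
apply: (@le_trans _ _ (\int[mu]_(t in `[1%R, 2%R]) (gammaw p 1 t)%:E)%E); last first.
  apply: ge0_subset_integral => //.
  - by apply/measurable_EFinP; exact: measurable_gammaw.
  - by move=> t _; rewrite lee_fin gammaw_ge0.
apply: ge0_le_integral => //.
- by apply/measurable_EFinP/measurable_funTS; exact: measurable_gammaw.
move=> t /=; rewrite in_itv/= => /andP[t1 t2]; rewrite lee_fin /gammaw.
have t0 : 0 < t by exact: lt_le_trans t1.
rewrite t0 !mul1r /powR gt_eqF// -expRD ler_expR lerD//; last by rewrite lerN2.
have lnt0 : 0 <= ln t by rewrite ln_ge0.
apply: (@le_trans _ _ (- `|p - 1| * ln t)).
  rewrite !mulNr lerN2 ler_wpM2l// (le_trans _ t2)// ltW// ln_sublinear//.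
by rewrite ler_wpM2r// lerNl -normrN ler_norm.
Qed.

Lemma integral_gammaw (p c : R) : 0 < p -> 0 < c ->
  (\int[mu]_t (gammaw p c t)%:E)%E = (Gamma p * c `^ (- p))%:E.
Proof.
move=> p0 c0.
have cN0 : c != 0 by rewrite gt_eqF.
have E t : gammaw p c t = c `^ (1 - p) * gammaw p 1 (c * t).
  rewrite /gammaw pmulr_rgt0// mul1r; have [t0|] := ltP 0 t; last by rewrite !mul0r mulr0.
  rewrite !mul1r powRM ?ltW// !mulrA -powRD; last by rewrite cN0 implybT.
  by rewrite (_ : 1 - p + (p - 1) = 0) ?powRr0 ?mul1r//; ring.
under eq_integral do rewrite E EFinM.
have mg : measurable_fun setT (fun t => (gammaw p 1 t)%:E).
  by apply/measurable_EFinP; exact: measurable_gammaw.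
rewrite ge0_integralZl//; last 3 first.
- by apply: (measurableT_comp mg); exact: measurable_funM.
- by move=> t _; rewrite lee_fin gammaw_ge0.
- by rewrite lee_fin powR_ge0.
rewrite (ge0_integral_scale (f := fun t => (gammaw p 1 t)%:E))//; last first.
  by move=> t; rewrite lee_fin gammaw_ge0.
rewrite integral_gammaw1// -!EFinM; congr EFin.
rewrite mulrCA mulrA mulrC; congr (_ * _).
rewrite -powR_inv1 ?ltW// -powRD; last by rewrite cN0 implybT.
by rewrite addrA addNr add0r.
Qed.

Lemma integral_gauss (w : R) : 0 < w ->
  (\int[mu]_x (expR (- (w * x ^+ 2)))%:E)%E = (Num.sqrt pi * w `^ (- 2^-1))%:E.
Proof.
move=> w0.
have s0 : 0 < Num.sqrt w by rewrite sqrtr_gt0.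
have mg : measurable_fun setT (fun t : R => (gauss_fun t)%:E).
  by apply/measurable_EFinP; exact: measurable_gauss_fun.
have := ge0_integral_scale (f := fun t : R => (gauss_fun t)%:E) s0 mg.
rewrite integralT_gauss => H; rewrite mulrC EFinM powRN powR12_sqrt ?ltW// -H.
  by apply: eq_integral => x _; rewrite /gauss_fun exprMn sqr_sqrtr// ltW.
by move=> x; rewrite lee_fin gauss_fun_ge0.
Qed.

(** Writing the power as a Gamma integral in an auxiliary variable [t] turns the integrand into a
    mixture of centered Gaussians in [x], which are integrated first. *)
Lemma integral_beta'1 (b : R) : 2^-1 < b ->
  (\int[mu]_x ((1 + x ^+ 2) `^ (- b))%:E)%E =
  (Num.sqrt pi * Gamma (b - 2^-1) / Gamma b)%:E.
Proof.
move=> b12; have b0 : 0 < b by exact: lt_trans b12.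
have b120 : 0 < b - 2^-1 by rewrite subr_gt0.
have G0 := Gamma_gt0 b0.
have GN0 : Gamma b != 0 by rewrite gt_eqF.
have x0 (x : R) : 0 < 1 + x ^+ 2 by rewrite ltr_pwDl// sqr_ge0.
have mf : measurable_fun setT (fun x : R => (1 + x ^+ 2) `^ (- b)).
  by apply: measurable_fun_powR; apply: measurable_funD.
transitivity (\int[mu]_x ((Gamma b)^-1%:E * \int[mu]_t (gammaw b (1 + x ^+ 2) t)%:E))%E.
  apply: eq_integral => x _; rewrite integral_gammaw// -EFinM.
  by rewrite mulrA mulVf ?mul1r.
have mg : measurable_fun setT (fun z : R * R => (gammaw b (1 + z.1 ^+ 2) z.2)%:E).
  apply/measurable_EFinP; apply: measurable_gammaw => //.
  by apply: measurable_funD => //; exact: measurable_funX.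
have mI := measurable_tonelli1 (f := fun x t : R => (gammaw b (1 + x ^+ 2) t)%:E) mu mg.
rewrite ge0_integralZl//; last 3 first.
- by apply: mI => x t; rewrite lee_fin gammaw_ge0.
- by move=> x _; apply: integral_ge0 => t _; rewrite lee_fin gammaw_ge0.
- by rewrite lee_fin invr_ge0 ltW.
rewrite mulrC EFinM; congr (_ * _)%E.
rewrite tonelli//; last first.
  by move=> x t; rewrite lee_fin gammaw_ge0.
transitivity (\int[mu]_t ((Num.sqrt pi)%:E * (gammaw (b - 2^-1) 1 t)%:E))%E.
  apply: eq_integral => t _; have [t0|t0] := ltP 0 t; last first.
    rewrite /gammaw ltNge t0/= mul0r mule0 integral0_eq// => x _.
    by rewrite mul0r.
  have E x : (gammaw b (1 + x ^+ 2) t)%:E =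
     ((t `^ (b - 1) * expR (- t))%:E * (expR (- (t * x ^+ 2)))%:E)%E.
    rewrite -EFinM /gammaw t0 mul1r -mulrA -expRD; congr (_ * expR _)%:E.
    by rewrite mulrDl mul1r opprD mulrC.
  under eq_integral do rewrite E.
  rewrite ge0_integralZl//; last 2 first.
  - apply/measurable_EFinP; apply: measurableT_comp => //.
    by apply: measurable_funN; apply: measurable_funM => //; exact: measurable_funX.
  - by rewrite lee_fin mulr_ge0 ?powR_ge0 ?expR_ge0.
  rewrite integral_gauss// -!EFinM mulrCA; congr (_ * _)%:E.
  rewrite /gammaw t0 !mul1r mulrAC -powRD; last by rewrite (gt_eqF t0) implybT.
  by rewrite addrAC.
rewrite ge0_integralZl; [|by []| | |by rewrite lee_fin sqrtr_ge0].
- by rewrite integral_gammaw1.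
- by apply/measurable_EFinP; exact: measurable_gammaw.
- by move=> x _; rewrite lee_fin gammaw_ge0.
Qed.

End gamma_integrals.

(** * Weighted means *)

Section weighted_mean.
Context {R : realType}.
Notation mu := (@lebesgue_measure R).
Notation lam := (lebesgue_rV R).

Section def.
Variable m : nat.
Implicit Types w t : 'rV[R]_m.

Definition wsum w : R := \sum_i w 0 i.
Definition wmean w t : R := (\sum_i w 0 i * t 0 i) / wsum w.
Definition wvar w t : R := \sum_i w 0 i * (t 0 i - wmean w t) ^+ 2.
Definition above (k : nat) w t : bool :=
  [forall i : 'I_m, (k <= i)%N ==> (wmean w t <= t 0 i)].

Lemma wmean_shift w t (l : R) : 0 < wsum w ->
  wmean w (t + const_mx l) = wmean w t + l.
Proof.
move=> w0; rewrite /wmean -[X in _ = _ + X](mulfK (lt0r_neq0 w0)) -mulrDl.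
congr (_ / _); rewrite mulrC /wsum mulr_suml -big_split/=.
by apply: eq_bigr => i _; rewrite !mxE mulrDr.
Qed.

Lemma wvar_shift w t (l : R) : 0 < wsum w ->
  wvar w (t + const_mx l) = wvar w t.
Proof.
move=> w0; apply: eq_bigr => i _; rewrite wmean_shift// !mxE.
by congr (_ * _ ^+ 2); ring.
Qed.

Lemma above_shift k w t (l : R) : 0 < wsum w ->
  above k w (t + const_mx l) = above k w t.
Proof.
move=> w0; apply: eq_forallb => i; rewrite wmean_shift// !mxE.
by rewrite lerD2r.
Qed.

Lemma wmeanZ w t (c : R) : wmean w (c *: t) = c * wmean w t.
Proof.
rewrite /wmean mulrA mulr_sumr; congr (_ / _).
by apply: eq_bigr => i _; rewrite !mxE mulrCA.
Qed.

Lemma wvarZ w t (c : R) : wvar w (c *: t) = c ^+ 2 * wvar w t.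
Proof.
rewrite /wvar mulr_sumr; apply: eq_bigr => i _; rewrite wmeanZ !mxE.
by rewrite -mulrBr exprMn mulrCA.
Qed.

Lemma aboveZ k w t (c : R) : 0 < c -> above k w (c *: t) = above k w t.
Proof.
move=> c0; apply: eq_forallb => i; rewrite wmeanZ !mxE.
by rewrite ler_pM2l.
Qed.

Lemma wsumZ (c : R) w : wsum (c *: w) = c * wsum w.
Proof. by rewrite /wsum mulr_sumr; apply: eq_bigr => i _; rewrite mxE. Qed.

Lemma wmeanZw w t (c : R) : c != 0 -> wmean (c *: w) t = wmean w t.
Proof.
move=> c0; rewrite /wmean wsumZ.
rewrite (_ : \sum_i _ = c * \sum_i w 0 i * t 0 i); first by rewrite -mulf_div divff// mul1r.
by rewrite mulr_sumr; apply: eq_bigr => i _; rewrite mxE mulrA.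
Qed.

Lemma wvarZw w t (c : R) : c != 0 -> wvar (c *: w) t = c * wvar w t.
Proof.
move=> c0; rewrite /wvar mulr_sumr; apply: eq_bigr => i _.
by rewrite wmeanZw// mxE mulrA.
Qed.

Lemma aboveZw k w t (c : R) : c != 0 -> above k (c *: w) t = above k w t.
Proof. by move=> c0; apply: eq_forallb => i; rewrite wmeanZw. Qed.

(** The parallel axis identity. It splits the exponent of a product of Gaussians into a part fixed
    by translations along the diagonal and a part in the weighted mean alone. *)
Lemma wvarE w t : 0 < wsum w ->
  \sum_i w 0 i * t 0 i ^+ 2 = wvar w t + wsum w * wmean w t ^+ 2.
Proof.
move=> w0; set M := wmean w t.
have MwE : \sum_i w 0 i * t 0 i = wsum w * M.
  by rewrite /M /wmean mulrC divfK// lt0r_neq0.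
rewrite /wvar -/M.
transitivity (\sum_i (w 0 i * (t 0 i - M) ^+ 2 + ((w 0 i * t 0 i) * (2 * M) - w 0 i * M ^+ 2))).
  by apply: eq_bigr => i _; ring.
rewrite big_split/=; congr (_ + _).
rewrite big_split/= sumrN -!mulr_suml MwE -/(wsum w); ring.
Qed.

Definition wpos w : bool := [forall i : 'I_m, 0 < w 0 i].

Lemma wsum_gt0 w : (0 < m)%N -> wpos w -> 0 < wsum w.
Proof.
move=> m0 /forallP w0; rewrite /wsum (bigD1 (Ordinal m0))//=.
by rewrite ltr_wpDr// sumr_ge0// => i _; exact/ltW/w0.
Qed.

End def.

Lemma measurable_invr : measurable_fun [set: R] (fun x : R => x^-1).
Proof.
rewrite (_ : (fun x => _) = (fun x : R => if 0 <= x then x `^ (-1) else - ((- x) `^ (-1)))).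
  apply: measurable_fun_ifT.
  - exact: measurable_fun_ler.
  - exact: measurable_fun_powR.
  - by apply: measurable_funN; apply: measurable_fun_powR; exact: measurable_funN.
apply/funext => x; case: ifPn => [x0|]; first by rewrite powR_inv1.
by rewrite -ltNge => x0; rewrite powR_inv1 ?oppr_ge0 ?ltW// invrN opprK.
Qed.

Lemma measurable_wmean d (T : measurableType d) (m : nat) (w t : T -> 'rV[R]_m) :
  measurable_fun setT w -> measurable_fun setT t ->
  measurable_fun setT (fun x => wmean (w x) (t x)).
Proof.
move=> mw mt; apply: measurable_funM.
  by apply: measurable_sum => i; apply: measurable_funM; exact: measurable_coordT.
apply: (measurableT_comp measurable_invr).
by apply: measurable_sum => i; exact: measurable_coordT.
Qed.

Lemma measurable_wvar d (T : measurableType d) (m : nat) (w t : T -> 'rV[R]_m) :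
  measurable_fun setT w -> measurable_fun setT t ->
  measurable_fun setT (fun x => wvar (w x) (t x)).
Proof.
move=> mw mt; apply: measurable_sum => i; apply: measurable_funM.
  exact: measurable_coordT.
apply: measurable_funX; apply: measurable_funB; first exact: measurable_coordT.
exact: measurable_wmean.
Qed.

Lemma measurable_forallb d (T : measurableType d) (I : finType) (b : I -> T -> bool) :
  (forall i, measurable_fun setT (b i)) ->
  measurable_fun setT (fun x => [forall i, b i x]).
Proof.
move=> mb; rewrite (_ : (fun x => _) = (fun x => \big[andb/true]_(i <- enum I) b i x)).
  elim: (enum I) => [|i s IH]; first by under eq_fun do rewrite big_nil; exact: measurable_cst.
  by under eq_fun do rewrite big_cons; exact: measurable_and.
apply/funext => x; rewrite big_all/=; apply/forallP/allP => [H i _|H i] //.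
by apply: H; rewrite mem_enum.
Qed.

Lemma measurable_above d (T : measurableType d) (m k : nat) (w t : T -> 'rV[R]_m) :
  measurable_fun setT w -> measurable_fun setT t ->
  measurable_fun setT (fun x => above k (w x) (t x)).
Proof.
move=> mw mt; apply: measurable_forallb => i.
case: (k <= i)%N => /=; last by [].
by apply: measurable_fun_ler; [exact: measurable_wmean|exact: measurable_coordT].
Qed.

Lemma measurable_wpos d (T : measurableType d) (m : nat) (w : T -> 'rV[R]_m) :
  measurable_fun setT w ->
  measurable_fun setT (fun x => wpos (w x)).
Proof.
move=> mw; apply: measurable_forallb => i.
by apply: measurable_fun_ltr => //; exact: measurable_coordT.
Qed.

Local Open Scope ereal_scope.

(** Used as a slab in the weighted mean: it cuts the lines parallel to the diagonal to unit length,
    so that shift-invariant functions can have finite integrals. *)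
Definition unitb (x : R) : \bar R := ((0 <= x <= 1)%R%:R)%:E.

Lemma unitb_ge0 x : 0 <= unitb x.
Proof. by rewrite lee_fin. Qed.

Lemma measurable_unitb d (T : measurableType d) (f : T -> R) :
  measurable_fun setT f -> measurable_fun setT (fun x => unitb (f x)).
Proof.
move=> mf; apply/measurable_EFinP; apply: measurable_bool_real.
by apply: measurable_and; exact: measurable_fun_ler.
Qed.

Lemma integral_unitb_itv (f : R -> R) (a b : R) : (a <= b)%R ->
  (forall l, (0 <= f l <= 1)%R = (a <= l <= b)%R) ->
  \int[mu]_l unitb (f l) = (b - a)%:E.
Proof.
move=> ab fE; transitivity (\int[mu]_(l in `[a, b]%classic) (1%R)%:E).
  rewrite [RHS]integral_mkcond; apply: eq_integral => l _.
  rewrite /unitb patchE fE; case: ifPn => [|].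
    by rewrite inE/= in_itv/= => ->.
  by rewrite notin_setE/= in_itv/= => /negP/negbTE ->.
rewrite integral_cst//= mul1e lebesgue_measure_itv/= lte_fin.
case: ifPn => //; rewrite -leNgt => ba.
by rewrite (@le_anti _ _ a b) ?subrr// ab.
Qed.

Section averaging.
Variables (m : nat) (w : 'rV[R]_m) (k : 'rV[R]_m -> \bar R).
Hypothesis w0 : (0 < wsum w)%R.
Hypotheses (mk : measurable_fun setT k) (k0 : forall t, 0 <= k t).
Hypothesis kshift : forall t l, k (t + const_mx l)%R = k t.

Let mwm : measurable_fun setT (fun t : 'rV[R]_m => wmean w t).
Proof. exact: measurable_wmean. Qed.

(* The translations along the diagonal act on [t] without changing [k] and act
   on the weighted mean by translations. *)
Lemma integral_wmean (phi : R -> \bar R) :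
  measurable_fun setT phi -> (forall x, 0 <= phi x) ->
  \int[lam m]_t (k t * phi (wmean w t)) =
  (\int[lam m]_t (k t * unitb (wmean w t))) * \int[mu]_x phi x.
Proof.
move=> mphi phi0.
have mphiw : measurable_fun setT (fun t : 'rV[R]_m => phi (wmean w t)).
  exact: measurableT_comp mphi mwm.
have Iphi : 0 <= \int[mu]_x phi x by exact: integral_ge0.
transitivity (\int[lam m]_t \int[mu]_l (k t * phi (wmean w t) * unitb (wmean w t - l)%R)).
  apply: eq_integral => t _; rewrite ge0_integralZl//; last 3 first.
  - by apply: measurable_unitb; exact: measurable_funB.
  - by move=> l _; exact: unitb_ge0.
  - exact: mule_ge0.
  rewrite (integral_unitb_itv (a := (wmean w t - 1)%R) (b := wmean w t))//.
  - by rewrite opprB addrC subrK mule1.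
  - by rewrite gerBl.
  - by move=> l; rewrite subr_ge0 lerBlDr andbC [in LHS]addrC -lerBlDr.
rewrite tonelli; last 2 first.
- apply: emeasurable_funM.
    apply: emeasurable_funM; first exact: measurableT_comp mk _.
    exact: measurableT_comp mphiw _.
  apply: measurable_unitb; apply: measurable_funB => //.
  exact: measurableT_comp mwm _.
- by move=> t l; rewrite mule_ge0 ?unitb_ge0// mule_ge0.
transitivity (\int[mu]_l \int[lam m]_t (k t * unitb (wmean w t) * phi (wmean w t + l)%R)).
  apply: eq_integral => l _.
  rewrite -[LHS](ge0_integral_rV_shift (const_mx l)); last 2 first.
  - apply: emeasurable_funM; first exact: emeasurable_funM.
    by apply: measurable_unitb; exact: measurable_funB.
  - by move=> t; rewrite mule_ge0 ?unitb_ge0// mule_ge0.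
  by apply: eq_integral => t _; rewrite kshift wmean_shift// addrK muleAC.
rewrite tonelli; last 2 first.
- apply: emeasurable_funM.
    apply: emeasurable_funM; first exact: measurableT_comp mk _.
    by apply: measurable_unitb; exact: measurableT_comp mwm _.
  apply: measurableT_comp mphi _; apply: measurable_funD => //.
  exact: measurableT_comp mwm _.
- by move=> t l; rewrite mule_ge0 ?unitb_ge0// mule_ge0 ?unitb_ge0.
rewrite -ge0_integralZr//; last 2 first.
- by apply: emeasurable_funM => //; exact: measurable_unitb.
- by move=> t _; rewrite mule_ge0 ?unitb_ge0.
apply: eq_integral => t _; rewrite ge0_integralZl//; last 2 first.
- by apply: measurableT_comp mphi _; exact: measurable_funD.
- by rewrite mule_ge0 ?unitb_ge0.
congr (_ * _); under eq_integral do rewrite addrC.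
by rewrite ge0_integral_shift.
Qed.

(** The dilation contributes [c ^- m]; it also turns the slab of unit width into one of width [c],
    hence the extra factor [c]. *)
Lemma integral_unitb_scale (c : R) : (0 < c)%R ->
  \int[lam m]_t (k (c *: t)%R * unitb (wmean w t)) =
  (c * c ^- m)%:E * \int[lam m]_t (k t * unitb (wmean w t)).
Proof.
move=> c0.
have mu1 : measurable_fun setT (fun x => unitb (c^-1 * x)%R).
  by apply: measurable_unitb; exact: measurable_funM.
transitivity (\int[lam m]_t ((fun t => k t * unitb (c^-1 * wmean w t)%R) (c *: t)%R)).
  by apply: eq_integral => t _; rewrite wmeanZ mulKf ?gt_eqF.
rewrite (ge0_integral_rV_scale (f := fun t => k t * unitb (c^-1 * wmean w t)%R))//; last 2 first.
- apply: emeasurable_funM => //; apply: measurable_unitb.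
  exact: measurable_funM.
- by move=> t; rewrite mule_ge0 ?unitb_ge0.
rewrite (integral_wmean (phi := fun x => unitb (c^-1 * x)%R))//; last first.
  by move=> x; exact: unitb_ge0.
rewrite (integral_unitb_itv (a := 0%R) (b := c)).
- by rewrite subr0 [X in _ * X = _]muleC muleA -EFinM mulrC.
- exact: ltW.
- by move=> l; rewrite pmulr_rge0 ?invr_gt0// ler_pdivrMl// mulr1.
Qed.

End averaging.

End weighted_mean.

(** * The law of the weighted mean *)

Section mean_law.
Context {R : realType}.
Notation mu := (@lebesgue_measure R).
Notation lam := (lebesgue_rV R).

(** Up to a constant, the joint density of Gamma weights of shape p - 1/2 and of numbers that, given
    the weights, are centered Gaussian with exponents [w 0 i]. Integrating out the weights leaves
    beta' densities of exponent [p]. *)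
Definition rho (m : nat) (p : R) (w t : 'rV[R]_m) : R :=
  \prod_i gammaw p (1 + t 0 i ^+ 2) (w 0 i).

Definition gprod (m : nat) (p : R) (w : 'rV[R]_m) : R :=
  (wpos w)%:R * \prod_i (w 0 i `^ (p - 1)).

Lemma rho_ge0 m p (w t : 'rV[R]_m) : 0 <= rho p w t.
Proof. by apply: prodr_ge0 => i _; exact: gammaw_ge0. Qed.

Lemma gprod_ge0 m p (w : 'rV[R]_m) : 0 <= gprod p w.
Proof. by rewrite mulr_ge0// prodr_ge0// => i _; exact: powR_ge0. Qed.

Lemma prod_pos (I : finType) (b : I -> bool) :
  \prod_i (b i)%:R = [forall i, b i]%:R :> R.
Proof.
have [/forallP bT|/forallPn[i bi]] := boolP [forall i, b i].
  by rewrite big1// => i _; rewrite bT.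
by rewrite (bigD1 i)//= (negbTE bi) mul0r.
Qed.

(** The three factors are homogeneous in the weights, shift-invariant in [t], and dependent on [t]
    through its mean only, respectively. *)
Lemma rhoE m p (w t : 'rV[R]_m) : (0 < m)%N ->
  rho p w t = gprod p w * expR (- wvar w t) *
    expR (- (wsum w * (1 + wmean w t ^+ 2))).
Proof.
move=> m0; rewrite /rho /gammaw big_split/= prod_pos /gprod -/(wpos w).
have [wp|] := boolP (wpos w); last by rewrite !mul0r.
rewrite !mul1r big_split/= -mulrA -expRD; congr (_ * _).
rewrite -expR_sum; congr expR.
have w0 := wsum_gt0 m0 wp.
rewrite sumrN -opprD; congr (- _).
rewrite (eq_bigr (fun i => w 0 i + w 0 i * t 0 i ^+ 2)); last by move=> i _; ring.
rewrite big_split/= wvarE//= -/(wsum w); ring.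
Qed.

Lemma measurable_rho d (T : measurableType d) m p (w t : T -> 'rV[R]_m) :
  measurable_fun setT w -> measurable_fun setT t ->
  measurable_fun setT (fun x => rho p (w x) (t x)).
Proof.
move=> mw mt; apply: measurable_prod => i _; apply: measurable_gammaw.
  by apply: measurable_funD => //; apply: measurable_funX; exact: measurable_coordT.
exact: measurable_coordT.
Qed.

Lemma measurable_wsum d (T : measurableType d) m (w : T -> 'rV[R]_m) :
  measurable_fun setT w -> measurable_fun setT (fun x => wsum (w x)).
Proof. by move=> mw; apply: measurable_sum => i; exact: measurable_coordT. Qed.

Lemma measurable_gprod d (T : measurableType d) m p (w : T -> 'rV[R]_m) :
  measurable_fun setT w -> measurable_fun setT (fun x => gprod p (w x)).
Proof.
move=> mw; apply: measurable_funM.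
  by apply: measurable_bool_real; exact: measurable_wpos.
apply: measurable_prod => i _; apply: measurable_fun_powR.
exact: measurable_coordT.
Qed.

Lemma gprodZ m p (w : 'rV[R]_m) (c : R) : 0 < c ->
  gprod p (c *: w) = (c `^ (p - 1)) ^+ m * gprod p w.
Proof.
move=> c0; rewrite /gprod.
have -> : wpos (c *: w) = wpos w.
  by apply: eq_forallb => i; rewrite mxE pmulr_rgt0.
have [/forallP wp|] := boolP (wpos w); last by rewrite !mul0r mulr0.
rewrite !mul1r -[in c `^ _ ^+ m](card_ord m) -prodr_const -big_split/=.
by apply: eq_bigr => i _; rewrite mxE powRM// ltW.
Qed.

(** When the weights are dilated, each of the [m] Gamma factors together with its volume element
    contributes [p], and the integral over the slab takes off 1/2 for each of its [m - 1] Gaussian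
    directions. *)
Definition mean_exponent (m : nat) (p : R) : R := m%:R * p - (m%:R - 1) / 2.

Lemma scaling_exponent m (p c s : R) : 0 < c -> c ^+ 2 = s ->
  (c / c ^+ m * s `^ (p - 1) ^+ m)^-1 / s ^+ m = s `^ (- mean_exponent m p).
Proof.
move=> c0 <-; have [L ->] : exists L, c = expR L by exists (ln c); rewrite lnK.
rewrite -!expRM_natl -!expRM -!expRM_natl -!expRN -!expRD -!expRN -!expRD.
by congr expR; rewrite /mean_exponent; field.
Qed.

Local Open Scope ereal_scope.

Section fixed_dimension.
Variables (m k : nat) (p : R).
Hypothesis m0 : (0 < m)%N.

Definition slice (w t : 'rV[R]_m) : \bar R :=
  ((above k w t)%:R * expR (- wvar w t))%:E.

Definition slice_int (w : 'rV[R]_m) : \bar R :=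
  \int[lam m]_t (slice w t * unitb (wmean w t)).

Lemma slice_ge0 w t : 0 <= slice w t.
Proof. by rewrite lee_fin mulr_ge0 ?expR_ge0. Qed.

Lemma measurable_slice d (T : measurableType d) (w t : T -> 'rV[R]_m) :
  measurable_fun setT w -> measurable_fun setT t ->
  measurable_fun setT (fun x => slice (w x) (t x)).
Proof.
move=> mw mt; apply/measurable_EFinP; apply: measurable_funM.
  by apply: measurable_bool_real; exact: measurable_above.
by apply: measurableT_comp => //; apply: measurable_funN; exact: measurable_wvar.
Qed.

Let mslice_unitb : measurable_fun setT
  (fun z : 'rV[R]_m * 'rV[R]_m => slice z.1 z.2 * unitb (wmean z.1 z.2)).
Proof.
apply: emeasurable_funM; first exact: measurable_slice.
by apply: measurable_unitb; exact: measurable_wmean.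
Qed.

Let slice_unitb_ge0 w t : 0 <= slice w t * unitb (wmean w t).
Proof. by rewrite mule_ge0 ?slice_ge0 ?unitb_ge0. Qed.

Lemma slice_int_ge0 w : 0 <= slice_int w.
Proof. by apply: integral_ge0 => t _; exact: slice_unitb_ge0. Qed.

Lemma measurable_slice_int : measurable_fun setT slice_int.
Proof.
exact: (measurable_tonelli1 (f := fun w t => slice w t * unitb (wmean w t))
  (lam m) mslice_unitb slice_unitb_ge0).
Qed.

Lemma slice_intZ (c : R) w : (0 < c)%R -> (0 < wsum w)%R ->
  slice_int (c ^+ 2 *: w)%R = (c * c ^- m)%:E * slice_int w.
Proof.
move=> c0 w0; have c20 : (c ^+ 2 != 0)%R by rewrite expf_neq0// gt_eqF.
transitivity (\int[lam m]_t (slice w (c *: t)%R * unitb (wmean w t))).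
  apply: eq_integral => t _; rewrite /slice aboveZw// wvarZw// wmeanZw//.
  by rewrite aboveZ// wvarZ.
apply: (integral_unitb_scale (k := slice w)) => //.
- exact: measurable_slice.
- exact: slice_ge0.
- by move=> t l; rewrite /slice above_shift// wvar_shift.
Qed.

Let wt (x : R) (w : 'rV[R]_m) : R :=
  (gprod p w * expR (- (wsum w * (1 + x ^+ 2))))%R.

Let wt_ge0 x w : (0 <= wt x w)%R.
Proof. by rewrite mulr_ge0 ?gprod_ge0 ?expR_ge0. Qed.

Let measurable_wt d (T : measurableType d) (x : T -> R) (w : T -> 'rV[R]_m) :
  measurable_fun setT x -> measurable_fun setT w ->
  measurable_fun setT (fun z => wt (x z) (w z)).
Proof.
move=> mx mw; apply: measurable_funM; first exact: measurable_gprod.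
apply: measurableT_comp => //; apply: measurable_funN; apply: measurable_funM.
  exact: measurable_wsum.
by apply: measurable_funD => //; exact: measurable_funX.
Qed.

(** Dilating the weights by [1 + x ^+ 2] removes [x]: the event [above] is unchanged and the
    remaining factors are homogeneous, so a power of [1 + x ^+ 2] comes out, the same for every
    [k]. *)
Let scale_wt (x : R) :
  \int[lam m]_w (slice_int w * (wt x w)%:E) =
  ((1 + x ^+ 2) `^ (- mean_exponent m p))%:E * \int[lam m]_w (slice_int w * (wt 0 w)%:E).
Proof.
set s := (1 + x ^+ 2)%R; have s0 : (0 < s)%R by rewrite ltr_pwDl// sqr_ge0.
pose c := Num.sqrt s; have c0 : (0 < c)%R by rewrite sqrtr_gt0.
have c2 : (c ^+ 2 = s)%R by rewrite sqr_sqrtr// ltW.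
pose C := (c * c ^- m * (s `^ (p - 1)) ^+ m)%R.
have C0 : (0 < C)%R by rewrite !mulr_gt0 ?invr_gt0 ?exprn_gt0 ?powR_gt0.
have E w : slice_int w * (wt x w)%:E =
    (C^-1)%:E * (slice_int (s *: w)%R * (wt 0 (s *: w))%:E).
  rewrite /wt gprodZ// wsumZ expr0n/= addr0 mulr1.
  have [wp|wp] := boolP (wpos w); last first.
    by rewrite /gprod (negbTE wp) !mul0r !mulr0 !mul0r !mule0.
  rewrite -c2 slice_intZ ?wsum_gt0// c2.
  rewrite [LHS]muleC [X in _ = _ * X]muleAC muleA -!EFinM; congr (_%:E * _).
  rewrite -/s (mulrC s).
  rewrite (_ : (c / c ^+ m * (s `^ (p - 1) ^+ m * gprod p w * expR (- (wsum w * s))) =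
     C * (gprod p w * expR (- (wsum w * s))))%R); first by rewrite mulKf ?gt_eqF.
  by rewrite /C !mulrA.
have mQ : measurable_fun setT (fun w => slice_int w * (wt 0 w)%:E).
  apply: emeasurable_funM; first exact: measurable_slice_int.
  by apply/measurable_EFinP; exact: measurable_wt.
have Q0 w : 0 <= slice_int w * (wt 0 w)%:E by rewrite mule_ge0 ?slice_int_ge0 ?lee_fin.
under eq_integral do rewrite E.
rewrite ge0_integralZl; [|by []| | |by rewrite lee_fin invr_ge0 ltW].
- rewrite (ge0_integral_rV_scale (f := fun w => slice_int w * (wt 0 w)%:E))//.
  rewrite muleA -EFinM; congr (_%:E * _).
  exact: scaling_exponent.
- by apply: (measurableT_comp mQ); exact: measurable_rVZ.
- by move=> w _; exact: Q0.
Qed.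

Definition slice_total : \bar R := \int[lam m]_w (slice_int w * (wt 0 w)%:E).

Let integral_rho_slice (Psi : R -> \bar R) w :
  measurable_fun setT Psi -> (forall x, 0 <= Psi x) ->
  \int[lam m]_t ((rho p w t * (above k w t)%:R)%:E * Psi (wmean w t)) =
  \int[mu]_x (slice_int w * (wt x w)%:E * Psi x).
Proof.
move=> mPsi Psi0.
have [wp|wp] := boolP (wpos w); last first.
  rewrite !integral0_eq// => t _; rewrite ?rhoE// /wt /gprod (negbTE wp) !mul0r ?mule0 ?mul0e//.
have w0 := wsum_gt0 m0 wp.
transitivity (\int[lam m]_t (slice w t * ((wt (wmean w t) w)%:E * Psi (wmean w t)))).
  apply: eq_integral => t _; rewrite muleA -EFinM rhoE//; congr (_%:E * _).
  by rewrite /wt; ring.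
have := @integral_wmean R m w (slice w) w0 _ _ _ (fun x => (wt x w)%:E * Psi x).
move=> ->.
- rewrite -/(slice_int w) -ge0_integralZl//.
  + by apply: eq_integral => x _; rewrite muleA.
  + apply: emeasurable_funM => //; apply/measurable_EFinP.
    exact: measurable_wt.
  + by move=> x _; rewrite mule_ge0 ?lee_fin.
  + exact: slice_int_ge0.
- exact: measurable_slice.
- exact: slice_ge0.
- by move=> t l; rewrite /slice above_shift// wvar_shift.
- apply: emeasurable_funM => //; apply/measurable_EFinP.
  exact: measurable_wt.
- by move=> x; rewrite mule_ge0 ?lee_fin.
Qed.

(** The product form says that the weighted mean is independent of the event [above] and has a beta'
    law of exponent [mean_exponent m p]. The constant [slice_total] cancels later. *)
Lemma integral_rho_above_mean (Psi : R -> \bar R) :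
  measurable_fun setT Psi -> (forall x, 0 <= Psi x) ->
  \int[lam m]_w \int[lam m]_t
    ((rho p w t * (above k w t)%:R)%:E * Psi (wmean w t)) =
  slice_total * \int[mu]_x (((1 + x ^+ 2) `^ (- mean_exponent m p))%:E * Psi x).
Proof.
move=> mPsi Psi0.
under eq_integral do rewrite integral_rho_slice//.
have S0 := slice_int_ge0.
have mS := measurable_slice_int.
have T0 : 0 <= slice_total.
  by apply: integral_ge0 => w _; rewrite mule_ge0 ?lee_fin.
have mwx : measurable_fun setT (fun z : 'rV[R]_m * R => (wt z.2 z.1)%:E).
  by apply/measurable_EFinP; exact: measurable_wt.
have ms : measurable_fun setT (fun x : R => ((1 + x ^+ 2) `^ (- mean_exponent m p))%:E).
  apply/measurable_EFinP; apply: measurable_fun_powR.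
  by apply: measurable_funD => //; exact: measurable_funX.
rewrite tonelli; last 2 first.
- apply: emeasurable_funM; last exact: measurableT_comp mPsi _.
  apply: emeasurable_funM; first exact: measurableT_comp mS _.
  exact: mwx.
- by move=> w x; rewrite !mule_ge0 ?lee_fin.
rewrite -ge0_integralZl//; last 2 first.
- exact: emeasurable_funM.
- by move=> x _; rewrite mule_ge0 ?lee_fin ?powR_ge0.
apply: eq_integral => x _.
have mx : measurable_fun setT (fun w => (wt x w)%:E).
  by apply/measurable_EFinP; exact: measurable_wt.
rewrite ge0_integralZr//; last 2 first.
- exact: emeasurable_funM.
- by move=> w _; rewrite mule_ge0 ?lee_fin.
by rewrite scale_wt -/slice_total [X in X * _ = _]muleC -muleA.
Qed.

End fixed_dimension.
End mean_law.

(** * Partition by separating weighted means *)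

Section partition.
Context {R : realType}.
Variables (n k : nat).
Implicit Types (w t : 'rV[R]_n) (G : {set 'I_n}).

Definition prefix_set : {set 'I_n} := [set i : 'I_n | (i < k)%N].

Definition gmean G w t : R :=
  (\sum_(i in G) w 0 i * t 0 i) / (\sum_(i in G) w 0 i).

(** Ties belong to [G]: the inequality is weak inside and strict outside, so that for positive
    weights the cells are disjoint and cover every [t], not only almost every one. *)
Definition mean_cell G w t : bool :=
  (prefix_set \subset G) &&
  [forall i : 'I_n, if i \in G then (k <= i)%N ==> (gmean G w t <= t 0 i)
                 else t 0 i < gmean G w t].

Definition dev G w t (l : R) : R := \sum_(i in G) w 0 i * (t 0 i - l).

Definition upper_set t (l : R) : {set 'I_n} :=
  prefix_set :|: [set i | l <= t 0 i].

Lemma gsum_gt0 G w : wpos w -> G != finset.set0 -> 0 < \sum_(i in G) w 0 i.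
Proof.
move=> /forallP wp /set0Pn[i iG]; rewrite (bigD1 i)//=.
by rewrite ltr_wpDr// sumr_ge0// => j _; exact/ltW/wp.
Qed.

Lemma devE G w t l : wpos w -> G != finset.set0 ->
  dev G w t l = (\sum_(i in G) w 0 i) * (gmean G w t - l).
Proof.
move=> wp G0; rewrite mulrBr /gmean mulrCA divff ?lt0r_neq0 ?gsum_gt0// mulr1.
by rewrite mulr_suml -sumrB; apply: eq_bigr => i _; rewrite mulrBr.
Qed.

(** For fixed [l] the deviation is a sum over indices, so the best superset of the prefix keeps
    exactly the free indices whose term is nonnegative. *)
Lemma dev_le_upper G w t l : wpos w -> prefix_set \subset G ->
  dev G w t l <= dev (upper_set t l) w t l.
Proof.
move=> /forallP wp /fintype.subsetP sG; rewrite /dev big_mkcond [leRHS]big_mkcond/=.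
apply: ler_sum => i _; rewrite !inE.
have [ik|ik] /= := boolP (i < k)%N; first by rewrite sG// inE.
case: (leP l (t 0 i)) => lt; case: ifP => // _.
  by rewrite mulr_ge0 ?subr_ge0// ltW.
by rewrite mulr_ge0_le0 ?subr_le0// ltW.
Qed.

Lemma mean_cell_upper G w t : mean_cell G w t -> G = upper_set t (gmean G w t).
Proof.
move=> /andP[/fintype.subsetP sG /forallP H]; apply/setP => i; rewrite !inE.
have := H i; have [iG|iG] := boolP (i \in G).
  by rewrite leqNgt; case: (i < k)%N => //= ->.
move=> tl; rewrite leNgt tl orbF; apply/esym/negbTE; apply: contra iG => ik.
by apply: sG; rewrite inE.
Qed.

Hypotheses (k_gt0 : (0 < k)%N) (k_le : (k <= n)%N).

Lemma prefix_set_neq0 G : prefix_set \subset G -> G != finset.set0.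
Proof.
move=> /fintype.subsetP sG; apply/set0Pn.
by exists (Ordinal (leq_trans k_gt0 k_le)); apply: sG; rewrite inE.
Qed.

Lemma upper_prefix t l : prefix_set \subset upper_set t l.
Proof. exact: finset.subsetUl. Qed.

(** Take the largest weighted mean [l] over the supersets of the prefix. A maximiser may miss ties,
    so pass to [upper_set t l]: its deviation from [l] is nonpositive by maximality, and at least
    that of the maximiser, which is 0. Hence its mean is again [l]. *)
Lemma mean_cell_exists w t : wpos w -> exists G, mean_cell G w t.
Proof.
move=> wp.
have sT : prefix_set \subset [set: 'I_n]%SET by exact: finset.subsetT.
case: (@Order.TotalTheory.arg_maxP _ _ _ [set: 'I_n]%SET
  (fun G => prefix_set \subset G) (fun G => gmean G w t) sT) => G sG Gmax.
set l := gmean G w t; pose U := upper_set t l.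
have U0 := prefix_set_neq0 (upper_prefix t l).
have G0 := prefix_set_neq0 sG.
have dU : dev U w t l = 0.
  apply/eqP; rewrite eq_le; apply/andP; split.
    rewrite devE// pmulr_rle0 ?gsum_gt0// subr_le0.
    by apply: Gmax; exact: upper_prefix.
  apply: le_trans (dev_le_upper _ _ wp sG).
  by rewrite devE// subrr mulr0.
have gU : gmean U w t = l.
  apply/eqP; move/eqP: dU; rewrite devE// mulf_eq0 subr_eq0.
  by rewrite gt_eqF ?gsum_gt0.
exists U; rewrite /mean_cell upper_prefix/=; apply/forallP => i; rewrite gU.
by rewrite !inE (leqNgt k i); case: (i < k)%N => //=; case: leP.
Qed.

(** A cell is the upper set of its own mean. If the means differed, the set with the larger mean
    would have a positive deviation from the smaller one, while the upper set there, which has the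
    largest deviation, has deviation 0. *)
Lemma mean_cell_uniq w t G1 G2 : wpos w ->
  mean_cell G1 w t -> mean_cell G2 w t -> G1 = G2.
Proof.
move=> wp; wlog: G1 G2 / gmean G1 w t <= gmean G2 w t => [H|].
  by case/orP: (le_total (gmean G1 w t) (gmean G2 w t)) => /H{}H c1 c2;
     [exact: H|apply/esym; exact: H].
rewrite le_eqVlt => /predU1P[E|lt12] c1 c2.
  by rewrite (mean_cell_upper c1) (mean_cell_upper c2) E.
have s1 : prefix_set \subset G1 by case/andP: c1.
have s2 : prefix_set \subset G2 by case/andP: c2.
have G10 := prefix_set_neq0 s1; have G20 := prefix_set_neq0 s2.
have := dev_le_upper t (gmean G1 w t) wp s2.
rewrite -(mean_cell_upper c1) [leRHS]devE// subrr mulr0 devE//.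
by rewrite pmulr_rle0 ?gsum_gt0// subr_le0 leNgt lt12.
Qed.

Lemma sum_mean_cell w t : wpos w -> \sum_G (mean_cell G w t)%:R = 1 :> R.
Proof.
move=> wp; have [G cG] := mean_cell_exists t wp.
rewrite (bigD1 G)//= cG big1 ?addr0// => G' G'G.
by case: (boolP (mean_cell G' w t)) => // /(mean_cell_uniq wp cG) E; rewrite E eqxx in G'G.
Qed.

End partition.

(** List the prefix, then the rest of [G], then the complement of [G]; the permutation sends each
    index to its position in this list. *)
Lemma prefix_perm (n k m : nat) (G : {set 'I_n}) :
  (k <= n)%N -> prefix_set n k \subset G -> #|G| = m ->
  exists s : 'S_n, forall i, ((s i < k)%N = (i < k)%N) /\ ((s i < m)%N = (i \in G)).
Proof.
move=> kn sG cG; set A := prefix_set n k.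
pose L1 := enum A; pose L2 := enum (G :\: A); pose L3 := enum (~: G).
pose L := L1 ++ (L2 ++ L3).
have cA : #|A| = k.
  have -> : A = [set widen_ord kn i | i in [set: 'I_k]]%SET.
    apply/setP => i; rewrite inE; apply/idP/imsetP => [ik|[j _ ->]]; last exact: (ltn_ord j).
    by exists (Ordinal ik) => //; exact: val_inj.
  by rewrite card_imset ?cardsT ?card_ord// => i j /(congr1 val)/= /val_inj.
have s1 : size L1 = k by rewrite -cardE.
have s2 : size L2 = (m - k)%N.
  by rewrite -cardE cardsD (finset.setIidPr sG) cG cA.
have km : (k <= m)%N by rewrite -cA -cG subset_leq_card.
have memL i : i \in L.
  rewrite !mem_cat !mem_enum !inE; case: (i < k)%N => //=.
  by case: (i \in G).
have uL : uniq L.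
  rewrite !cat_uniq !enum_uniq/= andbT; apply/andP; split.
    apply/hasPn => i; rewrite mem_cat !mem_enum !inE.
    case: (boolP (i < k)%N) => //= ik; rewrite (fintype.subsetP sG) ?inE//.
  by apply/hasPn => i; rewrite !mem_enum !inE => /negbTE ->; rewrite andbF.
have sL : size L = n.
  by rewrite -(card_uniqP uL) -[RHS]card_ord; apply: eq_card => i; rewrite memL.
have idx i : (index i L < n)%N by rewrite -[X in (_ < X)%N]sL index_mem.
pose f i := Ordinal (idx i).
have finj : injective f.
  by move=> i j /(congr1 val)/=; exact: index_inj.
exists (perm finj) => i; rewrite permE/=; split.
  rewrite index_cat mem_enum inE; case: (boolP (i < k)%N) => ik.
    by rewrite -[X in (_ < X)%N]s1 index_mem mem_enum inE.
  by rewrite s1 ltnNge leq_addr.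
rewrite index_cat mem_enum inE; case: (boolP (i < k)%N) => ik.
  rewrite (fintype.subsetP sG) ?inE//; apply: leq_trans km.
  by rewrite -[X in (_ < X)%N]s1 index_mem mem_enum inE.
rewrite s1 index_cat mem_enum !inE (negbTE ik)/= -ltn_subRL -s2.
case: (boolP (i \in G)) => iG; last by rewrite ltnNge leq_addr.
by rewrite index_mem mem_enum !inE ik.
Qed.

(** * Isometries of a weighted quadratic form *)

Section ball.
Context {R : realType}.
Notation lam := (lebesgue_rV R).

(** The test set for scale factors: an ellipsoid that every isometry of the weighted form
    preserves. *)
Definition wball (N : nat) (w : 'rV[R]_N) : set 'rV[R]_N :=
  [set x | \sum_i w 0 i * x 0 i ^+ 2 <= 1].

Lemma measurable_wball N (w : 'rV[R]_N) : measurable (wball w).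
Proof.
have -> : wball w = (fun x => \sum_i w 0 i * x 0 i ^+ 2 <= 1) @^-1` [set true].
  by apply/seteqP; split.
rewrite -[X in measurable X]setTI.
have m : measurable_fun setT (fun x : 'rV[R]_N => \sum_i w 0 i * x 0 i ^+ 2 <= 1).
  apply: measurable_fun_ler => //; apply: measurable_sum => i.
  by apply: measurable_funM => //; apply: measurable_funX; exact: measurable_coord.
exact: m.
Qed.

Lemma wballN N (w x : 'rV[R]_N) : wball w (- x) <-> wball w x.
Proof.
rewrite /wball/= (eq_bigr (fun i => w 0 i * x 0 i ^+ 2))// => i _.
by rewrite mxE sqrrN.
Qed.

Lemma wball_fin N (w : 'rV[R]_N) : wpos w ->
  (0 < lam N (wball w) /\ lam N (wball w) < +oo)%E.
Proof.
move=> /forallP wp; set W := \sum_i w 0 i.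
have W0 : 0 <= W by apply: sumr_ge0 => i _; exact/ltW/wp.
have W1 : 0 < 1 + W by rewrite ltr_pwDl.
apply: (@lebesgue_rV_bounded_nbhs _ _ _ (1 + W)^-1 (\sum_i (1 + (w 0 i)^-1))).
- exact: measurable_wball.
- by rewrite invr_gt0.
- move=> x xd; rewrite /wball/=.
  apply: (@le_trans _ _ (\sum_i w 0 i * (1 + W)^-1)).
    apply: ler_sum => i _; rewrite ler_wpM2l ?(ltW (wp i))//.
    rewrite -real_normK ?num_real// (le_trans _ (xd i))// expr2.
    rewrite ler_piMl// (le_trans (xd i))// invf_le1//.
    by rewrite lerDl.
  by rewrite -mulr_suml -/W ler_pdivrMr// mul1r lerDr.
- move=> x xb i; apply: (@le_trans _ _ (1 + (w 0 i)^-1)); last first.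
    rewrite (bigD1 i)//= lerDl sumr_ge0// => j _.
    by rewrite addr_ge0// invr_ge0; exact/ltW/wp.
  have xi : w 0 i * x 0 i ^+ 2 <= 1.
    apply: le_trans xb; rewrite (bigD1 i)//= lerDl sumr_ge0// => j _.
    by rewrite mulr_ge0 ?sqr_ge0//; exact/ltW/wp.
  apply: (@le_trans _ _ (1 + x 0 i ^+ 2)).
    rewrite -[x 0 i ^+ 2]real_normK ?num_real//.
    have := normr_ge0 (x 0 i); move: (`|x 0 i|) => y y0; nra.
  by rewrite lerD2l -[leRHS]mul1r ler_pdivlMr 1?mulrC.
Qed.

Lemma ge0_integral_isometry N (w : 'rV[R]_N) (phi psi : 'rV[R]_N -> 'rV[R]_N)
    (f : 'rV[R]_N -> \bar R) : wpos w ->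
  {morph phi : x y / x + y} -> measurable_fun setT phi -> cancel psi phi ->
  (forall x, \sum_i w 0 i * phi x 0 i ^+ 2 = \sum_i w 0 i * x 0 i ^+ 2) ->
  measurable_fun setT f -> (forall x, (0 <= f x)%E) ->
  (\int[lam N]_x f (phi x) = \int[lam N]_x f x)%E.
Proof.
move=> wp phiD mphi psiK phiw mf f0; have [b0 boo] := wball_fin wp.
apply: (ge0_integral_additive_inv phiD mphi psiK (measurable_wball w)) => //.
- exact: wballN.
- by move=> x; rewrite /wball/= phiw.
Qed.

Lemma ge0_integral_perm N (s : 'S_N) (f : 'rV[R]_N -> \bar R) :
  measurable_fun setT f -> (forall x, (0 <= f x)%E) ->
  (\int[lam N]_x f (col_perm s x) = \int[lam N]_x f x)%E.
Proof.
move=> mf f0.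
apply: (@ge0_integral_isometry N (const_mx 1) (col_perm s) (col_perm (s^-1)%g)) => //.
- by apply/forallP => i; rewrite mxE.
- by move=> x y; apply/rowP => i; rewrite !mxE.
- apply: measurable_fun_rV => i; under eq_fun do rewrite mxE.
  exact: measurable_coord.
- by move=> x; apply/rowP => i; rewrite !mxE permK.
- move=> x; rewrite [RHS](reindex_inj (@perm_inj _ s))/=.
  by apply: eq_bigr => i _; rewrite !mxE.
Qed.

End ball.

(** * Integration against a measure given by a density *)

Section density_integral.
Local Open Scope ereal_scope.
Context d (T : measurableType d) (R : realType).
Variables (m : {measure set T -> \bar R}) (g : T -> \bar R).
Hypotheses (mg : measurable_fun setT g) (g0 : forall x, 0 <= g x).
Import HBNNSimple.

Let integral_density_indic (A : set T) (r : R) : (0 <= r)%R -> measurable A ->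
  \int[density_measure m mg g0]_x (r * \1_A x)%:E =
  \int[m]_x ((r * \1_A x)%:E * g x).
Proof.
move=> r0 mA.
have mi : measurable_fun setT (fun x => (\1_A x : R)%:E).
  exact/measurable_EFinP/measurable_indic.
under [LHS]eq_integral do rewrite EFinM.
rewrite ge0_integralZl//.
rewrite integral_indic// setIT /density_measure/=.
under [RHS]eq_integral do rewrite EFinM -muleA.
rewrite ge0_integralZl//; last 2 first.
- exact: emeasurable_funM.
- by move=> x _; rewrite mule_ge0 ?lee_fin.
congr (_ * _); rewrite /density_measure integral_mkcond; apply: eq_integral => x _.
by rewrite patchE indicE; case: ifP; rewrite ?mul1e ?mul0e.
Qed.

Let integral_density_nnsfun (h : {nnsfun T >-> R}) :
  \int[density_measure m mg g0]_x (h x)%:E = \int[m]_x ((h x)%:E * g x).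
Proof.
transitivity (\int[density_measure m mg g0]_x
    (\sum_(r \in range h) (r * \1_(h @^-1` [set r]) x)%:E)).
  by apply: eq_integral => x _; rewrite fsumEFin//; congr EFin; rewrite [LHS]fimfunE.
have mh r : measurable_fun setT (fun x => (r * \1_(h @^-1` [set r]) x)%:E).
  by apply/measurable_EFinP; apply: measurable_funM => //; exact: measurable_indic.
rewrite ge0_integral_fsum//; last first.
  by move=> r x _; rewrite nnfun_muleindic_ge0.
transitivity (\int[m]_x (\sum_(r \in range h) ((r * \1_(h @^-1` [set r]) x)%:E * g x))).
  rewrite ge0_integral_fsum//; last 2 first.
  - by move=> r; exact: emeasurable_funM.
  - by move=> r x _; rewrite mule_ge0// nnfun_muleindic_ge0.
  apply: eq_fsbigr => r /set_mem[x _ <-].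
  by rewrite integral_density_indic.
apply: eq_integral => x _; rewrite -ge0_mule_fsuml; last first.
  by move=> r; rewrite nnfun_muleindic_ge0.
by rewrite fsumEFin//; congr (_%:E * _); rewrite -fimfunE.
Qed.

Lemma ge0_integral_density (f : T -> \bar R) :
  (forall x, g x \is a fin_num) ->
  measurable_fun setT f -> (forall x, 0 <= f x) ->
  \int[density_measure m mg g0]_x f x = \int[m]_x (f x * g x).
Proof.
move=> gfin mf f0.
pose h := nnsfun_approx measurableT mf.
have cvgh x : (h n x)%:E @[n --> \oo] --> f x by exact: cvg_nnsfun_approx.
have hle a b x : (a <= b)%N -> ((h a x)%:E <= (h b x)%:E).
  by move=> ab; rewrite lee_fin; exact/lefP/nd_nnsfun_approx.
have mh n : measurable_fun setT (fun x => (h n x)%:E).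
  by apply/measurable_EFinP; exact: measurable_funP.
transitivity (limn (fun n => \int[density_measure m mg g0]_x (h n x)%:E)).
  rewrite -monotone_convergence//.
  - by apply: eq_integral => x _; apply/esym/cvg_lim.
  - by move=> n x _; rewrite lee_fin.
  - by move=> x _ a b; exact: hle.
transitivity (limn (fun n => \int[m]_x ((h n x)%:E * g x))).
  by congr (limn _); apply/funext => n; exact: integral_density_nnsfun.
rewrite -monotone_convergence//.
- by apply: eq_integral => x _; apply/cvg_lim => //; exact: cvgeMr.
- by move=> n; exact: emeasurable_funM.
- by move=> n x _; rewrite mule_ge0// lee_fin.
- by move=> x _ a b ab; rewrite lee_wpmul2r// hle.
Qed.

End density_integral.

(** * The substitution by the tangent *)

Section tangent.
Context {R : realType}.
Notation mu := (@lebesgue_measure R).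

Let cauchy (x : R) : \bar R := ((1 + x ^+ 2)^-1)%:E.

Let mcauchy : measurable_fun setT cauchy.
Proof.
apply/measurable_EFinP; apply: (measurableT_comp measurable_invr).
by apply: measurable_funD => //; exact: measurable_funX.
Qed.

Let cauchy_ge0 x : (0 <= cauchy x)%E.
Proof. by rewrite lee_fin invr_ge0 addr_ge0// sqr_ge0. Qed.

Lemma measurable_tan : measurable_fun setT (@tan R).
Proof.
apply: measurable_funM; first by apply: continuous_measurable_fun => x; exact: continuous_sin.
apply: (measurableT_comp measurable_invr).
by apply: continuous_measurable_fun => x; exact: continuous_cos.
Qed.

Let D : set (measurableTypeR R) := `](- (pi / 2)), (pi / 2)[%classic.

Let mD : measurable D.
Proof. exact: measurable_itv. Qed.

Let cauchy_ocitv (a b : R) : a <= b ->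
  (\int[mu]_(x in `]a, b]%classic) cauchy x = (atan b - atan a)%:E)%E.
Proof.
rewrite le_eqVlt => /predU1P[->|ab].
  by rewrite set_itvoc0 integral_set0 subrr.
rewrite integral_itv_obnd_cbnd; last exact: measurable_funTS.
rewrite (continuous_FTC2 (F := @atan R)) ?EFinB//.
- apply: continuous_subspaceT => x; apply: cvgV.
    by rewrite gt_eqF// ltr_pwDl// sqr_ge0.
  by apply: cvgD; [exact: cvg_cst|exact: exprn_continuous].
- split.
  + by move=> x _; exact: derivable_atan.
  + by apply: cvg_at_right_filter; exact: continuous_atan.
  + by apply: cvg_at_left_filter; exact: continuous_atan.
- by move=> x _; rewrite derive1_atan.
Qed.

(** The image under [tan] of Lebesgue measure on the open interval and the measure of density
    [(1 + x ^+ 2)^-1] both give [atan b - atan a] to a half-open interval, hence coincide. *)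
Lemma integral_tan (f : R -> \bar R) :
  measurable_fun setT f -> (forall x, (0 <= f x)%E) ->
  (\int[mu]_(x in `](- (pi / 2))%R, (pi / 2)%R[%classic) f (tan x) =
   \int[mu]_x (f x * ((1 + x ^+ 2)^-1)%:E))%E.
Proof.
move=> mf f0.
have mtan : measurable_fun setT (@tan R : measurableTypeR R -> measurableTypeR R).
  exact: measurable_tan.
have mi : measurable_fun setT (fun t : measurableTypeR R => (\1_D t : R)%:E).
  by apply/measurable_EFinP; exact: measurable_indic.
have i0 t : (0 <= (\1_D t : R)%:E)%E by rewrite lee_fin.
pose m2 := image_measure [the measure _ _ of density_measure mu mi i0] mtan.
pose m1 := [the measure _ _ of density_measure mu mcauchy cauchy_ge0].
have m1E (a b : R) : a <= b -> m1 `]a, b]%classic = (atan b - atan a)%:E.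
  exact: cauchy_ocitv.
have m2E (a b : R) : a <= b -> m2 `]a, b]%classic = (atan b - atan a)%:E.
  move=> ab; rewrite /m2 /image_measure/= /pushforward/= /density_measure.
  have mt : measurable (@tan R @^-1` `]a, b]%classic).
    by rewrite -[X in measurable X]setTI; exact: (measurable_tan measurableT (measurable_itv _)).
  rewrite (integral_indic mu mt mD).
  rewrite (_ : _ `&` _ = `](atan a), (atan b)]%classic).
    apply: (etrans (lebesgue_measure_itv `]atan a, atan b])).
    rewrite /= lte_fin; case: ifPn => //.
    rewrite -leNgt => ba; congr EFin.
    by rewrite (@le_anti _ _ (atan a) (atan b)) ?subrr// le_atan.
  apply/seteqP; split => x /=; rewrite /D/= !in_itv/=.
    move=> [/andP[x1 x2] /andP[ax xb]].
    have xD : x \in `](- (pi / 2)), (pi / 2)[ by rewrite in_itv/= x1.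
    rewrite -(tanK xD) lt_atan//= le_atan//.
  move=> /andP[ax xb].
  have xD : x \in `](- (pi / 2)), (pi / 2)[.
    by rewrite in_itv/= (lt_trans (atan_gtNpi2 a) ax) (le_lt_trans xb (atan_ltpi2 b)).
  move: (xD); rewrite in_itv/= => /andP[-> ->]; split => //.
  have aD (c : R) : atan c \in `](- (pi / 2)), (pi / 2)[.
    by rewrite in_itv/= atan_gtNpi2 atan_ltpi2.
  rewrite -[a]atanK -[X in _ <= X]atanK ltr_tan// ax/=.
  move: xb; rewrite le_eqVlt => /predU1P[->//|xb].
  by apply/ltW; rewrite ltr_tan.
have m12 A : measurable A -> m1 A = m2 A.
  move=> mA; apply: (@measure_unique _ R (measurableTypeR R) (@ocitv R)
    (fun n : nat => `](- n%:R)%R, n%:R%R]%classic)) => //.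
  - exact: ocitvI.
  - by move=> n; exact: is_ocitv.
  - apply/seteqP; split => // x _; exists (Num.truncn `|x|).+1 => //=.
    have := truncnS_gt `|x|; rewrite in_itv/= => /ltr_normlP[].
    by rewrite ltrNl => -> /ltW ->.
  - move=> _ [[a b] _ <-]/=; have [ab|ba] := leP a b; first by rewrite m1E// m2E.
    by rewrite set_itv_ge ?measure0// bnd_simp -leNgt ltW.
  - by move=> n; rewrite m1E ?ltry// (@le_trans _ _ 0)// oppr_le0.
rewrite -(ge0_integral_density mu mcauchy cauchy_ge0)//.
transitivity (\int[m2]_x f x)%E; last by apply: eq_measure_integral => A mA _; exact/esym/m12.
rewrite /m2 ge0_integral_pushforward// preimage_setT.
rewrite ge0_integral_density; [|by []|exact: measurableT_comp mf mtan|by move=> x; exact: f0].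
rewrite [LHS]integral_mkcond; apply: eq_integral => x _.
by rewrite patchE indicE /D/=; case: ifP => _; rewrite ?mule1 ?mule0.
Qed.

End tangent.

(** * The weight tildeI as a probability *)

Section tildeI_integral.
Context {R : realType}.
Notation mu := (@lebesgue_measure R).

Definition bdens (b x : R) : R := beta'_const 1 b * (1 + x ^+ 2) `^ (- b).

Lemma beta'_const_ge0 d (b : R) : d%:R / 2 < b -> 0 <= beta'_const d b.
Proof.
move=> db; have b0 : 0 < b by apply: le_lt_trans db; rewrite divr_ge0.
rewrite divr_ge0 ?ltW ?Gamma_gt0// mulr_gt0 ?powR_gt0 ?pi_gt0//.
by rewrite Gamma_gt0// subr_gt0.
Qed.

Lemma one_sqr_gt0 (x : R) : 0 < 1 + x ^+ 2.
Proof. by rewrite ltr_pwDl// sqr_ge0. Qed.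

Lemma bdens_ge0 b x : 2^-1 < b -> 0 <= bdens b x.
Proof. by move=> b0; rewrite mulr_ge0 ?powR_ge0// beta'_const_ge0// mul1r. Qed.

Lemma measurable_bdens b : measurable_fun setT (bdens b).
Proof.
apply: measurable_funM => //; apply: measurable_fun_powR.
by apply: measurable_funD => //; exact: measurable_funX.
Qed.

Lemma beta'_const1E (b : R) : 2^-1 < b ->
  beta'_const 1 b = Gamma b / (Num.sqrt pi * Gamma (b - 2^-1)).
Proof. by move=> b0; rewrite /beta'_const mul1r powR12_sqrt// pi_ge0. Qed.

Lemma integral_bdens b : 2^-1 < b -> (\int[mu]_x (bdens b x)%:E = 1)%E.
Proof.
move=> b12; have b0 : 0 < b by exact: lt_trans b12.
under eq_integral do rewrite EFinM.
rewrite ge0_integralZl//; last 3 first.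
- apply/measurable_EFinP; apply: measurable_fun_powR.
  by apply: measurable_funD => //; exact: measurable_funX.
- by move=> x _; rewrite lee_fin powR_ge0.
- by rewrite lee_fin beta'_const_ge0// mul1r.
rewrite integral_beta'1// -EFinM beta'_const1E//.
have G0 := Gamma_gt0 b0; have s0 : 0 < Num.sqrt (pi : R) by rewrite sqrtr_gt0 pi_gt0.
have G1 : 0 < Gamma (b - 2^-1) by rewrite Gamma_gt0// subr_gt0.
move: (Gamma b) (Num.sqrt _) (Gamma _) G0 s0 G1 => x y z x0 y0 z0.
by congr EFin; field; rewrite !gt_eqF.
Qed.

Definition bcdf (b x : R) : \bar R :=
  (\int[mu]_y ((y < x)%R%:R * bdens b y)%:E)%E.

Let bcdf_measurable2 b :
  measurable_fun setT (fun z : R * R => ((z.2 < z.1)%R%:R * bdens b z.2)%:E).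
Proof.
apply/measurable_EFinP; apply: measurable_funM.
  by apply: measurable_bool_real; exact: measurable_fun_ltr.
by apply: (measurableT_comp (measurable_bdens b)).
Qed.

Let bcdf_int_ge0 b (x y : R) : 2^-1 < b -> (0 <= ((y < x)%R%:R * bdens b y)%:E)%E.
Proof. by move=> b0; rewrite lee_fin mulr_ge0// bdens_ge0. Qed.

Lemma measurable_bcdf b : 2^-1 < b -> measurable_fun setT (bcdf b).
Proof.
move=> b0.
apply: (measurable_tonelli1 (f := fun x y : R => ((y < x)%R%:R * bdens b y)%:E) mu).
- exact: bcdf_measurable2.
- by move=> x y; exact: bcdf_int_ge0.
Qed.

Lemma bcdf_ge0 b x : 2^-1 < b -> (0 <= bcdf b x)%E.
Proof. by move=> b0; apply: integral_ge0 => y _; exact: bcdf_int_ge0. Qed.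

Lemma bcdf_le1 b x : 2^-1 < b -> (bcdf b x <= 1)%E.
Proof.
move=> b0; rewrite -(integral_bdens b0); apply: ge0_le_integral => //.
- by move=> y _; exact: bcdf_int_ge0.
- exact: (measurable_section1 (f := fun x y : R => ((y < x)%R%:R * bdens b y)%:E)
    (bcdf_measurable2 b)).
- by apply/measurable_EFinP; exact: measurable_bdens.
- by move=> y _; rewrite lee_fin ler_piMl ?bdens_ge0//; case: (y < x).
Qed.

Lemma bcdf_fin b x : 2^-1 < b -> bcdf b x \is a fin_num.
Proof.
by move=> b0; rewrite ge0_fin_numE ?bcdf_ge0// (le_lt_trans (bcdf_le1 x b0))// ltry.
Qed.

Let D : set R := `](- (pi / 2)), (pi / 2)[%classic.

Let cos_tan (x q : R) : D x -> cos x `^ q = (1 + tan x ^+ 2) `^ (- (q / 2)).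
Proof.
rewrite /D/= in_itv/= => xD; have c0 : 0 < cos x by rewrite cos_gt0_pihalf.
rewrite -cos2_tan2 ?gt_eqF// -powR_invn ?ltW// -powRrM.
by congr (_ `^ _); field.
Qed.

Let inner (alpha phi : R) : 0 < alpha -> D phi ->
  (\int[mu]_(theta in `[(- (pi / 2))%R, phi]%classic)
      (beta'_const 1 ((alpha + 1) / 2) * cos theta `^ (alpha - 1))%:E =
   bcdf ((alpha + 1) / 2) (tan phi))%E.
Proof.
move=> a0 Dphi; set b := (alpha + 1) / 2.
have b12 : 2^-1 < b by rewrite /b; lra.
have mcos : measurable_fun setT (fun t : R => (beta'_const 1 b * cos t `^ (alpha - 1))%:E).
  apply/measurable_EFinP; apply: measurable_funM => //; apply: measurable_fun_powR.
  by apply: continuous_measurable_fun => x; exact: continuous_cos.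
rewrite integral_itv_bndoo; last exact: measurable_funTS.
pose h (y : R) : \bar R := ((y < tan phi)%R%:R * (beta'_const 1 b * (1 + y ^+ 2)
  `^ (- ((alpha - 1) / 2))))%:E.
have mh : measurable_fun setT h.
  apply/measurable_EFinP; apply: measurable_funM.
    by apply: measurable_bool_real; exact: measurable_fun_ltr.
  apply: measurable_funM => //; apply: measurable_fun_powR.
  by apply: measurable_funD => //; exact: measurable_funX.
transitivity (\int[mu]_(theta in D) h (tan theta))%E.
  rewrite [LHS]integral_mkcond [RHS]integral_mkcond; apply: eq_integral => t _.
  rewrite !patchE; move: Dphi; rewrite /D/= in_itv/= => /andP[Np pp].
  case: ifPn => [|].
    rewrite inE/= in_itv/= => /andP[Nt tp].
    rewrite ifT; last by rewrite inE/= in_itv/= Nt (lt_trans tp).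
    have tpi := lt_trans tp pp.
    have tt : tan t < tan phi by rewrite ltr_tan ?in_itv/= ?Nt ?Np ?pp ?tpi.
    rewrite /h tt mul1r cos_tan//.
    by rewrite /D/= in_itv/= Nt (lt_trans tp).
  rewrite notin_setE/= in_itv/= => H; case: ifPn => //.
  rewrite inE/= in_itv/= => /andP[Nt tp].
  rewrite /h ltr_tan ?in_itv/= ?Nt ?Np//.
  have -> : (t < phi) = false by apply/negbTE/negP => tphi; apply: H; rewrite Nt.
  by rewrite mul0r.
rewrite integral_tan//; last first.
  by move=> x; rewrite lee_fin mulr_ge0// mulr_ge0 ?powR_ge0// beta'_const_ge0// mul1r.
apply: eq_integral => y _; rewrite -EFinM; congr EFin; rewrite /bdens -!mulrA; congr (_ * (_ * _)).
have y0 := one_sqr_gt0 y.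
rewrite -(powR_inv1 (ltW y0)) -powRD; last by rewrite (gt_eqF y0) implybT.
by congr (_ * _ `^ _); rewrite /b; field.
Qed.

(** With [x = tan phi], the factor [(1 + x ^+ 2)^-1] of the substitution completes the powers of the
    cosine to two beta' densities: [tildeI n k alpha] is the probability that [n - k] independent
    numbers all lie below one more independent number. *)
Lemma tildeIE (n k : nat) (alpha : R) : 0 < alpha -> (0 < k)%N ->
  (tildeI n k alpha)%:E = (\int[mu]_x (bdens ((alpha * k%:R + 1) / 2) x *
     fine (bcdf ((alpha + 1) / 2) x) ^+ (n - k))%:E)%E.
Proof.
move=> a0 k0; set B := (alpha * k%:R + 1) / 2; set b := (alpha + 1) / 2.
have b12 : 2^-1 < b by rewrite /b; lra.
have ak0 : 0 < alpha * k%:R by rewrite mulr_gt0// ltr0n.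
have B12 : 2^-1 < B by rewrite /B; lra.
have F01 x : 0 <= fine (bcdf b x) <= 1.
  rewrite fine_ge0 ?bcdf_ge0//= -[leRHS]/(fine 1%E) fine_le ?bcdf_fin ?bcdf_le1//.
have mF : measurable_fun setT (fun x => fine (bcdf b x)).
  by apply: (measurableT_comp (f := fine)) => //; exact: measurable_bcdf.
have mI : measurable_fun setT (fun x => (bdens B x * fine (bcdf b x) ^+ (n - k))%:E).
  apply/measurable_EFinP; apply: measurable_funM; first exact: measurable_bdens.
  exact: measurable_funX.
have I0 x : (0 <= (bdens B x * fine (bcdf b x) ^+ (n - k))%:E)%E.
  by rewrite lee_fin mulr_ge0 ?bdens_ge0// exprn_ge0//; case/andP: (F01 x).
(* The outer integral in [tildeI] is the finite part of an extended integral, so finiteness is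
   required to compare the two; it holds because the distribution function is at most 1. *)
have Ifin : (\int[mu]_x (bdens B x * fine (bcdf b x) ^+ (n - k))%:E)%E \is a fin_num.
  rewrite ge0_fin_numE; last by apply: integral_ge0 => x _; exact: I0.
  apply: (@le_lt_trans _ _ 1%E); last exact: ltry.
  rewrite -(integral_bdens B12); apply: ge0_le_integral => //.
  - by apply/measurable_EFinP; exact: measurable_bdens.
  - move=> x _; rewrite lee_fin ler_piMr ?bdens_ge0//.
    by have /andP[? ?] := F01 x; rewrite exprn_ile1.
apply: etrans (fineK Ifin); rewrite /tildeI {1}/Rintegral.
apply: congr1; apply: congr1.
pose g (x : R) : \bar R := (beta'_const 1 B * (1 + x ^+ 2) `^ (- ((alpha * k%:R - 1) / 2)) *
  fine (bcdf b x) ^+ (n - k))%:E.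
have mg : measurable_fun setT g.
  apply/measurable_EFinP; apply: measurable_funM; last exact: measurable_funX.
  apply: measurable_funM => //; apply: measurable_fun_powR.
  by apply: measurable_funD => //; exact: measurable_funX.
have gE x : D x -> (beta'_const 1 B * cos x `^ (alpha * k%:R - 1) *
     (\int[mu]_(theta in `[- (pi / 2), x])
        (beta'_const 1 b * cos theta `^ (alpha - 1))) ^+ (n - k))%:E = g (tan x).
  by move=> Dx; rewrite /g cos_tan// /Rintegral inner.
transitivity (\int[mu]_(x in D) g (tan x))%E.
  rewrite integral_itv_bndoo.
    by apply: eq_integral => x /set_mem Dx; exact: gE.
  apply: (eq_measurable_fun (g \o @tan R)).
    by move=> x /set_mem Dx; rewrite /= -gE.
  apply: measurable_funTS; apply: measurableT_comp => //; exact: measurable_tan.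
rewrite integral_tan//; last first.
  move=> x; rewrite lee_fin mulr_ge0//; last by rewrite exprn_ge0//; case/andP: (F01 x).
  by rewrite mulr_ge0 ?powR_ge0// beta'_const_ge0// mul1r.
apply: eq_integral => x _; rewrite -EFinM; congr EFin.
rewrite mulrAC; congr (_ * _); rewrite /bdens -mulrA; congr (_ * _).
have x0 := one_sqr_gt0 x.
rewrite -(powR_inv1 (ltW x0)) -powRD; last by rewrite (gt_eqF x0) implybT.
by congr (_ `^ _); rewrite /B; field.
Qed.

End tildeI_integral.

(** * Total mass and symmetry of the cells *)

Section recursion.
Context {R : realType}.
Notation mu := (@lebesgue_measure R).
Notation lam := (lebesgue_rV R).
Local Open Scope ereal_scope.

Variable p : R.
Hypothesis p12 : (2^-1 < p)%R.

Let p0 : (0 < p)%R.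
Proof. exact: lt_trans p12. Qed.

(** The total mass of [gammaw p (1 + x ^+ 2) u] in the variables [u] and [x], so that its powers
    normalise [rho]. *)
Definition mass : R := (Num.sqrt pi * Gamma (p - 2^-1))%R.

Lemma mass_gt0 : (0 < mass)%R.
Proof. by rewrite mulr_gt0 ?sqrtr_gt0 ?pi_gt0// Gamma_gt0// subr_gt0. Qed.

Lemma mass_bdens x : (Gamma p * (1 + x ^+ 2) `^ (- p) = mass * bdens p x)%R.
Proof.
rewrite /bdens beta'_const1E// -/mass mulrA; congr (_ * _)%R.
by rewrite mulrCA divff ?mulr1// gt_eqF// mass_gt0.
Qed.

Local Opaque mass.

Lemma integral_gammaw_rho (N : nat) (t : 'rV[R]_N) :
  \int[lam N]_w (rho p w t)%:E = (\prod_i (mass * bdens p (t 0%R i))%R)%:E.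
Proof.
rewrite /rho (ge0_integral_prod (h := fun i => gammaw p (1 + t 0%R i ^+ 2))).
- rewrite -prodEFin; apply: eq_bigr => i _.
  by rewrite integral_gammaw ?one_sqr_gt0// mass_bdens.
- by move=> i; exact: measurable_gammaw.
- by move=> i x; exact: gammaw_ge0.
Qed.

Definition below (N : nat) (x : R) (t : 'rV[R]_N) : bool :=
  [forall j : 'I_N, (t 0%R j < x)%R].

Let measurable_below d (T : measurableType d) N (x : T -> R) (t : T -> 'rV[R]_N) :
  measurable_fun setT x -> measurable_fun setT t ->
  measurable_fun setT (fun z => below (x z) (t z)).
Proof.
move=> mx mt; apply: measurable_forallb => j.
by apply: measurable_fun_ltr => //; exact: measurable_coordT.
Qed.

Lemma integral_rho_below (N : nat) (x : R) :
  \int[lam N]_w \int[lam N]_t (rho p w t * (below x t)%:R)%:E =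
  ((mass * fine (bcdf p x)) ^+ N)%:E.
Proof.
have mb : measurable_fun setT (fun t : 'rV[R]_N => (below x t)%:R : R).
  by apply: measurable_bool_real; exact: measurable_below.
rewrite tonelli; last 2 first.
- apply/measurable_EFinP; apply: measurable_funM; first exact: measurable_rho.
  exact: measurableT_comp mb _.
- by move=> w t; rewrite lee_fin mulr_ge0 ?rho_ge0.
pose h (y : R) : R := (mass * ((y < x)%R%:R * bdens p y))%R.
have mh1 : measurable_fun setT (fun y : R => ((y < x)%R%:R * bdens p y)%R).
  apply: measurable_funM; last exact: measurable_bdens.
  by apply: measurable_bool_real; exact: measurable_fun_ltr.
have h10 y : (0 <= (y < x)%R%:R * bdens p y)%R by rewrite mulr_ge0 ?bdens_ge0.
transitivity (\int[lam N]_t (\prod_i h (t 0%R i))%:E).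
  apply: eq_integral => t _; under eq_integral do rewrite EFinM.
  rewrite ge0_integralZr//; last 2 first.
  - by apply/measurable_EFinP; exact: measurable_rho.
  - by move=> w _; rewrite lee_fin rho_ge0.
  rewrite integral_gammaw_rho -EFinM -prod_pos -big_split/=; congr EFin.
  by apply: eq_bigr => i _; rewrite /h mulrAC -mulrA.
rewrite (ge0_integral_prod (h := fun i : 'I_N => h)).
- rewrite (eq_bigr (fun=> (mass * fine (bcdf p x))%:E)); last first.
    move=> i _; under eq_integral do rewrite EFinM.
    rewrite ge0_integralZl; [|by []| | |by rewrite lee_fin ltW// mass_gt0].
    + by rewrite -/(bcdf p x) (EFinM mass) (fineK (bcdf_fin _ p12)).
    + exact/measurable_EFinP.
    + by move=> y _; rewrite lee_fin.
  by rewrite prodEFin prodr_const card_ord.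
- by move=> i; exact: measurable_funM.
- by move=> i y; rewrite /h mulr_ge0// ltW// mass_gt0.
Qed.

Lemma integral_rho (N : nat) :
  \int[lam N]_w \int[lam N]_t (rho p w t)%:E = (mass ^+ N)%:E.
Proof.
rewrite tonelli; last 2 first.
- by apply/measurable_EFinP; exact: measurable_rho.
- by move=> w t; rewrite lee_fin rho_ge0.
under eq_integral do rewrite integral_gammaw_rho.
rewrite (ge0_integral_prod (h := fun (i : 'I_N) x => (mass * bdens p x)%R)).
- rewrite (eq_bigr (fun=> mass%:E)); last first.
    move=> i _; under eq_integral do rewrite EFinM.
    rewrite ge0_integralZl; [|by []| | |by rewrite lee_fin ltW// mass_gt0].
    + by rewrite integral_bdens// mule1.
    + by apply/measurable_EFinP; exact: measurable_bdens.
    + by move=> y _; rewrite lee_fin bdens_ge0.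
  by rewrite prodEFin prodr_const card_ord.
- by move=> i; apply: measurable_funM => //; exact: measurable_bdens.
- by move=> i y; rewrite mulr_ge0 ?bdens_ge0// ltW// mass_gt0.
Qed.

Definition cell_int (n k : nat) (G : {set 'I_n}) : \bar R :=
  \int[lam n]_w \int[lam n]_t (rho p w t * (mean_cell k G w t)%:R)%:E.

Definition above_int (n k : nat) : \bar R :=
  \int[lam n]_w \int[lam n]_t (rho p w t * (above k w t)%:R)%:E.

Let measurable_mean_cell d (T : measurableType d) n k (G : {set 'I_n})
    (w t : T -> 'rV[R]_n) :
  measurable_fun setT w -> measurable_fun setT t ->
  measurable_fun setT (fun z => mean_cell k G (w z) (t z)).
Proof.
move=> mw mt; apply: measurable_and => //; apply: measurable_forallb => i.
have mg : measurable_fun setT (fun z => gmean G (w z) (t z)).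
  apply: measurable_funM.
    rewrite (_ : (fun z => _) = (fun z => \sum_(i <- enum G) w z 0%R i * t z 0%R i)%R); last first.
      by apply/funext => z; rewrite big_enum.
    by apply: measurable_sum => j; apply: measurable_funM; exact: measurable_coordT.
  apply: (measurableT_comp measurable_invr).
  rewrite (_ : (fun z => _) = (fun z => \sum_(i <- enum G) w z 0%R i)%R); last first.
    by apply/funext => z; rewrite big_enum.
  by apply: measurable_sum => j; exact: measurable_coordT.
case: (i \in G); last first.
  by apply: measurable_fun_ltr => //; exact: measurable_coordT.
case: (k <= i)%N => /=; last by [].
by apply: measurable_fun_ler => //; exact: measurable_coordT.
Qed.

(** For positive weights exactly one cell contains [t]; for all other weights [rho] vanishes. *)
Lemma sum_cell_int (n k : nat) : (0 < k <= n)%N ->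
  \sum_(G : {set 'I_n}) cell_int k G = (mass ^+ n)%:E.
Proof.
move=> /andP[k0 kn].
have mf G : measurable_fun setT
    (fun z : 'rV[R]_n * 'rV[R]_n => (rho p z.1 z.2 * (mean_cell k G z.1 z.2)%:R)%:E).
  apply/measurable_EFinP; apply: measurable_funM; first exact: measurable_rho.
  by apply: measurable_bool_real; exact: measurable_mean_cell.
have f0 (G : {set 'I_n}) w t : 0 <= (rho p w t * (mean_cell k G w t)%:R)%:E :> \bar R.
  by rewrite lee_fin mulr_ge0 ?rho_ge0.
rewrite /cell_int -ge0_integral_sum//; last 2 first.
- move=> G; exact: (measurable_tonelli1 (f :=
    fun w t => (rho p w t * (mean_cell k G w t)%:R)%:E) (lam n) (mf G) (f0 G)).
- by move=> G w _; exact: integral_ge0.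
rewrite -integral_rho; apply: eq_integral => w _.
rewrite -ge0_integral_sum//; last first.
  by move=> G; exact: (measurable_section1 (f :=
    fun w t => (rho p w t * (mean_cell k G w t)%:R)%:E) (mf G)).
apply: eq_integral => t _; rewrite sumEFin -mulr_sumr.
have [wp|wp] := boolP (wpos w); first by rewrite sum_mean_cell// mulr1.
by rewrite rhoE ?(leq_trans k0)// /gprod (negbTE wp) !mul0r.
Qed.

Lemma cell_int_notsub (n k : nat) (G : {set 'I_n}) :
  ~~ (prefix_set n k \subset G) -> cell_int k G = 0.
Proof.
move=> /negbTE nG; rewrite /cell_int integral0_eq// => w _.
by rewrite integral0_eq// => t _; rewrite /mean_cell nG mulr0.
Qed.

(** A permutation of the indices that maps the prefix onto itself changes neither [rho] nor Lebesgue
    measure, so only the size of [G] matters. *)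
Lemma cell_int_perm (n k : nat) (G : {set 'I_n}) : (k <= n)%N ->
  prefix_set n k \subset G -> cell_int k G = cell_int k (prefix_set n #|G|).
Proof.
move=> kn sG; have [s sP] := prefix_perm kn sG erefl.
have sk i : (s i < k)%N = (i < k)%N by case: (sP i).
have sm i : (s i \in prefix_set n #|G|) = (i \in G) by rewrite inE; case: (sP i).
have mf : measurable_fun setT
    (fun z : 'rV[R]_n * 'rV[R]_n => (rho p z.1 z.2 * (mean_cell k G z.1 z.2)%:R)%:E).
  apply/measurable_EFinP; apply: measurable_funM; first exact: measurable_rho.
  by apply: measurable_bool_real; exact: measurable_mean_cell.
have f0 w t : 0 <= (rho p w t * (mean_cell k G w t)%:R)%:E :> \bar R.
  by rewrite lee_fin mulr_ge0 ?rho_ge0.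
have mF := measurable_tonelli1 (f := fun w t => (rho p w t * (mean_cell k G w t)%:R)%:E)
  (lam n) mf f0.
have F0 w : 0 <= \int[lam n]_t (rho p w t * (mean_cell k G w t)%:R)%:E by exact: integral_ge0.
etransitivity; first exact: (esym (ge0_integral_perm s mF F0)).
apply: eq_integral => w _.
have ms := measurable_section1 (f := fun w t => (rho p w t * (mean_cell k G w t)%:R)%:E)
  mf (col_perm s w).
etransitivity; first exact: (esym (ge0_integral_perm s ms (f0 _))).
apply: eq_integral => t _; congr (_ * _%:R)%:E.
  rewrite /rho [RHS](reindex_inj (@perm_inj _ s))/=.
  by apply: eq_bigr => i _; rewrite !mxE.
have gE : gmean G (col_perm s w) (col_perm s t) = gmean (prefix_set n #|G|) w t.
  rewrite /gmean [in RHS](reindex_inj (@perm_inj _ s))/=.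
  rewrite [X in (_ / X)%R = _](eq_bigl (fun i => s i \in prefix_set n #|G|)); last by move=> i;
    rewrite sm.
  rewrite [X in _ = (_ / X)%R](reindex_inj (@perm_inj _ s))/=.
  congr (_ / _)%R; last by apply: eq_bigr => i _; rewrite mxE.
  by apply: eq_big => i; rewrite ?sm// !mxE.
rewrite /mean_cell sG gE.
have -> : prefix_set n k \subset prefix_set n #|G|.
  apply/fintype.subsetP => i ik; have := fintype.subsetP sG ((s^-1)%g i).
  rewrite -sm permKV; apply; move: ik; rewrite !inE.
  by rewrite -(sk ((s^-1)%g i)) permKV.
congr nat_of_bool => /=; apply/forallP/forallP => H i.
  have := H ((s^-1)%g i); rewrite -sm permKV !mxE permKV.
  by rewrite (leqNgt k) -(sk ((s^-1)%g i)) permKV -leqNgt.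
have := H (s i); rewrite sm !mxE.
by rewrite (leqNgt k (s i)) sk -leqNgt.
Qed.

End recursion.

(** * Factorisation of a cell and the recursion *)

Section mean_splitting.
Context {R : realType}.
Notation mu := (@lebesgue_measure R).
Notation lam := (lebesgue_rV R).
Local Open Scope ereal_scope.

Variable p : R.
Hypothesis p12 : (2^-1 < p)%R.

Local Notation mass := (mass p).

Lemma rho_row_mx (a b : nat) (w t : 'rV[R]_a) (w' t' : 'rV[R]_b) :
  rho p (row_mx w w') (row_mx t t') = (rho p w t * rho p w' t')%R.
Proof.
rewrite /rho big_split_ord/=; congr (_ * _)%R; apply: eq_bigr => i _.
  by rewrite !row_mxEl.
by rewrite !row_mxEr.
Qed.

Lemma big_prefix (m r : nat) (F : 'I_(m + r) -> R) :
  (\sum_(i in prefix_set (m + r) m) F i = \sum_i F (lshift r i))%R.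
Proof.
rewrite big_mkcond/= big_split_ord/= [X in (_ + X)%R]big1 ?addr0.
  by apply: eq_bigr => i _; rewrite inE/= ltn_ord.
by move=> i _; rewrite inE/= ltnNge leq_addr.
Qed.

Lemma mean_cell_row_mx (m r k : nat) (w t : 'rV[R]_m) (w' t' : 'rV[R]_r) :
  (k <= m)%N ->
  mean_cell k (prefix_set (m + r) m) (row_mx w w') (row_mx t t') =
  above k w t && below (wmean w t) t'.
Proof.
move=> km; rewrite /mean_cell.
have -> : prefix_set (m + r) k \subset prefix_set (m + r) m.
  by apply/fintype.subsetP => i; rewrite !inE => /leq_trans; exact.
have -> : gmean (prefix_set (m + r) m) (row_mx w w') (row_mx t t') = wmean w t.
  rewrite /gmean !big_prefix; congr (_ / _)%R.
    by apply: eq_bigr => i _; rewrite !row_mxEl.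
  by apply: eq_bigr => i _; rewrite row_mxEl.
rewrite andTb; apply/forallP/andP => [H|[/forallP H1 /forallP H2] i].
  split; apply/forallP => i.
    by have := H (lshift r i); rewrite inE/= ltn_ord row_mxEl.
  by have := H (rshift m i); rewrite inE/= ltnNge leq_addr/= row_mxEr.
case: (splitP i) => j ij.
- rewrite (_ : i = lshift r j); last exact/val_inj.
  by rewrite inE/= ltn_ord row_mxEl; exact: H1.
- rewrite (_ : i = rshift m j); last exact/val_inj.
  by rewrite inE/= ltnNge leq_addr/= row_mxEr; exact: H2.
Qed.

Let measurable_below d (T : measurableType d) N (x : T -> R) (t : T -> 'rV[R]_N) :
  measurable_fun setT x -> measurable_fun setT t ->
  measurable_fun setT (fun z => below (x z) (t z)).
Proof.
move=> mx mt; apply: measurable_forallb => j.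
by apply: measurable_fun_ltr => //; exact: measurable_coordT.
Qed.

Let cellf (m r k : nat) (w : 'rV[R]_m) (w' : 'rV[R]_r) (t : 'rV[R]_m) (t' : 'rV[R]_r)
   : \bar R :=
  ((rho p w t * (above k w t)%:R) * (rho p w' t' * (below (wmean w t) t')%:R))%:E.

Let cellf_ge0 m r k w w' t t' : 0 <= @cellf m r k w w' t t'.
Proof. by rewrite lee_fin !mulr_ge0 ?rho_ge0. Qed.

Let measurable_cellf d (T : measurableType d) m r k (w t : T -> 'rV[R]_m)
    (w' t' : T -> 'rV[R]_r) :
  measurable_fun setT w -> measurable_fun setT t ->
  measurable_fun setT w' -> measurable_fun setT t' ->
  measurable_fun setT (fun z => cellf k (w z) (w' z) (t z) (t' z)).
Proof.
move=> mw mt mw' mt'; apply/measurable_EFinP; apply: measurable_funM; apply: measurable_funM.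
- exact: measurable_rho.
- by apply: measurable_bool_real; exact: measurable_above.
- exact: measurable_rho.
- by apply: measurable_bool_real; apply: measurable_below => //; exact: measurable_wmean.
Qed.

Let cellfE m r k w w' t t' : (k <= m)%N ->
  (rho p (row_mx w w') (row_mx t t') *
    (mean_cell k (prefix_set (m + r) m) (row_mx w w') (row_mx t t'))%:R)%:E =
  cellf k w w' t t'.
Proof.
move=> km; rewrite rho_row_mx mean_cell_row_mx// -mulnb natrM /cellf.
by congr EFin; rewrite mulrACA.
Qed.

Lemma measurable_below_mass r :
  measurable_fun setT (fun x => ((mass * fine (bcdf p x)) ^+ r)%:E : \bar R).
Proof.
apply/measurable_EFinP; apply: measurable_funX; apply: measurable_funM => //.
by apply: (measurableT_comp (f := fine)) => //; exact: measurable_bcdf.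
Qed.

Lemma below_mass_ge0 r x : 0 <= ((mass * fine (bcdf p x)) ^+ r)%:E.
Proof.
rewrite lee_fin exprn_ge0// mulr_ge0 ?fine_ge0 ?bcdf_ge0//.
exact/ltW/mass_gt0.
Qed.

(** Given the first block of indices, the cell asks each of the other [r] numbers to lie below the
    mean of that block. Integrating these out with their weights leaves a power of the distribution
    function at the mean. *)
Lemma cell_int_prefix_mean (m r k : nat) : (k <= m)%N ->
  cell_int p k (prefix_set (m + r) m) =
  \int[lam m]_w \int[lam m]_t ((rho p w t * (above k w t)%:R)%:E *
     ((mass * fine (bcdf p (wmean w t))) ^+ r)%:E).
Proof.
move=> km; rewrite /cell_int.
pose F (W T : 'rV[R]_(m + r)) : \bar R :=
  (rho p W T * (mean_cell k (prefix_set (m + r) m) W T)%:R)%:E.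
have F0 W T : 0 <= F W T by rewrite lee_fin mulr_ge0 ?rho_ge0.
have mF : measurable_fun setT (fun z => F z.1 z.2).
  have -> : (fun z => F z.1 z.2) = (fun z : 'rV[R]_(m + r) * 'rV[R]_(m + r) =>
      cellf k (lsubmx z.1) (rsubmx z.1) (lsubmx z.2) (rsubmx z.2)).
    by apply/funext => z; rewrite -cellfE// !hsubmxK.
  have ml (g : 'rV[R]_(m + r) * 'rV[R]_(m + r) -> 'rV[R]_(m + r)) :
      measurable_fun setT g -> measurable_fun setT (fun z => lsubmx (g z) : 'rV[R]_m).
    by move=> mg; apply: measurable_fun_rV => i; under eq_fun do rewrite mxE;
      exact: measurable_coordT.
  have mr (g : 'rV[R]_(m + r) * 'rV[R]_(m + r) -> 'rV[R]_(m + r)) :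
      measurable_fun setT g -> measurable_fun setT (fun z => rsubmx (g z) : 'rV[R]_r).
    by move=> mg; apply: measurable_fun_rV => i; under eq_fun do rewrite mxE;
      exact: measurable_coordT.
  by apply: measurable_cellf; [exact: ml|exact: ml|exact: mr|exact: mr].
transitivity (\int[lam (m + r)]_W \int[lam (m + r)]_T F W T); first by [].
rewrite ge0_integral_row_mx; last 2 first.
- exact: (measurable_tonelli1 (f := F) (lam (m + r)) mF F0).
- by move=> W; exact: integral_ge0.
apply: eq_integral => w _.
transitivity (\int[lam r]_w' \int[lam m]_t \int[lam r]_t' cellf k w w' t t').
  apply: eq_integral => w' _.
  rewrite ge0_integral_row_mx; last 2 first.
  - exact: (measurable_section1 (f := F) mF).
  - exact: F0.
  by apply: eq_integral => t _; apply: eq_integral => t' _; exact: cellfE.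
rewrite tonelli; last 2 first.
- have mc : measurable_fun setT (fun z : ('rV[R]_r * 'rV[R]_m) * 'rV[R]_r =>
    cellf k w z.1.1 z.1.2 z.2).
    by apply: measurable_cellf => //; exact: measurableT_comp.
  exact: (measurable_tonelli1 (f := fun (z : 'rV[R]_r * 'rV[R]_m) t' => cellf k w z.1 z.2 t')
    (lam r) mc (fun z t' => cellf_ge0 _ _ _ _ _)).
- by move=> w' t; apply: integral_ge0 => t' _; exact: cellf_ge0.
apply: eq_integral => t _.
rewrite -integral_rho_below// -ge0_integralZl; last 4 first.
- by [].
- have mb : measurable_fun setT (fun z : 'rV[R]_r * 'rV[R]_r =>
      (rho p z.1 z.2 * (below (wmean w t) z.2)%:R)%:E).
    apply/measurable_EFinP; apply: measurable_funM; first exact: measurable_rho.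
    by apply: measurable_bool_real; exact: measurable_below.
  have b0 (w' t' : 'rV[R]_r) : 0 <= (rho p w' t' * (below (wmean w t) t')%:R)%:E.
    by rewrite lee_fin mulr_ge0 ?rho_ge0.
  exact: (measurable_tonelli1 (f := fun w' t' => (rho p w' t' * (below (wmean w t) t')%:R)%:E)
    (lam r) mb b0).
- by move=> w' _; apply: integral_ge0 => t' _; rewrite lee_fin mulr_ge0 ?rho_ge0.
- by rewrite lee_fin mulr_ge0 ?rho_ge0.
apply: eq_integral => w' _; rewrite -ge0_integralZl; last 4 first.
- by [].
- apply/measurable_EFinP; apply: measurable_funM; first exact: measurable_rho.
  by apply: measurable_bool_real; exact: measurable_below.
- by move=> t' _; rewrite lee_fin mulr_ge0 ?rho_ge0.
- by rewrite lee_fin mulr_ge0 ?rho_ge0.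
by apply: eq_integral => t' _; rewrite -EFinM.
Qed.

Lemma mean_exponentE (m : nat) :
  mean_exponent m p = (((2 * p - 1) * m%:R + 1) / 2)%R.
Proof. by rewrite /mean_exponent; field. Qed.

Lemma cell_int_prefix (m r k : nat) : (0 < m)%N -> (k <= m)%N ->
  cell_int p k (prefix_set (m + r) m) =
  above_int p m k * (mass ^+ r * tildeI (m + r) m (2 * p - 1))%:E.
Proof.
move=> m0 km; rewrite cell_int_prefix_mean//.
rewrite (integral_rho_above_mean k p m0 (measurable_below_mass r) (below_mass_ge0 r)).
(* The same formula with the constant function 1 evaluates [above_int], so that [slice_total]
   appears on both sides. *)
have := integral_rho_above_mean k p m0 (Psi := fun=> 1) (measurable_cst 1) (fun _ => lee01).
under eq_integral do under eq_integral do rewrite mule1.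
rewrite -/(above_int p m k) => ->.
have a0 : (0 < 2 * p - 1)%R by move: p12; lra.
set e := mean_exponent m p.
have e12 : (2^-1 < e)%R.
  rewrite /e mean_exponentE; have : (0 < (2 * p - 1) * m%:R)%R by rewrite mulr_gt0// ltr0n.
  by move: (_ * _)%R => z z0; lra.
have c0 : (0 < beta'_const 1 e)%R.
  rewrite lt_neqAle beta'_const_ge0 ?mul1r// andbT; apply/eqP => c0.
  have := integral_bdens e12; rewrite /bdens -c0.
  under eq_integral do rewrite mul0r.
  by rewrite integral0 => /eqP; rewrite eqe eq_sym oner_eq0.
have bE x : ((1 + x ^+ 2) `^ (- e))%:E = ((beta'_const 1 e)^-1)%:E * (bdens e x)%:E.
  by rewrite -EFinM mulKf// gt_eqF.
have mb : measurable_fun setT (fun x => (bdens e x)%:E).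
  by apply/measurable_EFinP; exact: measurable_bdens.
have b0 x : 0 <= (bdens e x)%:E by rewrite lee_fin bdens_ge0.
have ci0 : 0 <= ((beta'_const 1 e)^-1)%:E by rewrite lee_fin invr_ge0 ltW.
under [in LHS]eq_integral do rewrite bE -muleA.
under [in RHS]eq_integral do rewrite bE mule1.
rewrite [in RHS]ge0_integralZl; [|by []|by []|by []|by []].
rewrite [in LHS]ge0_integralZl; [|by []| | |by []]; last 2 first.
- by apply: emeasurable_funM => //; exact: measurable_below_mass.
- by move=> x _; rewrite mule_ge0// below_mass_ge0.
rewrite integral_bdens// mule1 -!muleA; congr (_ * (_ * _)).
rewrite EFinM tildeIE; last 2 first.
- exact: a0.
- exact: m0.
rewrite -mean_exponentE -/e.
rewrite (_ : (2 * p - 1 + 1) / 2 = p)%R; last by field.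
rewrite addnC addnK -ge0_integralZl; last 4 first.
- by [].
- apply/measurable_EFinP; apply: measurable_funM; first exact: measurable_bdens.
  by apply: measurable_funX; by apply: (measurableT_comp (f := fine)) => //; exact: measurable_bcdf.
- move=> x _; rewrite lee_fin mulr_ge0 ?bdens_ge0// exprn_ge0// fine_ge0//.
  exact: bcdf_ge0.
- by rewrite lee_fin exprn_ge0// ltW// mass_gt0.
by apply: eq_integral => x _; rewrite -!EFinM exprMn mulrCA.
Qed.

Lemma above_int_le (m k : nat) : above_int p m k <= (mass ^+ m)%:E.
Proof.
rewrite -integral_rho//.
have mf : measurable_fun setT (fun z : 'rV[R]_m * 'rV[R]_m =>
    (rho p z.1 z.2 * (above k z.1 z.2)%:R)%:E).
  apply/measurable_EFinP; apply: measurable_funM; first exact: measurable_rho.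
  by apply: measurable_bool_real; exact: measurable_above.
have mg : measurable_fun setT (fun z : 'rV[R]_m * 'rV[R]_m => (rho p z.1 z.2)%:E).
  by apply/measurable_EFinP; exact: measurable_rho.
have f0 (w t : 'rV[R]_m) : 0 <= (rho p w t * (above k w t)%:R)%:E.
  by rewrite lee_fin mulr_ge0 ?rho_ge0.
have g0 (w t : 'rV[R]_m) : 0 <= (rho p w t)%:E by rewrite lee_fin rho_ge0.
apply: ge0_le_integral => //.
- by move=> w _; exact: integral_ge0.
- exact: (measurable_tonelli1 (f := fun w t => (rho p w t * (above k w t)%:R)%:E) (lam m) mf f0).
- exact: (measurable_tonelli1 (f := fun w t => (rho p w t)%:E) (lam m) mg g0).
- move=> w _; apply: ge0_le_integral => //.
  + exact: (measurable_section1 (f := fun w t => (rho p w t * (above k w t)%:R)%:E) mf).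
  + exact: (measurable_section1 (f := fun w t => (rho p w t)%:E) mg).
  + move=> t _; rewrite lee_fin ler_piMr ?rho_ge0//.
    by case: (above k w t).
Qed.

Definition prob_above (m k : nat) : R := (fine (above_int p m k) / mass ^+ m)%R.

Lemma above_intE (m k : nat) : above_int p m k = (prob_above m k * mass ^+ m)%:E.
Proof.
rewrite /prob_above divfK ?expf_neq0 ?gt_eqF ?mass_gt0// fineK//.
rewrite ge0_fin_numE; first exact: le_lt_trans (above_int_le m k) (ltry _).
apply: integral_ge0 => w _; apply: integral_ge0 => t _.
by rewrite lee_fin mulr_ge0 ?rho_ge0.
Qed.

Lemma cell_int_prefix_set (n m k : nat) : (0 < m)%N -> (k <= m <= n)%N ->
  cell_int p k (prefix_set n m) =
  above_int p m k * (mass ^+ (n - m) * tildeI n m (2 * p - 1))%:E.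
Proof.
move=> m0 /andP[km mn]; rewrite -(subnKC mn) cell_int_prefix//.
by rewrite [(m + (n - m) - m)%N]addKn.
Qed.

Lemma card_prefix_set (n k : nat) : (k <= n)%N -> #|prefix_set n k| = k.
Proof.
move=> kn; have -> : prefix_set n k = [set widen_ord kn i | i in [set: 'I_k]]%SET.
  apply/setP => i; rewrite inE; apply/idP/imsetP => [ik|[j _ ->]]; last exact: (ltn_ord j).
  by exists (Ordinal ik) => //; exact: val_inj.
by rewrite card_imset ?cardsT ?card_ord// => i j /(congr1 val)/= /val_inj.
Qed.

Lemma card_prefix_supersets (n k m : nat) : (k <= m)%N -> (k <= n)%N ->
  #|[set G : {set 'I_n} | (prefix_set n k \subset G) && (#|G| == m)]%SET| = 'C(n - k, m - k).
Proof.
move=> km kn; have cA := card_prefix_set kn.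
have cC : #|~: prefix_set n k| = (n - k)%N.
  by rewrite cardsCs finset.setCK card_ord cA.
rewrite -cC -cards_draws -[RHS](card_in_imset (f := fun G => prefix_set n k :|: G)%SET); last first.
  move=> G H; rewrite !inE => /andP[sG _] /andP[sH _] /= E.
  have D (K : {set 'I_n}) : K \subset ~: prefix_set n k ->
      (prefix_set n k :|: K) :\: prefix_set n k = K.
    move=> sK; rewrite finset.setDUl finset.setDv finset.set0U finset.setDE.
    exact/finset.setIidPl.
  by rewrite -(D G)// E D.
apply: eq_card => G; rewrite inE; apply/andP/imsetP => [[sG /eqP cG]|[H]].
  exists (G :\: prefix_set n k); last first.
    apply/setP => i; rewrite !inE; move/fintype.subsetP: sG => /(_ i).
    by rewrite inE; case: (i < k)%N; case: (i \in G) => // /(_ isT).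
  rewrite inE cardsD (finset.setIidPr sG) cG cA eqxx andbT.
  by rewrite finset.setDE finset.subsetIr.
rewrite inE => /andP[sH /eqP cH] ->; rewrite finset.subsetUl; split => //.
rewrite cardsU cA cH (_ : _ :&: _ = finset.set0) ?cards0 ?subn0 ?subnKC//.
apply/setP => i; rewrite !inE; case: (boolP (i \in H)); last by rewrite andbF.
by move/(fintype.subsetP sH); rewrite !inE => /negbTE ->.
Qed.

Lemma prob_above_recursion (n k : nat) : (0 < k <= n)%N ->
  (\sum_(k <= m < n.+1) 'C(n - k, m - k)%:R *
     (prob_above m k * tildeI n m (2 * p - 1)) = 1)%R.
Proof.
move=> /andP[k0 kn]; set A := (2 * p - 1)%R.
have mn0 : (mass ^+ n != 0)%R by rewrite expf_neq0// gt_eqF// mass_gt0.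
pose f m := (prob_above m k * tildeI n m A)%R.
have cE (G : {set 'I_n}) : cell_int p k G =
    (if prefix_set n k \subset G then mass ^+ n * f #|G| else 0)%R%:E.
  case: ifPn => sG; last by rewrite cell_int_notsub.
  rewrite cell_int_perm//.
  have Gn : (#|G| <= n)%N by rewrite -[X in (_ <= X)%N](card_ord n) max_card.
  have kG : (k <= #|G|)%N by rewrite -(card_prefix_set kn) subset_leq_card.
  rewrite cell_int_prefix_set ?kG//; last exact: leq_trans kG.
  rewrite above_intE -EFinM; congr EFin.
  rewrite -/A /f -[X in (_ = mass ^+ X * _)%R](subnKC Gn) exprD; ring.
have := sum_cell_int p12 (introT andP (conj k0 kn)).
under eq_bigr do rewrite cE.
rewrite sumEFin => -[]; rewrite -big_mkcond/= -mulr_sumr.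
move=> /(canRL (mulKf mn0)); rewrite mulVf// => E; rewrite -[RHS]E {E}.
(* Group the sets by size. [inord] is exact here since no set has more than [n] elements, and sizes
   below [k] give empty sums. *)
rewrite [RHS](partition_big (fun G : {set 'I_n} => inord #|G| : 'I_n.+1) xpredT)//=.
rewrite (big_geq_mkord _ n.+1 xpredT) [RHS](bigID (fun m : 'I_n.+1 => (k <= m)%N))/=.
rewrite [X in (_ = _ + X)%R]big1 ?addr0 => [|m]; last first.
  rewrite -ltnNge => mk; rewrite big1// => G /andP[sG /eqP Gm].
  have Gn : (#|G| <= n)%N by rewrite -[X in (_ <= X)%N](card_ord n) max_card.
  have kG : (k <= #|G|)%N by rewrite -(card_prefix_set kn) subset_leq_card.
  by move: mk; rewrite -Gm inordK// ltnNge kG.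
apply: eq_bigr => m km.
rewrite -(card_prefix_supersets km kn) mulr_natl -sumr_const.
apply: eq_big => [G|G]; last by rewrite inE => /andP[_ /eqP ->].
have Gn : (#|G| <= n)%N by rewrite -[X in (_ <= X)%N](card_ord n) max_card.
by rewrite inE -val_eqE/= inordK.
Qed.

End mean_splitting.

(** * Sums over chains *)

Section chains.
Context {R : comRingType}.
Variables (k : nat) (B : nat -> nat -> R).

(** This is [is_chain] with the starting value [a] separated from the bound [N] on the entries, so
    that the tail of a chain is again a chain for the same [N]. *)
Definition chain_from (N a l : nat) (s : {ffun 'I_l.+1 -> 'I_N.+1}) : bool :=
  [&& s ord0 == a :> nat,
      [forall i : 'I_l, (s (lift ord0 i) < s (widen_ord (leqnSn l) i))%N] &
      (k <= s ord_max)%N].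

Definition chain_weight (N l : nat) (s : {ffun 'I_l.+1 -> 'I_N.+1}) : R :=
  (\prod_(i < l) B (s (widen_ord (leqnSn l) i)) (s (lift ord0 i))) *
  'C(s ord_max, k)%:R.

Definition chain_sum (N a l : nat) : R :=
  \sum_(s : {ffun 'I_l.+1 -> 'I_N.+1} | chain_from a s) chain_weight s.

Lemma chain_sum0 (N a : nat) : (a <= N)%N -> chain_sum N a 0 = 'C(a, k)%:R.
Proof.
move=> aN; have aN1 : (a < N.+1)%N by [].
rewrite /chain_sum; have [ka|ak] := leqP k a.
  rewrite (big_pred1 [ffun=> Ordinal aN1]).
    by rewrite /chain_weight big_ord0 mul1r ffunE.
  move=> s; rewrite /chain_from/=; apply/and3P/eqP => [[/eqP s0 _ _]|->].
    by apply/ffunP => i; rewrite ffunE ord1; exact: val_inj.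
  by split; rewrite ?ffunE//; apply/forallP => -[].
(* When [a < k] there is no chain, in agreement with the binomial coefficient being 0. *)
rewrite bin_small// big1// => s /and3P[/eqP s0 _].
rewrite (_ : ord_max = (ord0 : 'I_1)); last exact: val_inj.
by rewrite s0 leqNgt ak.
Qed.

Definition chain_cons (N l : nat) (z : 'I_N.+1 * {ffun 'I_l.+1 -> 'I_N.+1}) :
    {ffun 'I_l.+2 -> 'I_N.+1} :=
  [ffun i => if unlift ord0 i is Some j then z.2 j else z.1].

Lemma chain_cons0 N l z : @chain_cons N l z ord0 = z.1.
Proof. by rewrite ffunE unlift_none. Qed.

Lemma chain_consS N l z i : @chain_cons N l z (lift ord0 i) = z.2 i.
Proof. by rewrite ffunE liftK. Qed.

Let widen_lift0 l (j : 'I_l) :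
  widen_ord (leqnSn l.+1) (lift ord0 j) = lift ord0 (widen_ord (leqnSn l) j).
Proof. exact: val_inj. Qed.

Let widen_ord00 l : widen_ord (leqnSn l.+1) ord0 = ord0.
Proof. exact: val_inj. Qed.

Let ord_maxS l : ord_max = lift ord0 (@ord_max l).
Proof. exact: val_inj. Qed.

Lemma chain_from_cons N a l z : chain_from a (@chain_cons N l z) =
  [&& z.1 == a :> nat, (z.2 ord0 < a)%N & chain_from (z.2 ord0) z.2].
Proof.
rewrite /chain_from chain_cons0 eqxx ord_maxS chain_consS/=.
case: (eqVneq (z.1 : nat) a) => //= za.
rewrite andbA; congr (_ && _); apply/forallP/andP => [H|[H0 /forallP H] i].
  split; first by have := H ord0; rewrite widen_ord00 chain_cons0 chain_consS za.
  by apply/forallP => j; have := H (lift ord0 j); rewrite widen_lift0 !chain_consS.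
case: (unliftP ord0 i) => [j|] ->; first by rewrite widen_lift0 !chain_consS.
by rewrite widen_ord00 chain_cons0 chain_consS za.
Qed.

Lemma chain_weight_cons N l z :
  chain_weight (@chain_cons N l z) = B z.1 (z.2 ord0) * chain_weight z.2.
Proof.
rewrite /chain_weight big_ord_recl ord_maxS chain_consS widen_ord00 chain_cons0.
rewrite chain_consS -mulrA; congr (_ * (_ * _)).
by apply: eq_bigr => i _; rewrite widen_lift0 !chain_consS.
Qed.

(** Remove the first entry and sort the tails by where they start. Starts below [k] are allowed in
    the sum and carry empty sums. *)
Lemma chain_sumS (N a l : nat) : (a <= N)%N ->
  chain_sum N a l.+1 = \sum_(0 <= m < a) B a m * chain_sum N m l.
Proof.
move=> aN; have aN1 : (a < N.+1)%N by [].
rewrite /chain_sum (reindex (@chain_cons N l)); last first.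
  exists (fun s : {ffun 'I_l.+2 -> 'I_N.+1} =>
    (s ord0, [ffun j : 'I_l.+1 => s (lift ord0 j)])) => [[x s]|s] _.
    rewrite chain_cons0; congr pair; apply/ffunP => j.
    by rewrite ffunE chain_consS.
  apply/ffunP => i; case: (unliftP ord0 i) => [j|] ->.
    by rewrite chain_consS ffunE.
  by rewrite chain_cons0.
under eq_bigl do rewrite chain_from_cons.
under eq_bigr do rewrite chain_weight_cons.
rewrite -(pair_big_dep (fun x : 'I_N.+1 => x == a :> nat)
  (fun _ (s : {ffun 'I_l.+1 -> 'I_N.+1}) => (s ord0 < a)%N && chain_from (s ord0) s)
  (fun x (s : {ffun 'I_l.+1 -> 'I_N.+1}) => B x (s ord0) * chain_weight s))/=.
rewrite (big_pred1 (Ordinal aN1)) //=.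
rewrite (partition_big (fun s : {ffun 'I_l.+1 -> 'I_N.+1} => s ord0)
  (fun m => m < a)%N)/=; last by move=> s /andP[].
rewrite (big_nat_widen _ _ N.+1)/=; last exact: leqW.
rewrite big_mkord; apply: eq_bigr => m ma.
rewrite mulr_sumr; apply: eq_big => [s|s /andP[_ /eqP ->]] //.
case: (eqVneq (s ord0) m) => [->|/negbTE sm]; first by rewrite ma andbT.
by rewrite andbF /chain_from val_eqE sm.
Qed.

Lemma chain_sum_small (N a l : nat) : (a <= N)%N -> (a < k)%N ->
  chain_sum N a l = 0.
Proof.
elim: l a => [|l IH] a aN ak; first by rewrite chain_sum0// bin_small.
rewrite chain_sumS// big_nat big1// => m /andP[_ ma].
by rewrite IH ?mulr0//; [exact: leq_trans (ltnW ma) aN|exact: ltn_trans ak].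
Qed.

(* A unitriangular system is solved by the Neumann series of its strictly
   triangular part, whose powers are sums over chains. *)
Lemma chain_inversion (f : nat -> R) (N : nat) :
  (forall n, (k <= n)%N -> B n n = 1) ->
  (forall n, (k <= n)%N -> \sum_(k <= m < n.+1) B n m * f m = 'C(n, k)%:R) ->
  forall L a, (k <= a <= N)%N -> (a - k < L)%N ->
    \sum_(0 <= l < L) (-1) ^+ l * chain_sum N a l = f a.
Proof.
move=> B1 fE; elim=> // L IH a /andP[ka aN] aL.
rewrite big_nat_recl// expr0 mul1r chain_sum0//.
have := fE a ka; rewrite big_nat_recr//= B1// mul1r => <-.
rewrite addrAC -[RHS]add0r; congr (_ + _).
under [X in _ + X]eq_bigr do rewrite chain_sumS// exprS mulN1r mulNr mulr_sumr.
rewrite sumrN; apply/eqP; rewrite subr_eq0; apply/eqP.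
rewrite exchange_big/= [in RHS](big_cat_nat _ ka)//= [X in _ = X + _]big_nat.
rewrite [X in _ = X + _]big1 ?add0r => [|m /andP[_ mk]]; last first.
  rewrite big1// => l _; rewrite chain_sum_small ?mulr0//.
  exact: leq_trans (ltnW mk) (leq_trans ka aN).
rewrite !big_nat; apply: eq_bigr => m /andP[km ma].
rewrite -(IH m).
- by rewrite mulr_sumr; apply: eq_bigr => l _; rewrite mulrCA.
- by rewrite km (leq_trans (ltnW ma)).
- by rewrite -ltnS (leq_trans _ aL)// ltnS ltn_sub2r// (leq_ltn_trans km).
Qed.

End chains.

(** * Cones invariant under affine changes of scale *)

Lemma measurable_sqrtr (R : realType) :
  measurable_fun [set: R] (fun x : R => Num.sqrt x).
Proof.
rewrite (_ : (fun x => _) = (fun x : R => if 0 <= x then x `^ 2^-1 else 0)).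
  by apply: measurable_fun_ifT => //; exact: measurable_fun_ler.
apply/funext => x; case: ifPn => [x0|]; first by rewrite powR12_sqrt.
by rewrite -ltNge => /ltW; exact: ler0_sqrtr.
Qed.

Section cross_ratio.
Context {R : realType}.
Notation mu := (@lebesgue_measure R).
Notation lam := (lebesgue_rV R).
Local Open Scope ereal_scope.
Variables (m : nat) (w : 'rV[R]_m).
Hypothesis w0 : (0 < wsum w)%R.
Hypothesis wvar_ge0 : forall t, (0 <= wvar w t)%R.

(** For positive [N] this is [N] to the power (1 - m)/2. With this factor, the image under [wvar] of
    Lebesgue measure on the slab is a multiple of dN/N, also when restricted to an invariant cone.
    The value 0 at [N = 0] discards the vectors of zero variance. *)
Definition haarw (N : R) : R := (Num.sqrt N * Num.sqrt N ^- m)%R.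

Lemma haarw0 : haarw 0 = 0%R.
Proof. by rewrite /haarw sqrtr0 mul0r. Qed.

Lemma haarw_ge0 N : (0 <= haarw N)%R.
Proof. by rewrite mulr_ge0 ?sqrtr_ge0// invr_ge0 exprn_ge0// sqrtr_ge0. Qed.

Lemma haarw_gt0 N : (0 < N)%R -> (0 < haarw N)%R.
Proof. by move=> N0; rewrite mulr_gt0 ?sqrtr_gt0// invr_gt0 exprn_gt0// sqrtr_gt0. Qed.

Lemma haarwM a b : (0 <= a)%R -> haarw (a * b) = (haarw a * haarw b)%R.
Proof. by move=> a0; rewrite /haarw sqrtrM// exprMn invfM mulrACA. Qed.

Lemma measurable_haarw : measurable_fun setT haarw.
Proof.
apply: measurable_funM; first exact: measurable_sqrtr.
apply: (measurableT_comp measurable_invr).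
by apply: measurable_funX; exact: measurable_sqrtr.
Qed.

Let mN : measurable_fun setT (fun t : 'rV[R]_m => wvar w t).
Proof. exact: measurable_wvar. Qed.

Let mM : measurable_fun setT (fun t : 'rV[R]_m => wmean w t).
Proof. exact: measurable_wmean. Qed.

Definition haar_weight (F : 'rV[R]_m -> \bar R) (t : 'rV[R]_m) : \bar R :=
  F t * (haarw (wvar w t))%:E * unitb (wmean w t).

Definition haar_int (F : 'rV[R]_m -> \bar R) (f : R -> \bar R) : \bar R :=
  \int[lam m]_t (haar_weight F t * f (wvar w t)).

Definition cone_invariant (F : 'rV[R]_m -> \bar R) :=
  [/\ measurable_fun setT F, forall t, 0 <= F t,
      forall t l, F (t + const_mx l)%R = F t &
      forall t c, (0 < c)%R -> F (c *: t)%R = F t].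

Lemma cone_invariant1 : cone_invariant (fun=> 1).
Proof. by split. Qed.

Section fixed_cone.
Variable F : 'rV[R]_m -> \bar R.
Hypothesis Fcone : cone_invariant F.

Let mF : measurable_fun setT F. Proof. by case: Fcone. Qed.
Let F0 t : 0 <= F t. Proof. by case: Fcone. Qed.

Lemma haar_weight_ge0 t : 0 <= haar_weight F t.
Proof. by rewrite /haar_weight !mule_ge0 ?unitb_ge0 ?lee_fin ?haarw_ge0. Qed.

Lemma haar_weight0 t : wvar w t = 0%R -> haar_weight F t = 0.
Proof. by move=> N0; rewrite /haar_weight N0 haarw0 mule0 mul0e. Qed.

Lemma measurable_haar_weight : measurable_fun setT (haar_weight F).
Proof.
apply: emeasurable_funM; last exact: measurable_unitb.
apply: emeasurable_funM => //; apply/measurable_EFinP.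
exact: (measurableT_comp measurable_haarw mN).
Qed.

Lemma haar_int_ge0 f : (forall N, 0 <= f N) -> 0 <= haar_int F f.
Proof.
by move=> f0; apply: integral_ge0 => t _; rewrite mule_ge0 ?haar_weight_ge0.
Qed.

(** Dilating [t] by the square root of [r] multiplies the variance by [r]; [haarw] absorbs the scale
    factor of the slab. *)
Lemma haar_int_scale (f : R -> \bar R) (r : R) : (0 < r)%R ->
  measurable_fun setT f -> (forall N, 0 <= f N) ->
  haar_int F (fun N => f (r * N)%R) = haar_int F f.
Proof.
move=> r0 mf f0; have [_ _ Fshift FZ] := Fcone.
pose c := Num.sqrt r; have c0 : (0 < c)%R by rewrite sqrtr_gt0.
have c2 : (c ^+ 2 = r)%R by rewrite sqr_sqrtr// ltW.
pose k t := F t * (haarw (wvar w t))%:E * f (wvar w t).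
have k0 t : 0 <= k t by rewrite /k !mule_ge0 ?lee_fin ?haarw_ge0.
have mk : measurable_fun setT k.
  apply: emeasurable_funM; last exact: measurableT_comp mf mN.
  apply: emeasurable_funM => //; apply/measurable_EFinP.
  exact: (measurableT_comp measurable_haarw mN).
have kshift t l : k (t + const_mx l)%R = k t by rewrite /k Fshift wvar_shift.
have hr := haarw_gt0 r0.
have := integral_unitb_scale w0 mk k0 kshift c0.
have -> : (c * c ^- m)%R = haarw r by [].
have kZ t : k (c *: t)%R * unitb (wmean w t) =
    (haarw r)%:E * (haar_weight F t * f (r * wvar w t)%R).
  rewrite /k /haar_weight FZ// wvarZ c2 haarwM ?(ltW r0)// EFinM.
  rewrite -!muleA muleCA; congr (_ * (_ * (_ * _))).
  by rewrite muleC.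
under [in LHS]eq_integral do rewrite kZ.
rewrite ge0_integralZl; [|by []| | |by rewrite lee_fin haarw_ge0]; last 2 first.
- apply: emeasurable_funM; first exact: measurable_haar_weight.
  by apply: (measurableT_comp mf); exact: measurable_funM.
- by move=> t _; rewrite mule_ge0 ?haar_weight_ge0.
move=> /(congr1 (fun z => (haarw r)^-1%:E * z)).
rewrite !muleA -!EFinM mulVf ?gt_eqF// !mul1e => E.
rewrite /haar_int E; apply: eq_integral => t _.
by rewrite /k /haar_weight muleAC.
Qed.

End fixed_cone.

(* Uniqueness of the Haar measure dN/N of the multiplicative group. *)
Lemma haar_int_cross (F : 'rV[R]_m -> \bar R) (f g : R -> \bar R) :
  cone_invariant F ->
  measurable_fun setT f -> (forall N, 0 <= f N) ->
  measurable_fun setT g -> (forall N, 0 <= g N) ->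
  haar_int F f * haar_int (fun=> 1) g =
  haar_int F g * haar_int (fun=> 1) (fun N => f N^-1)%R.
Proof.
move=> Fc mf f0 mg g0.
have T1 := cone_invariant1.
have mfi : measurable_fun setT (fun N : R => f N^-1%R)
  by exact: (measurableT_comp mf measurable_invr).
have Npos t : wvar w t = 0%R \/ (0 < wvar w t)%R.
  by have := wvar_ge0 t; rewrite le_eqVlt => /predU1P[->|]; [left|right].
set QF := haar_weight F; set QT := haar_weight (fun=> 1).
have QF0 t : 0 <= QF t by exact: haar_weight_ge0.
have QT0 t : 0 <= QT t by exact: haar_weight_ge0.
have mQF : measurable_fun setT QF by exact: measurable_haar_weight.
have mQT : measurable_fun setT QT by exact: measurable_haar_weight.
have mfN : measurable_fun setT (fun t => f (wvar w t)) by exact: measurableT_comp mf mN.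
have mgN : measurable_fun setT (fun t => g (wvar w t)) by exact: measurableT_comp mg mN.
have mN1 : measurable_fun setT (fun z : 'rV[R]_m * 'rV[R]_m => wvar w z.1)
  by exact: measurableT_comp mN _.
have mN2 : measurable_fun setT (fun z : 'rV[R]_m * 'rV[R]_m => wvar w z.2)
  by exact: measurableT_comp mN _.
(* The variance of [s] is rescaled by that of [t], then, after exchanging the integrals, that of [t]
   by the inverse of that of [s], and finally that of [s] once more; each time [haar_int_scale]
   applies. *)
transitivity (\int[lam m]_t \int[lam m]_s
    (QF t * f (wvar w t) * (QT s * g (wvar w t * wvar w s)%R))).
  rewrite -ge0_integralZr; last 4 first.
  - by [].
  - exact: emeasurable_funM.
  - by move=> t _; rewrite mule_ge0.
  - exact: haar_int_ge0.
  apply: eq_integral => t _; rewrite ge0_integralZl; last 4 first.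
  - by [].
  - by apply: emeasurable_funM => //; apply: (measurableT_comp mg); exact: measurable_funM.
  - by move=> s _; rewrite mule_ge0.
  - by rewrite mule_ge0.
  have [t0|t0] := Npos t; first by rewrite /QF haar_weight0// !mul0e.
  congr (_ * _); exact: (esym (haar_int_scale T1 t0 mg g0)).
rewrite tonelli; last 2 first.
- apply: emeasurable_funM; apply: emeasurable_funM.
  + exact: measurableT_comp mQF _.
  + exact: measurableT_comp mf mN1.
  + exact: measurableT_comp mQT _.
  + by apply: (measurableT_comp mg); exact: measurable_funM.
- by move=> t s; apply: mule_ge0; apply: mule_ge0.
transitivity (\int[lam m]_s \int[lam m]_t
    (QF t * g (wvar w t) * (QT s * f (wvar w t / wvar w s)%R))).
  apply: eq_integral => s _.
  pose h N := f N * g (N * wvar w s)%R.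
  pose h' N := f (N / wvar w s)%R * g N.
  have mh : measurable_fun setT h.
    by apply: emeasurable_funM => //; apply: (measurableT_comp mg); exact: measurable_funM.
  have mh' : measurable_fun setT h'.
    by apply: emeasurable_funM => //; apply: (measurableT_comp mf); exact: measurable_funM.
  have h0 N : 0 <= h N by rewrite mule_ge0.
  have h'0 N : 0 <= h' N by rewrite mule_ge0.
  transitivity (QT s * haar_int F h).
    rewrite -ge0_integralZl; last 4 first.
    - by [].
    - by apply: emeasurable_funM => //; exact: measurableT_comp mh mN.
    - by move=> t _; rewrite mule_ge0.
    - exact: QT0.
    by apply: eq_integral => t _; rewrite /h muleCA -!muleA.
  transitivity (QT s * haar_int F h'); last first.
    rewrite -ge0_integralZl; last 4 first.
    - by [].
    - by apply: emeasurable_funM => //; exact: measurableT_comp mh' mN.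
    - by move=> t _; rewrite mule_ge0.
    - exact: QT0.
    apply: eq_integral => t _.
    by rewrite [RHS]muleCA -[QF t * g _ * f _]muleA /h' [g _ * f _]muleC.
  have [s0|s0] := Npos s; first by rewrite (_ : QT s = 0) ?mul0e//; exact: haar_weight0.
  congr (_ * _); rewrite -(haar_int_scale Fc s0 mh' h'0).
  apply: eq_integral => t _; rewrite /h /h'; congr (_ * (f _ * g _)).
    by rewrite mulrC mulKf// gt_eqF.
  by rewrite mulrC.
rewrite tonelli; last 2 first.
- apply: emeasurable_funM; apply: emeasurable_funM.
  + exact: measurableT_comp mQF _.
  + exact: measurableT_comp mg mN2.
  + exact: measurableT_comp mQT _.
  + apply: (measurableT_comp mf); apply: measurable_funM => //.
    exact: (measurableT_comp measurable_invr mN1).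
- by move=> t s; apply: mule_ge0; apply: mule_ge0.
rewrite -[RHS]ge0_integralZr; last 4 first.
- by [].
- exact: emeasurable_funM.
- by move=> t _; rewrite mule_ge0.
- exact: haar_int_ge0.
apply: eq_integral => t _; rewrite ge0_integralZl; last 4 first.
- by [].
- apply: emeasurable_funM => //; apply: (measurableT_comp mf).
  by apply: measurable_funM => //; exact: (measurableT_comp measurable_invr mN).
- by move=> s _; rewrite mule_ge0.
- by rewrite mule_ge0.
have [t0|t0] := Npos t; first by rewrite /QF haar_weight0// !mul0e.
congr (_ * _).
have ti0 : (0 < (wvar w t)^-1)%R by rewrite invr_gt0.
rewrite -(haar_int_scale T1 ti0 mfi (fun N => f0 _)).
by apply: eq_integral => s _; rewrite invfM invrK.
Qed.

End cross_ratio.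

Lemma mule_fin_inj (R : realType) (c x y : \bar R) :
  (0 < c)%E -> (c < +oo)%E -> (c * x = c * y)%E -> x = y.
Proof.
move=> c0 coo; have cfin : c \is a fin_num by rewrite ge0_fin_numE// ltW.
move: c0; rewrite -(fineK cfin); move: (fine c) => r; rewrite lte_fin => r0.
move=> /(congr1 (fun z => r^-1%:E * z)%E).
by rewrite !muleA -!EFinM mulVf ?gt_eqF// !mul1e.
Qed.

Lemma mule_cross_cancel (R : realType) (a b c d e : \bar R) :
  (0 < c)%E -> (c < +oo)%E -> (a * c = b * e)%E -> (d * c = c * e)%E ->
  (a * c = b * d)%E.
Proof.
move=> c0 coo -> E; congr (_ * _)%E.
by apply: (mule_fin_inj c0 coo); rewrite -E muleC.
Qed.

(** * Replacing a function of the variance by a Gaussian weight *)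

Section slice_ratio.
Context {R : realType}.
Notation mu := (@lebesgue_measure R).
Notation lam := (lebesgue_rV R).
Local Open Scope ereal_scope.
Variables (m : nat) (w : 'rV[R]_m).
Hypotheses (m1 : (1 < m)%N) (wp : wpos w).

Let w0 : (0 < wsum w)%R.
Proof. exact: wsum_gt0 (ltnW m1) wp. Qed.

Lemma wvar_ge0 t : (0 <= wvar w t)%R.
Proof.
apply: sumr_ge0 => i _; rewrite mulr_ge0 ?sqr_ge0// ltW//.
exact: (forallP wp).
Qed.

Let mN : measurable_fun setT (fun t : 'rV[R]_m => wvar w t).
Proof. exact: measurable_wvar. Qed.

Let mM : measurable_fun setT (fun t : 'rV[R]_m => wmean w t).
Proof. exact: measurable_wmean. Qed.

Definition mean_int (F : 'rV[R]_m -> \bar R) (f : R -> \bar R) : \bar R :=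
  \int[lam m]_t (F t * f (wvar w t) * unitb (wmean w t)).

Definition gauss_weight (N : R) : \bar R := (expR (- N))%:E.

Let measurable_gauss_weight : measurable_fun setT gauss_weight.
Proof. by apply/measurable_EFinP; apply: measurableT_comp => //; exact: measurable_funN. Qed.

(** The Gaussian integral over the whole space factors over the coordinates and, by the parallel
    axis identity, also into a slab part and a part in the mean. *)
Lemma mean_int_gauss :
  mean_int (fun=> 1) gauss_weight * (Num.sqrt pi * wsum w `^ (- 2^-1))%:E =
  (\prod_(i < m) (Num.sqrt pi * w 0%R i `^ (- 2^-1)))%:E.
Proof.
have wi i : (0 < w 0 i)%R by exact: (forallP wp).
transitivity (\int[lam m]_t (\prod_i expR (- (w 0 i * t 0 i ^+ 2)))%:E); last first.
  rewrite (ge0_integral_prod (h := fun i x => expR (- (w 0 i * x ^+ 2))))%R.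
  - by rewrite -prodEFin; apply: eq_bigr => i _; exact: integral_gauss.
  - move=> i; apply: measurableT_comp => //; apply: measurable_funN.
    by apply: measurable_funM => //; exact: measurable_funX.
  - by move=> i x; exact: expR_ge0.
have mp : measurable_fun setT (fun x : R => (expR (- (wsum w * x ^+ 2)))%:E).
  apply/measurable_EFinP; apply: measurableT_comp => //; apply: measurable_funN.
  by apply: measurable_funM => //; exact: measurable_funX.
rewrite -integral_gauss// /mean_int.
under [in LHS]eq_integral do rewrite mul1e.
rewrite -(integral_wmean (k := fun t => gauss_weight (wvar w t)) w0) => //.
- apply: eq_integral => t _; rewrite /gauss_weight -EFinM -expRD -expR_sum sumrN -opprD.
  by rewrite wvarE.
- exact: measurableT_comp measurable_gauss_weight mN.
- by move=> t; rewrite lee_fin expR_ge0.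
- by move=> t l; rewrite wvar_shift.
Qed.

Lemma mean_int_gauss_gt0 : 0 < mean_int (fun=> 1) gauss_weight < +oo.
Proof.
have wi i : (0 < w 0 i)%R by exact: (forallP wp).
have c0 : (0 < Num.sqrt pi * wsum w `^ (- 2^-1) :> R)%R.
  by rewrite mulr_gt0 ?powR_gt0// sqrtr_gt0 pi_gt0.
have C0 : (0 < \prod_(i < m) (Num.sqrt pi * w 0%R i `^ (- 2^-1)))%R.
  by rewrite prodr_gt0// => i _; rewrite mulr_gt0 ?powR_gt0// sqrtr_gt0 pi_gt0.
have I0 : 0 <= mean_int (fun=> 1) gauss_weight.
  by apply: integral_ge0 => t _; rewrite !mule_ge0 ?unitb_ge0// lee_fin expR_ge0.
have := mean_int_gauss; move: I0; case: (mean_int _ _) => [r| |] //.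
  rewrite lee_fin ltry andbT lte_fin -EFinM => r0 -[E].
  rewrite lt0r r0 andbT; apply/eqP => rE; move: C0; rewrite -E rE mul0r ltxx//.
by rewrite mulyr gtr0_sg// mul1e.
Qed.

Let D0 : set 'rV[R]_m := [set t | (wvar w t == 0%R) && (0 <= wmean w t <= 1)%R].

Let mD0 : measurable D0.
Proof.
have mb : measurable_fun setT (fun t => (wvar w t == 0%R) && (0 <= wmean w t <= 1)%R).
  apply: measurable_and; first exact: measurable_fun_eqr.
  by apply: measurable_and; exact: measurable_fun_ler.
rewrite -[X in measurable X]setTI (_ : D0 =
  (fun t => (wvar w t == 0%R) && (0 <= wmean w t <= 1)%R) @^-1` [set true]).
  exact: mb.
by apply/seteqP; split.
Qed.

(** Zero variance is stable under doubling, so the volume equals itself times [2 * 2 ^- m], a factor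
    less than 1 because [1 < m]. The volume is finite, since the Gaussian weight is 1 on this set,
    and is therefore zero. *)
Lemma wvar0_negligible : lam m D0 = 0.
Proof.
pose k (t : 'rV[R]_m) : \bar R := ((wvar w t == 0%R)%:R)%:E.
have mk : measurable_fun setT k.
  by apply/measurable_EFinP; apply: measurable_bool_real; exact: measurable_fun_eqr.
have k0 t : 0 <= k t by rewrite lee_fin.
have kshift t l : k (t + const_mx l)%R = k t by rewrite /k wvar_shift.
have E : lam m D0 = \int[lam m]_t (k t * unitb (wmean w t)).
  rewrite -[D0]setIT -integral_indic//; apply: eq_integral => t _.
  rewrite indicE /k /unitb -EFinM -natrM mulnb; congr (_%:R%:E).
  by congr nat_of_bool; apply/idP/idP => [/set_mem|/mem_set].
have := integral_unitb_scale w0 mk k0 kshift (ltr0Sn R 1).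
have kZ t : k (2%:R *: t)%R = k t.
  by rewrite /k wvarZ mulf_eq0 sqrf_eq0 pnatr_eq0.
under eq_integral do rewrite kZ.
rewrite -E.
have Dfin : lam m D0 < +oo.
  case/andP: mean_int_gauss_gt0 => _; apply: le_lt_trans.
  rewrite E; apply: ge0_le_integral => //.
  - by move=> t _; rewrite mule_ge0// unitb_ge0.
  - by apply: emeasurable_funM => //; exact: measurable_unitb.
  - apply: emeasurable_funM; last exact: measurable_unitb.
    by apply: emeasurable_funM => //; exact: measurableT_comp measurable_gauss_weight mN.
  - move=> t _; rewrite mul1e lee_wpmul2r ?unitb_ge0// lee_fin.
    by have [->|_] := eqVneq; rewrite ?oppr0 ?expR0// expR_ge0.
have : lam m D0 \is a fin_num by rewrite ge0_fin_numE.
move=> /fineK <-; rewrite -EFinM => -[] /eqP.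
rewrite -subr_eq0 -{1}[fine _]mul1r -mulrBl mulf_eq0 => /orP[|/eqP ->//].
rewrite gt_eqF// subr_gt0 ltr_pdivrMr ?exprn_gt0// mul1r.
by rewrite -[X in (X < _)%R]expr1 ltr_eXn2l// ltr1n.
Qed.

(** Dividing by [haarw] undoes the weight except where the variance vanishes, which is a null set
    within the slab. *)
Lemma mean_int_haar (F : 'rV[R]_m -> \bar R) (Fc : cone_invariant F) (f : R -> \bar R) :
  measurable_fun setT f -> (forall N, 0 <= f N) ->
  mean_int F f = haar_int w F (fun N => ((haarw m N)^-1)%:E * f N).
Proof.
have [mF F0 _ _] := Fc.
move=> mf f0; apply: ge0_ae_eq_integral => //.
- apply: emeasurable_funM; last exact: measurable_unitb.
  by apply: emeasurable_funM => //; exact: measurableT_comp mf mN.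
- apply: emeasurable_funM; first exact: measurable_haar_weight.
  apply: emeasurable_funM; last exact: measurableT_comp mf mN.
  apply/measurable_EFinP; apply: (measurableT_comp measurable_invr).
  exact: (measurableT_comp (measurable_haarw m) mN).
- by move=> t _; rewrite !mule_ge0 ?unitb_ge0.
- move=> t _; rewrite mule_ge0 ?haar_weight_ge0// mule_ge0// lee_fin invr_ge0.
  exact: haarw_ge0.
exists D0; split => //; first exact: wvar0_negligible.
move=> t /= H; apply: contrapT => tD; apply: H => _.
have [t0|t0] := eqVneq (wvar w t) 0%R.
  rewrite haar_weight0// mul0e /unitb.
  case: (boolP (0 <= wmean w t <= 1)%R) => M; last by rewrite mule0.
  by exfalso; apply: tD; rewrite /D0/= t0 eqxx.
have N0 : (0 < wvar w t)%R by rewrite lt0r t0 wvar_ge0.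
have h0 := haarw_gt0 m N0.
rewrite /haar_weight [RHS]muleACA -[X in _ = X * _]muleA -EFinM mulfV ?gt_eqF//.
by rewrite mule1 -muleA [unitb _ * _]muleC.
Qed.

(** [haar_int_cross] is applied to [F] and to the constant 1. The second instance shows that
    inverting the argument of [f] preserves its integral, which removes the inverse from the
    first. *)
Lemma mean_int_cross (F : 'rV[R]_m -> \bar R) (theta : R -> \bar R) :
  cone_invariant F ->
  measurable_fun setT theta -> (forall N, 0 <= theta N) ->
  mean_int F theta * mean_int (fun=> 1) gauss_weight =
  mean_int F gauss_weight * mean_int (fun=> 1) theta.
Proof.
move=> Fc mt t0; have T1 := @cone_invariant1 R m.
have g0 N : 0 <= gauss_weight N by rewrite lee_fin expR_ge0.
have mh : measurable_fun setT (fun N : R => ((haarw m N)^-1)%:E).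
  by apply/measurable_EFinP; exact: (measurableT_comp measurable_invr (measurable_haarw m)).
have h0 N : 0 <= ((haarw m N)^-1)%:E :> \bar R by rewrite lee_fin invr_ge0 haarw_ge0.
pose f N := ((haarw m N)^-1)%:E * theta N.
pose g N := ((haarw m N)^-1)%:E * gauss_weight N.
have mf : measurable_fun setT f by exact: emeasurable_funM.
have mg : measurable_fun setT g by exact: emeasurable_funM.
have f0 N : 0 <= f N by rewrite mule_ge0.
have gg0 N : 0 <= g N by rewrite mule_ge0.
have C1 := haar_int_cross w0 wvar_ge0 T1 mf f0 mg gg0.
have CF := haar_int_cross w0 wvar_ge0 Fc mf f0 mg gg0.
have G := mean_int_gauss_gt0.
rewrite (mean_int_haar Fc mt t0) (mean_int_haar T1 mt t0).
rewrite (mean_int_haar Fc measurable_gauss_weight g0).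
rewrite (mean_int_haar T1 measurable_gauss_weight g0) -/f -/g.
move: G; rewrite (mean_int_haar T1 measurable_gauss_weight g0) -/g.
move=> /andP[G0 Goo].
exact: (mule_cross_cancel G0 Goo CF C1).
Qed.

End slice_ratio.

(** * Gaussian simplices *)

Section simplex_cone.
Context {R : realType}.
Variable d : nat.
Implicit Types (X : 'M[R]_(d.+1, d)) (w t y z : 'rV[R]_d.+1) (v : 'rV[R]_d).

Definition edge_mx X : 'M[R]_d := \matrix_(i, j) (X (lift ord0 i) j - X ord0 j).

(** The inverse of the edge matrix in adjugate form: visibly measurable in [X], and 0 when the
    simplex is degenerate. *)
Definition edge_coord X v : 'rV[R]_d :=
  (\det (edge_mx X))^-1 *: (v *m \adj (edge_mx X)).

Definition in_cone (k : nat) X v : bool :=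
  [forall j : 'I_d, (k <= j.+1)%N ==> (0 <= edge_coord X v 0 j)].

Lemma edge_coordK X v : \det (edge_mx X) != 0 -> edge_coord X v *m edge_mx X = v.
Proof.
move=> D0; rewrite /edge_coord -scalemxAl -mulmxA mul_adj_mx mul_mx_scalar.
by rewrite scalerA mulVf// scale1r.
Qed.

Lemma mul_edge_mxK X v : \det (edge_mx X) != 0 -> edge_coord X (v *m edge_mx X) = v.
Proof.
move=> D0; rewrite /edge_coord -mulmxA mul_mx_adj mul_mx_scalar.
by rewrite scalerA mulVf// scale1r.
Qed.

Definition ip w t y : R := \sum_i w 0 i * t 0 i * y 0 i.

Definition centered w t : 'rV[R]_d.+1 := \row_i (t 0 i - wmean w t).

Definition colr X (j : 'I_d) : 'rV[R]_d.+1 := \row_i X i j.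

(** The combination of the vertices with coefficients [w 0 i * (t 0 i - wmean w t)]. These sum to
    zero, so it is a combination of edges, whose coordinates carry the signs of the deviations from
    the mean. *)
Definition wcomb w t X : 'rV[R]_d := \row_j ip w (centered w t) (colr X j).

Lemma ipC w t y : ip w t y = ip w y t.
Proof. by apply: eq_bigr => i _; rewrite mulrAC. Qed.

Lemma ipDr w t y z : ip w t (y + z) = ip w t y + ip w t z.
Proof. by rewrite -big_split/=; apply: eq_bigr => i _; rewrite mxE mulrDr. Qed.

Lemma ipZr w t y (c : R) : ip w t (c *: y) = c * ip w t y.
Proof. by rewrite /ip mulr_sumr; apply: eq_bigr => i _; rewrite mxE mulrCA. Qed.

Lemma ipNr w t y : ip w t (- y) = - ip w t y.
Proof. by rewrite -scaleN1r ipZr mulN1r. Qed.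

Lemma ipBr w t y z : ip w t (y - z) = ip w t y - ip w t z.
Proof. by rewrite ipDr ipNr. Qed.

Lemma ipBl w t y z : ip w (y - z) t = ip w y t - ip w z t.
Proof. by rewrite ipC ipBr !(ipC w t). Qed.

Lemma ip_gt0 w z : wpos w -> z != 0 -> 0 < ip w z z.
Proof.
move=> /forallP wp /eqP z0.
have [i zi] : exists i, z 0 i != 0.
  apply: contrapT => H; apply: z0; apply/rowP => i; rewrite mxE.
  by apply/eqP; apply: contrapT => /negP zi; apply: H; exists i.
rewrite /ip (bigD1 i)//=; apply: ltr_pwDl.
  by rewrite -mulrA mulr_gt0// -expr2 lt_neqAle sqr_ge0 andbT eq_sym sqrf_eq0.
by apply: sumr_ge0 => j _; rewrite -mulrA mulr_ge0 ?(ltW (wp j))// -expr2 sqr_ge0.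
Qed.

Lemma wvar_ip w t : wvar w t = ip w (centered w t) (centered w t).
Proof. by apply: eq_bigr => i _; rewrite !mxE expr2 mulrA. Qed.

Lemma centeredE w t : centered w t = t - const_mx (wmean w t).
Proof. by apply/rowP => i; rewrite !mxE. Qed.

Lemma sum_centered w t : wsum w != 0 -> ip w (centered w t) (const_mx 1) = 0.
Proof.
move=> W0; rewrite /ip.
under eq_bigr do rewrite !mxE mulr1 mulrBr.
by rewrite big_split/= sumrN -mulr_suml -/(wsum w) /wmean mulrCA divff// mulr1 subrr.
Qed.

Lemma ip_const w t (c : R) : ip w t (const_mx c) = c * ip w t (const_mx 1).
Proof. by rewrite -ipZr; congr ip; apply/rowP => i; rewrite !mxE mulr1. Qed.

Lemma wcomb_edge w t X : wsum w != 0 ->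
  wcomb w t X =
  (\row_i (w 0 (lift ord0 i) * (t 0 (lift ord0 i) - wmean w t))) *m edge_mx X.
Proof.
move=> W0; apply/rowP => j; rewrite !mxE.
have E := sum_centered t W0.
transitivity (ip w (centered w t) (colr X j - const_mx (X ord0 j))).
  by rewrite ipBr ip_const E mulr0 subr0.
rewrite /ip big_ord_recl !mxE subrr mulr0 add0r.
by apply: eq_bigr => i _; rewrite !mxE.
Qed.

Lemma in_cone_wcomb k w t X : wpos w -> \det (edge_mx X) != 0 -> (0 < k)%N ->
  in_cone k X (wcomb w t X) = above k w t.
Proof.
move=> wp D0 k0; have W0 : wsum w != 0 by rewrite gt_eqF// wsum_gt0.
rewrite /in_cone wcomb_edge// mul_edge_mxK//.
have wi i : 0 < w 0 i by exact: (forallP wp).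
apply/forallP/forallP => H i.
  case: (unliftP ord0 i) => [j|] ->; last by rewrite leqNgt k0.
  by have := H j; rewrite mxE pmulr_rge0// subr_ge0.
by have := H (lift ord0 i); rewrite mxE pmulr_rge0// subr_ge0.
Qed.

(** The mean restores the one dimension that [wcomb] forgets, which makes the map a linear bijection
    when the simplex is nondegenerate. *)
Definition Lmap w X t : 'rV[R]_d.+1 := cons_rV (wmean w t, wcomb w t X).

(** Edge coordinates are the weighted deviations from the mean; since all deviations sum to zero,
    the one at vertex 0 is minus the sum of the others. *)
Definition Linv w X y : 'rV[R]_d.+1 :=
  let c := edge_coord X (\row_j y 0 (lift ord0 j)) in
  \row_i (y 0 ord0 +
    (if unlift ord0 i is Some j then c 0 j else - \sum_j c 0 j) / w 0 i).

Lemma wmeanD w t y : wmean w (t + y) = wmean w t + wmean w y.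
Proof.
rewrite /wmean -mulrDl -big_split/=; congr (_ / _).
by apply: eq_bigr => i _; rewrite mxE mulrDr.
Qed.

Lemma wcombD w X : {morph (wcomb w)^~ X : t y / t + y}.
Proof.
move=> t y; apply/rowP => j; rewrite !mxE !(ipC _ _ (colr X j)) -ipDr; congr ip.
by apply/rowP => i; rewrite !mxE wmeanD; ring.
Qed.

Lemma LmapD w X : {morph Lmap w X : t y / t + y}.
Proof. by move=> t y; rewrite /Lmap -cons_rVD wmeanD wcombD. Qed.

Lemma LmapK w X : wpos w -> \det (edge_mx X) != 0 -> cancel (Lmap w X) (Linv w X).
Proof.
move=> wp D0 t; have W0 : wsum w != 0 by rewrite gt_eqF// wsum_gt0.
have w0 i : w 0 i != 0 by rewrite gt_eqF//; exact: (forallP wp).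
apply/rowP => i; rewrite mxE /Lmap cons_rV0.
set v := (X in edge_coord _ X).
have -> : edge_coord X v = \row_i (w 0 (lift ord0 i) * (t 0 (lift ord0 i) - wmean w t)).
  rewrite -[RHS](mul_edge_mxK _ D0) -wcomb_edge//; congr edge_coord.
  by apply/rowP => j; rewrite mxE cons_rVS.
case: (unliftP ord0 i) => [j|] ->.
  by rewrite mxE mulrC mulKf// addrC subrK.
have := sum_centered t W0.
rewrite /ip big_ord_recl !mxE mulr1 => /eqP; rewrite addr_eq0 => /eqP E.
rewrite (_ : \sum_j _ = - (w 0 ord0 * (t 0 ord0 - wmean w t))).
  by rewrite opprK mulrC mulKf// addrC subrK.
by rewrite E opprK; apply: eq_bigr => j _; rewrite !mxE mulr1.
Qed.

Lemma LinvK w X : wpos w -> \det (edge_mx X) != 0 -> cancel (Linv w X) (Lmap w X).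
Proof.
move=> wp D0 y; have W0 : wsum w != 0 by rewrite gt_eqF// wsum_gt0.
have w0 i : w 0 i != 0 by rewrite gt_eqF//; exact: (forallP wp).
set v : 'rV[R]_d := \row_j y 0 (lift ord0 j); set c := edge_coord X v.
have M : wmean w (Linv w X y) = y 0 ord0.
  rewrite /wmean; under eq_bigr do rewrite mxE mulrDr.
  rewrite big_split/= -mulr_suml -/(wsum w) mulrDl [wsum w * _]mulrC mulfK//.
  rewrite [X in _ + X / _](_ : _ = 0) ?mul0r ?addr0// big_ord_recl unlift_none.
  rewrite [w 0 ord0 * _]mulrC divfK// -/v -/c.
  under [X in _ + X]eq_bigr do rewrite liftK mulrC divfK//.
  by rewrite addNr.
apply/rowP => i; rewrite /Lmap; case: (unliftP ord0 i) => [j|] ->; last by rewrite cons_rV0.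
rewrite cons_rVS wcomb_edge// M.
rewrite (_ : (\row_i _) = c).
  by rewrite edge_coordK// mxE.
apply/rowP => j'; rewrite [LHS]mxE /Linv -/v -/c [X in _ * (X - _)]mxE liftK.
by rewrite addrAC subrr add0r mulrC divfK.
Qed.

(** The reflection, orthogonal for [ip w], that reverses [z]; for [z = 0] it is the identity. *)
Definition refl w z t : 'rV[R]_d.+1 := t - (2 * ip w z t / ip w z z) *: z.

Definition refl_mx w z X : 'M[R]_(d.+1, d) := \matrix_(i, j) refl w z (colr X j) 0 i.

Lemma colr_refl w z X j : colr (refl_mx w z X) j = refl w z (colr X j).
Proof. by apply/rowP => i; rewrite !mxE. Qed.

Lemma ip_refl w z t y : ip w (refl w z t) y = ip w t (refl w z y).
Proof.
rewrite /refl ipBr ipC ipBr !ipZr (ipC w y) (ipC w t z) (ipC w y z).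
by congr (_ - _); rewrite -!mulrA; congr (_ * _); ring.
Qed.

Lemma reflK w z : wpos w -> involutive (refl w z).
Proof.
move=> wp t; have [->|z0] := eqVneq z 0; first by rewrite /refl !scaler0 !subr0.
have zz := ip_gt0 wp z0.
rewrite /refl ipBr ipZr divfK ?gt_eqF// -addrA -opprD -scalerDl.
rewrite [X in X *: z](_ : _ = 0) ?scale0r ?subr0//.
by field; rewrite gt_eqF.
Qed.

Lemma ip_refl_sqr w z t : wpos w -> ip w (refl w z t) (refl w z t) = ip w t t.
Proof. by move=> wp; rewrite ip_refl reflK. Qed.

Lemma reflD w z : {morph refl w z : t y / t + y}.
Proof.
move=> t y; rewrite /refl ipDr mulrDr mulrDl scalerDl opprD.
by rewrite addrACA.
Qed.

Section orthogonal_to_constants.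
Variables (w z : 'rV[R]_d.+1).
Hypothesis z1 : ip w z (const_mx 1) = 0.

Lemma refl_const (c : R) : refl w z (const_mx c) = const_mx c.
Proof. by rewrite /refl ip_const z1 !mulr0 mul0r scale0r subr0. Qed.

Lemma wmean_refl t : wmean w (refl w z t) = wmean w t.
Proof.
have E y : wmean w y = ip w y (const_mx 1) / wsum w.
  by congr (_ / _); apply: eq_bigr => i _; rewrite mxE mulr1.
by rewrite !E ip_refl refl_const.
Qed.

(** The reflection is self-adjoint for [ip w] and, [z] being orthogonal to the constants, commutes
    with centering. So reflecting the simplex amounts to reflecting [t]. *)
Lemma wcomb_refl t X : wcomb w t (refl_mx w z X) = wcomb w (refl w z t) X.
Proof.
apply/rowP => j; rewrite !mxE colr_refl -ip_refl; congr (ip w _ _).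
rewrite !centeredE wmean_refl -{2}(refl_const (wmean w t)) /refl ipBr.
rewrite mulrBr mulrBl scalerBl ip_const z1; apply/rowP => i; rewrite !mxE; ring.
Qed.

Lemma Lmap_refl t X : Lmap w (refl_mx w z X) t = Lmap w X (refl w z t).
Proof. by rewrite /Lmap wmean_refl wcomb_refl. Qed.

End orthogonal_to_constants.

Lemma wcomb_shift w t (c : R) X : 0 < wsum w ->
  wcomb w (t + const_mx c) X = wcomb w t X.
Proof.
move=> W0; apply/rowP => j; rewrite !mxE; congr ip.
by apply/rowP => i; rewrite !mxE wmean_shift//; ring.
Qed.

(* The reflection that exchanges two vectors of equal weighted variance, up to
   constants, fixes the constants because the two vectors are centered. *)
Lemma refl_exchange w s t : wpos w -> wvar w s = wvar w t ->
  let z := centered w t - centered w s in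
  ip w z (const_mx 1) = 0 /\
  refl w z t = s + const_mx (wmean w t - wmean w s).
Proof.
move=> wp st z; have W0 : wsum w != 0 by rewrite gt_eqF// wsum_gt0.
have z1 : ip w z (const_mx 1) = 0 by rewrite ipBl !sum_centered// subrr.
split=> //.
have tE : t = s + const_mx (wmean w t - wmean w s) + z.
  by apply/rowP => i; rewrite !mxE; ring.
have [z0|z0] := eqVneq z 0.
  by rewrite z0 /refl scaler0 subr0 {1}tE z0 addr0.
have zz := ip_gt0 wp z0.
have zt : ip w z t = ip w z (centered w t).
  by rewrite centeredE ipBr ip_const z1 mulr0 subr0.
have zzE : ip w z z = 2 * ip w z t.
  rewrite zt {2}/z ipBr !ipBl -!wvar_ip st (ipC w (centered w s)); ring.
rewrite /refl -zzE divff ?gt_eqF// scale1r {1}tE addrK//.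
Qed.

End simplex_cone.

Section measurable_linear_algebra.
Context {R : realType}.

Lemma measurable_det e (T : measurableType e) n (A : T -> 'M[R]_n) :
  (forall i j, measurable_fun setT (fun z => A z i j)) ->
  measurable_fun setT (fun z => \det (A z)).
Proof.
move=> mA; apply: measurable_sum => s; apply: measurable_funM => //.
by apply: measurable_prod => i _.
Qed.

Lemma measurable_adj e (T : measurableType e) n (A : T -> 'M[R]_n) i j :
  (forall i j, measurable_fun setT (fun z => A z i j)) ->
  measurable_fun setT (fun z => (\adj (A z)) i j).
Proof.
move=> mA; under eq_fun do rewrite mxE; apply: measurable_funM => //.
by apply: measurable_det => i' j'; under eq_fun do rewrite !mxE; exact: mA.
Qed.

Variable d : nat.

Definition simplex (x : 'rV[R]_(d.+1 * d)) : 'M[R]_(d.+1, d) := vec_mx x.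

Lemma measurable_simplex e (T : measurableType e) (x : T -> 'rV[R]_(d.+1 * d)) i j :
  measurable_fun setT x -> measurable_fun setT (fun z => simplex (x z) i j).
Proof. by move=> mx; under eq_fun do rewrite mxE; exact: measurable_coordT. Qed.

Lemma measurable_edge_mx e (T : measurableType e) (x : T -> 'rV[R]_(d.+1 * d)) i j :
  measurable_fun setT x -> measurable_fun setT (fun z => edge_mx (simplex (x z)) i j).
Proof.
move=> mx; under eq_fun do rewrite mxE.
by apply: measurable_funB; exact: measurable_simplex.
Qed.

Lemma measurable_det_edge e (T : measurableType e) (x : T -> 'rV[R]_(d.+1 * d)) :
  measurable_fun setT x ->
  measurable_fun setT (fun z => \det (edge_mx (simplex (x z)))).
Proof. by move=> mx; apply: measurable_det => i j; exact: measurable_edge_mx. Qed.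

Lemma measurable_in_cone e (T : measurableType e) k (x : T -> 'rV[R]_(d.+1 * d))
    (v : T -> 'rV[R]_d) :
  measurable_fun setT x -> measurable_fun setT v ->
  measurable_fun setT (fun z => in_cone k (simplex (x z)) (v z)).
Proof.
move=> mx mv; apply: measurable_forallb => j.
case: (k <= j.+1)%N => /=; last by [].
apply: measurable_fun_ler => //; under eq_fun do rewrite mxE.
apply: measurable_funM.
  by apply: (measurableT_comp measurable_invr); exact: measurable_det_edge.
under eq_fun do rewrite mxE; apply: measurable_sum => i; apply: measurable_funM.
  exact: measurable_coordT.
by apply: measurable_adj => i' j'; exact: measurable_edge_mx.
Qed.

Lemma measurable_wcomb e (T : measurableType e) w (t : T -> 'rV[R]_d.+1)
    (x : T -> 'rV[R]_(d.+1 * d)) :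
  measurable_fun setT t -> measurable_fun setT x ->
  measurable_fun setT (fun z => wcomb w (t z) (simplex (x z))).
Proof.
move=> mt mx; apply: measurable_fun_rV => j; under eq_fun do rewrite mxE.
apply: measurable_sum => i; apply: measurable_funM; last first.
  by under eq_fun do rewrite mxE; exact: measurable_simplex.
apply: measurable_funM => //; under eq_fun do rewrite mxE.
by apply: measurable_funB; [exact: measurable_coordT|exact: measurable_wmean].
Qed.

Lemma measurable_cons_rVT e (T : measurableType e) N (a : T -> R) (v : T -> 'rV[R]_N) :
  measurable_fun setT a -> measurable_fun setT v ->
  measurable_fun setT (fun z => cons_rV (a z, v z)).
Proof.
move=> ma mv; apply: (measurableT_comp (@measurable_cons_rV R N)).
exact: measurable_fun_pair.
Qed.

Lemma measurable_Lmap e (T : measurableType e) w (t : T -> 'rV[R]_d.+1)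
    (x : T -> 'rV[R]_(d.+1 * d)) :
  measurable_fun setT t -> measurable_fun setT x ->
  measurable_fun setT (fun z => Lmap w (simplex (x z)) (t z)).
Proof.
move=> mt mx; apply: measurable_cons_rVT; last exact: measurable_wcomb.
exact: measurable_wmean.
Qed.

Lemma measurable_Linv w (x : 'rV[R]_(d.+1 * d)) :
  measurable_fun setT (Linv w (simplex x)).
Proof.
have mc j : measurable_fun setT (fun y : 'rV[R]_d.+1 =>
    edge_coord (simplex x) (\row_j y 0 (lift ord0 j)) 0 j).
  under eq_fun do rewrite !mxE; apply: measurable_funM => //.
  apply: measurable_sum => i; apply: measurable_funM => //.
  by under eq_fun do rewrite mxE; exact: measurable_coord.
apply: measurable_fun_rV => i; under eq_fun do rewrite mxE.
apply: measurable_funD; first exact: measurable_coord.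
apply: measurable_funM => //; case: (unliftP ord0 i) => [j _|_]; first exact: mc.
by apply: measurable_funN; apply: measurable_sum => j; exact: mc.
Qed.

End measurable_linear_algebra.

(** * Degenerate simplices form a null set *)

Section degenerate_simplices.
Context {R : realType}.
Notation mu := (@lebesgue_measure R).
Notation lam := (lebesgue_rV R).

Lemma finite_set_root (p : {poly R}) : p != 0 -> finite_set [set s | root p s].
Proof.
move: {2}(size p) (leqnn (size p)) => n; elim: n p => [|n IH] p.
  by rewrite leqn0 size_poly_eq0 => ->.
move=> sp p0; have [[s ps]|H] := pselect (exists s, root p s); last first.
  rewrite (_ : [set s | root p s] = set0); first exact: finite_set0.
  by apply/seteqP; split => // s ps; apply: H; exists s.
have /factor_theorem[q pE] := ps.
have q0 : q != 0 by apply: contraNneq p0 => q0; rewrite pE q0 mul0r.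
apply: (@sub_finite_set _ _ ([set s | root q s] `|` [set s])).
  move=> r /=; rewrite pE rootM root_XsubC => /orP[qr|/eqP ->]; first by left.
  by right.
rewrite finite_setU; split; last exact: finite_set1.
apply: IH => //; move: sp.
by rewrite pE size_Mmonic ?monicXsubC// size_XsubC addn2/=.
Qed.

Variable d : nat.

(** The simplex whose edge matrix is the identity. *)
Let simplex0 : 'rV[R]_(d.+1 * d) := mxvec (\matrix_(i, j) (i == lift ord0 j)%:R).

Let det_edge_shift x (s : R) :
  \det (edge_mx (simplex (x + s *: simplex0))) =
  (char_poly (- edge_mx (simplex x))).[s].
Proof.
rewrite /char_poly -horner_evalE -det_map_mx; congr (\det _).
apply/matrixP => i j; rewrite !mxE /simplex0 !mxvecE !mxE (inj_eq lift_inj).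
rewrite (negbTE (neq_lift _ _)) mulr0 addr0.
rewrite -[RHS]/(_.[s]) hornerD hornerN hornerMn hornerX hornerC opprK.
by case: eqP => _; rewrite ?mulr1n ?mulr0n; ring.
Qed.

Let degenerate : set 'rV[R]_(d.+1 * d) := [set x | \det (edge_mx (simplex x)) == 0].

Lemma measurable_degenerate : measurable degenerate.
Proof.
have mb : measurable_fun setT
    (fun x : 'rV[R]_(d.+1 * d) => \det (edge_mx (simplex x)) == 0).
  by apply: measurable_fun_eqr => //; exact: measurable_det_edge.
rewrite -[X in measurable X]setTI (_ : degenerate =
  (fun x => \det (edge_mx (simplex x)) == 0) @^-1` [set true]).
  exact: mb.
by apply/seteqP; split.
Qed.

(* Moving x along the line x + s *: simplex0 changes the determinant into the
   characteristic polynomial of the edge matrix, which has finitely many roots. *)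
Lemma degenerate_negligible : (lam (d.+1 * d) degenerate = 0)%E.
Proof.
pose g (x : 'rV[R]_(d.+1 * d)) : \bar R := ((\det (edge_mx (simplex x)) == 0)%:R)%:E.
have mD := measurable_degenerate.
have mg : measurable_fun setT g.
  apply/measurable_EFinP; apply: measurable_bool_real.
  by apply: measurable_fun_eqr => //; exact: measurable_det_edge.
have g0 x : (0 <= g x)%E by rewrite lee_fin.
have E : (lam _ degenerate = \int[lam _]_x g x)%E.
  rewrite -[in LHS](setIT degenerate) -integral_indic//; apply: eq_integral => x _.
  rewrite indicE /g; congr (_%:R%:E).
  by congr nat_of_bool; apply/idP/idP => [/set_mem|/mem_set].
have U : (\int[mu]_s unitb s = 1)%E.
  by rewrite (integral_unitb_itv (a := 0) (b := 1))// subr0.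
have mgs : measurable_fun setT
    (fun z : R * 'rV[R]_(d.+1 * d) => (unitb z.1 * g (z.2 + z.1 *: simplex0)%R)%E).
  apply: emeasurable_funM; first exact: measurable_unitb.
  apply: (measurableT_comp mg); apply: measurable_rVD => //.
  exact: measurable_rVZ.
transitivity (\int[mu]_s \int[lam (d.+1 * d)]_x (unitb s * g (x + s *: simplex0)%R))%E.
  rewrite E -[LHS]mul1e -{1}U -ge0_integralZr; last 4 first.
  - by [].
  - exact: measurable_unitb.
  - by move=> s _; exact: unitb_ge0.
  - exact: integral_ge0.
  apply: eq_integral => s _; rewrite ge0_integralZl.
  - by rewrite ge0_integral_rV_shift.
  - by [].
  - apply: (measurableT_comp mg); exact: measurable_rVD.
  - by move=> x _; exact: g0.
  - exact: unitb_ge0.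
rewrite tonelli; last 2 first.
- exact: mgs.
- by move=> s x; rewrite mule_ge0 ?unitb_ge0.
apply: integral0_eq => x _.
pose N := [set s | root (char_poly (- edge_mx (simplex x))) s].
have N0 : mu N = 0%E.
  apply: countable_lebesgue_measure0; apply: finite_set_countable.
  by apply: finite_set_root; rewrite monic_neq0// char_poly_monic.
have mN : measurable N.
  apply: countable_measurable => [t|]; first exact: measurable_set1.
  apply: finite_set_countable.
  by apply: finite_set_root; rewrite monic_neq0// char_poly_monic.
transitivity (\int[mu]_s (cst 0 s))%E; last exact: integral0.
apply: ge0_ae_eq_integral => //.
- apply: emeasurable_funM; first exact: measurable_unitb.
  apply: (measurableT_comp mg); apply: measurable_rVD => //.
  exact: measurable_rVZ.
- by move=> s _; rewrite mule_ge0 ?unitb_ge0.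
exists N; split => // s /= H; apply: contrapT => sN; apply: H => _.
rewrite /g det_edge_shift; case: eqP => [s0|_]; last by rewrite mule0.
by exfalso; apply: sN; rewrite /N/= /root s0.
Qed.

End degenerate_simplices.

Lemma big_mxvec (V : nmodType) m n (F : 'I_(m * n) -> V) :
  \sum_i F i = \sum_i \sum_j F (mxvec_index i j).
Proof.
rewrite (reindex (uncurry (@mxvec_index m n))) /=; last exact: curry_mxvec_bij.
by rewrite pair_bigA; apply: eq_bigr => -[].
Qed.

Lemma big_mxvec_prod (R : comRingType) m n (F : 'I_(m * n) -> R) :
  \prod_i F i = \prod_i \prod_j F (mxvec_index i j).
Proof.
rewrite (reindex (uncurry (@mxvec_index m n))) /=; last exact: curry_mxvec_bij.
by rewrite pair_bigA; apply: eq_bigr => -[].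
Qed.

(** * Cones of a Gaussian simplex with fixed weights *)

Section gaussian_simplex.
Context {R : realType}.
Notation mu := (@lebesgue_measure R).
Notation lam := (lebesgue_rV R).

Definition ballb N (v : 'rV[R]_N) : bool := dotp v v <= 1.

Definition unit_ball N : set 'rV[R]_N := [set v | dotp v v <= 1].

Arguments unit_ball N : clear implicits.

Lemma unit_ballE N : unit_ball N = wball (const_mx 1).
Proof.
apply/seteqP; split => v; rewrite /unit_ball/= /wball/= /dotp;
  under eq_bigr do rewrite ?mxE ?mul1r; by [|under eq_bigr do rewrite mxE mul1r expr2].
Qed.

Lemma measurable_ballb e (T : measurableType e) N (v : T -> 'rV[R]_N) :
  measurable_fun setT v -> measurable_fun setT (fun z => ballb (v z)).
Proof.
move=> mv; apply: measurable_fun_ler => //; apply: measurable_sum => i.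
by apply: measurable_funM; exact: measurable_coordT.
Qed.

Lemma measurable_unit_ball N : measurable (unit_ball N).
Proof. by rewrite unit_ballE; exact: measurable_wball. Qed.

Lemma unit_ball_fin N : (0 < lam N (unit_ball N) /\ lam N (unit_ball N) < +oo)%E.
Proof.
by rewrite unit_ballE; apply: wball_fin; apply/forallP => i; rewrite mxE ltr01.
Qed.

Lemma integral_ballb N : (\int[lam N]_v ((ballb v)%:R)%:E = lam N (unit_ball N))%E.
Proof.
rewrite -[in RHS](setIT (unit_ball N)) -integral_indic//; last exact: measurable_unit_ball.
apply: eq_integral => v _; rewrite indicE; congr (_%:R%:E).
by congr nat_of_bool; apply/idP/idP => [/mem_set|/set_mem].
Qed.

Variables (d : nat) (w : 'rV[R]_d.+1).
Hypotheses (d_gt0 : (0 < d)%N) (wp : wpos w).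

Let w0 : 0 < wsum w. Proof. exact: wsum_gt0. Qed.

Let wi i : 0 < w 0 i. Proof. exact: (forallP wp). Qed.

Definition sq_size (x : 'rV[R]_(d.+1 * d)) : R :=
  \sum_i w 0 i * (\sum_j simplex x i j ^+ 2).

Let measurable_sq_size e (T : measurableType e) (x : T -> 'rV[R]_(d.+1 * d)) :
  measurable_fun setT x -> measurable_fun setT (fun z => sq_size (x z)).
Proof.
move=> mx; apply: measurable_sum => i; apply: measurable_funM => //.
by apply: measurable_sum => j; apply: measurable_funX; exact: measurable_simplex.
Qed.

Let W : 'rV[R]_(d.+1 * d) := mxvec (\matrix_(i, j) w 0 i).

Let sq_sizeE (x : 'rV[R]_(d.+1 * d)) : \sum_i W 0 i * x 0 i ^+ 2 = sq_size x.
Proof.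
rewrite big_mxvec; apply: eq_bigr => i _; rewrite mulr_sumr; apply: eq_bigr => j _.
by rewrite mxvecE !mxE.
Qed.

Let reflx z (x : 'rV[R]_(d.+1 * d)) : 'rV[R]_(d.+1 * d) := mxvec (refl_mx w z (simplex x)).

Let simplex_reflx z x : simplex (reflx z x) = refl_mx w z (simplex x).
Proof. exact: mxvecK. Qed.

Let sq_size_ip x : sq_size x = \sum_j ip w (colr (simplex x) j) (colr (simplex x) j).
Proof.
rewrite exchange_big/=; apply: eq_bigr => i _; rewrite mulr_sumr.
by apply: eq_bigr => j _; rewrite [colr _ _ _ _]mxE expr2 mulrA.
Qed.

Let measurable_refl e (T : measurableType e) z (t : T -> 'rV[R]_d.+1) :
  measurable_fun setT t -> measurable_fun setT (fun a => refl w z (t a)).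
Proof.
move=> mt; apply: measurable_rVD => //; apply: measurable_rVN.
apply: measurable_rVZ => //; apply: measurable_funM => //.
apply: measurable_funM => //; apply: measurable_sum => i.
by apply: measurable_funM => //; exact: measurable_coordT.
Qed.

(** Acting on each column separately, the reflection preserves the quadratic form [sq_size], hence
    Lebesgue measure. *)
Let integral_reflx z (f : 'rV[R]_(d.+1 * d) -> \bar R) :
  measurable_fun setT f -> (forall x, 0 <= f x)%E ->
  (\int[lam _]_x f (reflx z x) = \int[lam _]_x f x)%E.
Proof.
move=> mf f0; apply: (@ge0_integral_isometry _ _ W (reflx z) (reflx z)) => //.
- by apply/forallP => k; rewrite /W; case/mxvec_indexP: k => i j; rewrite mxvecE mxE.
- move=> x y; rewrite /reflx -linearD; congr mxvec; apply/matrixP => i j.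
  rewrite [RHS]mxE; do 3! rewrite [refl_mx _ _ _ _ _]mxE.
  transitivity ((refl w z (colr (simplex x) j) + refl w z (colr (simplex y) j)) 0 i);
    last by rewrite mxE.
  rewrite -reflD; congr (refl _ _ _ 0 i).
  by apply/rowP => i'; rewrite !mxE.
- apply: measurable_fun_rV => k; case/mxvec_indexP: k => i j.
  under eq_fun do rewrite mxvecE mxE; apply: measurable_coordT.
  apply: measurable_refl; apply: measurable_fun_rV => i'.
  by under eq_fun do rewrite mxE; exact: measurable_simplex.
- move=> x; rewrite /reflx simplex_reflx -[RHS]vec_mxK; congr mxvec.
  by apply/matrixP => i j; rewrite mxE colr_refl reflK// mxE.
- move=> x; rewrite !sq_sizeE !sq_size_ip; apply: eq_bigr => j _.
  by rewrite simplex_reflx colr_refl ip_refl_sqr.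
Qed.

Let integral_refl z (f : 'rV[R]_d.+1 -> \bar R) :
  measurable_fun setT f -> (forall x, 0 <= f x)%E ->
  (\int[lam _]_x f (refl w z x) = \int[lam _]_x f x)%E.
Proof.
move=> mf f0; apply: (@ge0_integral_isometry _ _ w (refl w z) (refl w z)) => //.
- exact: reflD.
- exact: measurable_refl.
- exact: reflK.
- move=> x; have E (y : 'rV[R]_d.+1) : \sum_i w 0 i * y 0 i ^+ 2 = ip w y y.
    by apply: eq_bigr => i _; rewrite expr2 mulrA.
  by rewrite !E ip_refl_sqr.
Qed.

Local Open Scope ereal_scope.

Definition jac (x : 'rV[R]_(d.+1 * d)) : \bar R :=
  \int[lam d.+1]_t ((ballb (Lmap w (simplex x) t))%:R)%:E.

(** For a nondegenerate simplex, the absolute determinant of [Lmap] expressed by volumes. In this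
    form it is measurable in [x] by Tonelli and inherits the symmetry of [jac] under reflections. *)
Definition jac_ratio (x : 'rV[R]_(d.+1 * d)) : R :=
  (fine (lam d.+1 (unit_ball d.+1)) / fine (jac x))%R.

Lemma jac_ratio_ge0 x : (0 <= jac_ratio x)%R.
Proof.
rewrite mulr_ge0 ?invr_ge0 ?fine_ge0//.
by apply: integral_ge0 => t _; rewrite lee_fin.
Qed.

Lemma measurable_jac_ratio : measurable_fun setT jac_ratio.
Proof.
apply: measurable_funM => //; apply: (measurableT_comp measurable_invr).
apply: (measurableT_comp (f := fine)) => //.
have mb : measurable_fun setT (fun z : 'rV[R]_(d.+1 * d) * 'rV[R]_d.+1 =>
    ((ballb (Lmap w (simplex z.1) z.2))%:R)%:E : \bar R).
  apply/measurable_EFinP; apply: measurable_bool_real; apply: measurable_ballb.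
  exact: measurable_Lmap.
have b0 (x : 'rV[R]_(d.+1 * d)) (t : 'rV[R]_d.+1) :
    0 <= ((ballb (Lmap w (simplex x) t))%:R)%:E :> \bar R by rewrite lee_fin.
exact: (measurable_tonelli1 (f := fun x t => ((ballb (Lmap w (simplex x) t))%:R)%:E)
  (lam d.+1) mb b0).
Qed.

Lemma ge0_integral_Lmap x (f : 'rV[R]_d.+1 -> \bar R) :
  (\det (edge_mx (simplex x)) != 0)%R ->
  measurable_fun setT f -> (forall y, 0 <= f y) ->
  \int[lam d.+1]_y f y = \int[lam d.+1]_t (f (Lmap w (simplex x) t) * (jac_ratio x)%:E).
Proof.
move=> D0 mf f0; set L := Lmap w (simplex x).
have mL : measurable_fun setT L by exact: measurable_Lmap.
have [S0 Soo] := unit_ball_fin d.+1.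
have SN y : unit_ball d.+1 (- y)%R <-> unit_ball d.+1 y.
  by rewrite !unit_ballE; exact: wballN.
have mS := @measurable_unit_ball d.+1.
have LD : {morph L : t y / (t + y)%R} := LmapD w (simplex x).
have LK' : cancel (Linv w (simplex x)) L := LinvK wp D0.
have LK : cancel L (Linv w (simplex x)) := LmapK wp D0.
have mLi := measurable_Linv w x.
have := ge0_integral_additive_mul LD mL LK' mS SN mf f0.
have [P0 Poo] := lebesgue_rV_preim_additive LD mL LK' mS SN S0 Soo LK mLi.
have jE : jac x = lam d.+1 (L @^-1` unit_ball d.+1).
  rewrite -[in RHS](setIT (L @^-1` _)) -integral_indic//; last first.
    by rewrite -[X in measurable X]setTI; exact: mL.
  apply: eq_integral => t _; rewrite indicE; congr (_%:R%:E).
  by congr nat_of_bool; apply/idP/idP => [/mem_set|/set_mem].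
rewrite -jE in P0 Poo *.
have Sfin : lam d.+1 (unit_ball d.+1) \is a fin_num by rewrite ge0_fin_numE// ltW.
have jfin : jac x \is a fin_num by rewrite ge0_fin_numE// ltW.
have jr0 := jac_ratio_ge0 x.
have I0 : 0 <= \int[lam d.+1]_t f (L t) by exact: integral_ge0.
rewrite ge0_integralZr; last 4 first.
- by [].
- exact: measurableT_comp mf mL.
- by move=> t _; exact: f0.
- by rewrite lee_fin.
move=> E; rewrite /jac_ratio EFinM muleA (fineK Sfin) E -(fineK jfin) -muleA -EFinM.
by rewrite mulfV ?mule1// gt_eqF// -lte_fin fineK.
Qed.

Definition gaussx (x : 'rV[R]_(d.+1 * d)) : \bar R := (expR (- sq_size x))%:E.

Let gaussx_ge0 x : 0 <= gaussx x.
Proof. by rewrite lee_fin expR_ge0. Qed.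

Let measurable_gaussx e (T : measurableType e) (x : T -> 'rV[R]_(d.+1 * d)) :
  measurable_fun setT x -> measurable_fun setT (fun z => gaussx (x z)).
Proof.
move=> mx; apply/measurable_EFinP; apply: measurableT_comp => //.
by apply: measurable_funN; exact: measurable_sq_size.
Qed.

(** What remains at [t] when the volume of the cone inside the unit ball is rewritten by [Lmap]: the
    Gaussian weight, the Jacobian, and the condition that the image of [t] lies in the ball. *)
Definition Theta_kernel (t : 'rV[R]_d.+1) (x : 'rV[R]_(d.+1 * d)) : \bar R :=
  gaussx x * (jac_ratio x * (ballb (wcomb w t (simplex x)))%:R)%:E.

Definition Theta (t : 'rV[R]_d.+1) : \bar R := \int[lam _]_x Theta_kernel t x.

Let Theta_kernel_ge0 t x : 0 <= Theta_kernel t x.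
Proof. by rewrite mule_ge0// lee_fin mulr_ge0// jac_ratio_ge0. Qed.

Let measurable_Theta_kernel e (T : measurableType e) (t : T -> 'rV[R]_d.+1)
    (x : T -> 'rV[R]_(d.+1 * d)) :
  measurable_fun setT t -> measurable_fun setT x ->
  measurable_fun setT (fun z => Theta_kernel (t z) (x z)).
Proof.
move=> mt mx; apply: emeasurable_funM; first exact: measurable_gaussx.
apply/measurable_EFinP; apply: measurable_funM.
  exact: (measurableT_comp measurable_jac_ratio mx).
by apply: measurable_bool_real; apply: measurable_ballb; exact: measurable_wcomb.
Qed.

Let Theta_ge0 t : 0 <= Theta t.
Proof. exact: integral_ge0. Qed.

Let measurable_Theta : measurable_fun setT Theta.
Proof.
have mT : measurable_fun setT
  (fun z : 'rV[R]_d.+1 * 'rV[R]_(d.+1 * d) => Theta_kernel z.1 z.2).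
  exact: measurable_Theta_kernel.
exact: (measurable_tonelli1 (f := Theta_kernel) (lam _) mT Theta_kernel_ge0).
Qed.

Lemma jac_reflx z x : ip w z (const_mx 1%R) = 0%R -> jac (reflx z x) = jac x.
Proof.
move=> z1; rewrite /jac simplex_reflx.
under eq_integral do rewrite Lmap_refl//.
have mb : measurable_fun setT (fun t : 'rV[R]_d.+1 =>
  ((ballb (Lmap w (simplex x) t))%:R)%:E : \bar R).
  apply/measurable_EFinP; apply: measurable_bool_real; apply: measurable_ballb.
  exact: measurable_Lmap.
have b0 (t : 'rV[R]_d.+1) : 0 <= ((ballb (Lmap w (simplex x) t))%:R)%:E :> \bar R.
  by rewrite lee_fin.
exact: (integral_refl z mb b0).
Qed.

(** Some reflection takes [t] to [s] up to a constant, which [wcomb] ignores. Moved from [t] to the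
    simplex, it leaves the Gaussian weight, the Jacobian and Lebesgue measure unchanged. *)
Lemma Theta_wvar s t : wvar w s = wvar w t -> Theta s = Theta t.
Proof.
move=> st; have [z1 tE] := refl_exchange wp st.
set z := (centered w t - centered w s)%R in z1 tE *.
rewrite -[RHS](integral_reflx z); last 2 first.
- exact: measurable_Theta_kernel.
- exact: Theta_kernel_ge0.
apply: eq_integral => x _; rewrite /Theta_kernel /gaussx /jac_ratio jac_reflx//.
rewrite simplex_reflx wcomb_refl// tE wcomb_shift//.
suff -> : sq_size (reflx z x) = sq_size x by [].
rewrite !sq_size_ip.
by apply: eq_bigr => j _; rewrite simplex_reflx colr_refl ip_refl_sqr.
Qed.

Let unit_var : exists e : 'rV[R]_d.+1, wvar w e = 1%R.
Proof.
pose t : 'rV[R]_d.+1 := (delta_mx 0 ord0)%R.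
have t0 : (0 < wvar w t)%R.
  rewrite wvar_ip; apply: ip_gt0 => //; apply/eqP => /rowP H.
  have := H ord0; have := H (lift ord0 (Ordinal d_gt0)); rewrite !mxE/=.
  move=> /eqP; rewrite subr_eq0 => /eqP <- /eqP.
  by rewrite subr0 oner_eq0.
exists ((Num.sqrt (wvar w t))^-1 *: t)%R.
by rewrite wvarZ exprVn sqr_sqrtr ?ltW// mulVf// gt_eqF.
Qed.

(** The function is read off along the ray through a vector of unit variance, which exists because
    [0 < d]; this makes it measurable. *)
Lemma Theta_factor : exists theta : R -> \bar R,
  [/\ measurable_fun setT theta, forall N, 0 <= theta N &
      forall t, Theta t = theta (wvar w t)].
Proof.
have [e e1] := unit_var; exists (fun N => Theta (Num.sqrt N *: e)); split; [|by move=> N;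
  exact: Theta_ge0|].
- apply: (measurableT_comp measurable_Theta); apply: measurable_rVZ => //.
  exact: measurable_sqrtr.
- move=> t; apply: Theta_wvar; rewrite wvarZ e1 mulr1 sqr_sqrtr//.
  exact: wvar_ge0.
Qed.

Definition cone_vol (k : nat) (x : 'rV[R]_(d.+1 * d)) : \bar R :=
  \int[lam d]_v ((ballb v && in_cone k (simplex x) v)%:R)%:E.

Definition cone_int (k : nat) : \bar R := \int[lam _]_x (gaussx x * cone_vol k x).

Lemma cone_vol_ge0 k x : 0 <= cone_vol k x.
Proof. by apply: integral_ge0 => v _; rewrite lee_fin. Qed.

Lemma measurable_cone_vol k : measurable_fun setT (cone_vol k).
Proof.
have mb : measurable_fun setT (fun z : 'rV[R]_(d.+1 * d) * 'rV[R]_d =>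
    ((ballb z.2 && in_cone k (simplex z.1) z.2)%:R)%:E : \bar R).
  apply/measurable_EFinP; apply: measurable_bool_real; apply: measurable_and.
    exact: measurable_ballb.
  exact: measurable_in_cone.
have b0 (x : 'rV[R]_(d.+1 * d)) (v : 'rV[R]_d) :
    0 <= ((ballb v && in_cone k (simplex x) v)%:R)%:E :> \bar R by rewrite lee_fin.
exact: (measurable_tonelli1 (f := fun x v => ((ballb v && in_cone k (simplex x) v)%:R)%:E)
  (lam d) mb b0).
Qed.

Definition aboveE (k : nat) (t : 'rV[R]_d.+1) : \bar R := ((above k w t)%:R)%:E.

(** A dummy coordinate ranging over the unit interval raises the dimension from [d] to [d.+1]. Under
    [Lmap] it becomes the slab in the mean, and the cone becomes the event [above]. *)
Let cone_vol_Lmap k x : (\det (edge_mx (simplex x)) != 0)%R -> (0 < k)%N ->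
  gaussx x * cone_vol k x =
  \int[lam d.+1]_t (aboveE k t * unitb (wmean w t) * Theta_kernel t x).
Proof.
move=> D0 k0.
pose f (y : 'rV[R]_d.+1) : \bar R := unitb (y 0%R ord0) *
  ((ballb (\row_i y 0 (lift ord0 i))%R &&
    in_cone k (simplex x) (\row_i y 0 (lift ord0 i))%R)%:R)%:E.
have mtl : measurable_fun setT (fun y : 'rV[R]_d.+1 => (\row_i y 0 (lift ord0 i) : 'rV[R]_d)%R).
  by apply: measurable_fun_rV => i; under eq_fun do rewrite mxE; exact: measurable_coord.
have mf : measurable_fun setT f.
  apply: emeasurable_funM; first by apply: measurable_unitb; exact: measurable_coord.
  apply/measurable_EFinP; apply: measurable_bool_real; apply: measurable_and.
    exact: measurable_ballb.
  exact: measurable_in_cone.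
have f0 y : 0 <= f y by rewrite mule_ge0 ?unitb_ge0// lee_fin.
have fcons a v : f (cons_rV (a, v)) =
    unitb a * ((ballb v && in_cone k (simplex x) v)%:R)%:E.
  rewrite /f cons_rV0 (_ : (\row_i _)%R = v)//.
  by apply/rowP => i; rewrite mxE cons_rVS.
have mv : measurable_fun setT (fun v : 'rV[R]_d =>
    ((ballb v && in_cone k (simplex x) v)%:R)%:E : \bar R).
  apply/measurable_EFinP; apply: measurable_bool_real; apply: measurable_and.
    exact: measurable_ballb.
  exact: measurable_in_cone.
have -> : cone_vol k x = \int[lam d.+1]_y f y.
  rewrite ge0_integral_lebesgue_cons//.
  transitivity (\int[mu]_a (unitb a * cone_vol k x)).
    rewrite ge0_integralZr; last 4 first.
    - by [].
    - exact: measurable_unitb.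
    - by move=> a _; exact: unitb_ge0.
    - exact: cone_vol_ge0.
    by rewrite (integral_unitb_itv (a := 0%R) (b := 1%R))// subr0 mul1e.
  apply: eq_integral => a _; under [RHS]eq_integral do rewrite fcons.
  rewrite ge0_integralZl; [by []|by []|by []| |exact: unitb_ge0].
  by move=> v _; rewrite lee_fin.
rewrite (ge0_integral_Lmap D0 mf f0) -ge0_integralZl; last 4 first.
- by [].
- apply: emeasurable_funM => //; apply: (measurableT_comp mf).
  exact: measurable_Lmap.
- by move=> t _; rewrite mule_ge0// lee_fin jac_ratio_ge0.
- exact: gaussx_ge0.
apply: eq_integral => t _; rewrite /Lmap fcons in_cone_wcomb//.
rewrite /unitb /aboveE /Theta_kernel /gaussx -!EFinM -!mulnb !natrM.
by congr EFin; ring.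
Qed.

Lemma cone_int_Theta k : (0 < k)%N ->
  cone_int k = \int[lam d.+1]_t (aboveE k t * Theta t * unitb (wmean w t)).
Proof.
move=> k0.
have mA : measurable_fun setT (aboveE k).
  by apply/measurable_EFinP; apply: measurable_bool_real; exact: measurable_above.
have A0 t : 0 <= aboveE k t by rewrite lee_fin.
have mAu : measurable_fun setT (fun t : 'rV[R]_d.+1 => aboveE k t * unitb (wmean w t)).
  by apply: emeasurable_funM => //; apply: measurable_unitb; exact: measurable_wmean.
have Au0 t : 0 <= aboveE k t * unitb (wmean w t) by rewrite mule_ge0 ?unitb_ge0.
pose F (x : 'rV[R]_(d.+1 * d)) (t : 'rV[R]_d.+1) : \bar R :=
  aboveE k t * unitb (wmean w t) * Theta_kernel t x.
have F0 x t : 0 <= F x t by rewrite mule_ge0.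
have mF : measurable_fun setT (fun z => F z.1 z.2).
  apply: emeasurable_funM; first exact: (measurableT_comp mAu measurable_snd).
  exact: measurable_Theta_kernel.
transitivity (\int[lam (d.+1 * d)]_x \int[lam d.+1]_t F x t).
  apply: ge0_ae_eq_integral => //.
  - apply: emeasurable_funM; first exact: measurable_gaussx.
    exact: measurable_cone_vol.
  - exact: (measurable_tonelli1 (f := F) (lam d.+1) mF F0).
  - by move=> x _; rewrite mule_ge0 ?cone_vol_ge0.
  - by move=> x _; exact: integral_ge0.
  exists [set x | \det (edge_mx (simplex x)) == 0%R]; split.
  - exact: measurable_degenerate.
  - exact: degenerate_negligible.
  - move=> x /= H; apply: contrapT => /negP D0; apply: H => _.
    exact: cone_vol_Lmap.
rewrite tonelli//; apply: eq_integral => t _; rewrite /F ge0_integralZl; last 4 first.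
- by [].
- exact: measurable_Theta_kernel.
- by move=> x _; exact: Theta_kernel_ge0.
- exact: Au0.
by rewrite muleAC.
Qed.

Let cone_invariant_above k : cone_invariant (aboveE k).
Proof.
split.
- by apply/measurable_EFinP; apply: measurable_bool_real; exact: measurable_above.
- by move=> t; rewrite lee_fin.
- by move=> t l; rewrite /aboveE above_shift.
- by move=> t c c0; rewrite /aboveE aboveZ.
Qed.

Lemma aboveE_all t : aboveE d.+1 t = 1.
Proof.
by rewrite /aboveE (_ : above _ _ _ = true)//; apply/forallP => i; rewrite leqNgt ltn_ord.
Qed.

(** For [k = d.+1] the cone is the whole space and the integral is explicit: this reference case
    fixes the constant for every other [k]. *)
Lemma cone_int_all : cone_int d.+1 =
  lam d (unit_ball d) *
  (\prod_(i < d.+1) (Num.sqrt pi * w 0%R i `^ (- 2^-1)) ^+ d)%:E.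
Proof.
have -> : cone_int d.+1 = \int[lam _]_x (gaussx x * lam d (unit_ball d)).
  apply: eq_integral => x _; congr (_ * _); rewrite -integral_ballb.
  apply: eq_integral => v _; rewrite (_ : in_cone _ _ _ = true) ?andbT//.
  by apply/forallP => j; rewrite ltnS leqNgt ltn_ord.
rewrite ge0_integralZr; last 4 first.
- by [].
- exact: measurable_gaussx.
- by move=> x _; exact: gaussx_ge0.
- exact: measure_ge0.
rewrite muleC; congr (_ * _).
transitivity (\int[lam (d.+1 * d)]_x (\prod_k expR (- (W 0 k * x 0 k ^+ 2)))%R%:E).
  apply: eq_integral => x _; rewrite /gaussx -sq_sizeE -expR_sum sumrN//.
have Wk k : (0 < W 0%R k)%R by rewrite /W; case/mxvec_indexP: k => i j; rewrite mxvecE mxE.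
rewrite (ge0_integral_prod (h := fun k x => expR (- (W 0 k * x ^+ 2))))%R; last 2 first.
- move=> i; apply: measurableT_comp => //; apply: measurable_funN.
  by apply: measurable_funM => //; exact: measurable_funX.
- by move=> i x; exact: expR_ge0.
under eq_bigr do rewrite integral_gauss//.
rewrite prodEFin big_mxvec_prod; congr EFin; apply: eq_bigr => i _.
rewrite -[X in (_ ^+ X)%R](card_ord d) -prodr_const; apply: eq_bigr => j _.
by rewrite mxvecE mxE.
Qed.

(* Both sides are integrals over t of functions of wvar w t only, up to the
   indicator of the cone, so mean_int_cross applies. *)
Lemma cone_int_slice k : (0 < k)%N ->
  cone_int k * mean_int w (fun=> 1) (@gauss_weight R) =
  mean_int w (aboveE k) (@gauss_weight R) * cone_int d.+1.
Proof.
move=> k0; have [theta [mt t0 tE]] := Theta_factor.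
have E k' : (0 < k')%N -> cone_int k' = mean_int w (aboveE k') theta.
  by move=> k'0; rewrite cone_int_Theta//; apply: eq_integral => t _; rewrite tE.
have T1 : cone_int d.+1 = mean_int w (fun=> 1) theta.
  by rewrite (E _ (ltn0Sn d)); apply: eq_integral => t _; rewrite aboveE_all.
by rewrite (E _ k0) T1; exact: (mean_int_cross (d_gt0 : (1 < d.+1)%N) wp (cone_invariant_above k)
  mt t0).
Qed.

End gaussian_simplex.

Arguments unit_ball {R} N.

(** * Mixing over the weights *)

Section mixture.
Context {R : realType}.
Notation mu := (@lebesgue_measure R).
Notation lam := (lebesgue_rV R).
Local Open Scope ereal_scope.

Variables (d : nat) (beta : R).
Hypothesis hb : (d%:R / 2 < beta)%R.

Let b0 : (0 < beta)%R.
Proof. by apply: le_lt_trans hb; rewrite divr_ge0. Qed.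

Definition mix_const : R := (beta'_const d beta / Gamma beta)%R.

Lemma mix_constE : mix_const = ((pi `^ (d%:R / 2) * Gamma (beta - d%:R / 2))^-1)%R.
Proof.
by rewrite /mix_const /beta'_const mulrAC divff ?mul1r// gt_eqF// Gamma_gt0.
Qed.

Lemma mix_const_gt0 : (0 < mix_const)%R.
Proof.
by rewrite mix_constE invr_gt0 mulr_gt0 ?powR_gt0 ?pi_gt0// Gamma_gt0// subr_gt0.
Qed.

(** The contribution of the weight [u] to the beta' density at a point of squared norm [q]: a Gamma
    density times a Gaussian. *)
Definition mixw (q u : R) : R := (mix_const * gammaw beta 1 u * expR (- (u * q)))%R.

Lemma mixw_ge0 q u : (0 <= mixw q u)%R.
Proof.
rewrite /mixw; apply: mulr_ge0; last exact: expR_ge0.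
by rewrite mulr_ge0 ?gammaw_ge0// ltW// mix_const_gt0.
Qed.

Lemma mixw_gammaw q u : mixw q u = (mix_const * gammaw beta (1 + q) u)%R.
Proof.
rewrite /mixw -mulrA; congr (_ * _)%R; rewrite /gammaw -!mulrA -expRD.
by congr (_ * (_ * expR _))%R; ring.
Qed.

Lemma measurable_mixw e (T : measurableType e) (q u : T -> R) :
  measurable_fun setT q -> measurable_fun setT u ->
  measurable_fun setT (fun z => mixw (q z) (u z)).
Proof.
move=> mq mu'; apply: measurable_funM.
  by apply: measurable_funM => //; exact: measurable_gammaw.
by apply: measurableT_comp => //; apply: measurable_funN; exact: measurable_funM.
Qed.

Lemma integral_mixw q : (0 <= q)%R ->
  \int[mu]_u (mixw q u)%:E = (beta'_const d beta * (1 + q) `^ (- beta))%:E.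
Proof.
move=> q0; under eq_integral do rewrite mixw_gammaw EFinM.
rewrite ge0_integralZl; last 4 first.
- by [].
- by apply/measurable_EFinP; exact: measurable_gammaw.
- by move=> u _; rewrite lee_fin gammaw_ge0.
- by rewrite lee_fin ltW// mix_const_gt0.
rewrite integral_gammaw//; last by rewrite ltr_pwDl.
by rewrite -EFinM mulrA /mix_const divfK// gt_eqF// Gamma_gt0.
Qed.

Lemma dotp_ge0 N (v : 'rV[R]_N) : (0 <= dotp v v)%R.
Proof. by apply: sumr_ge0 => i _; rewrite -expr2 sqr_ge0. Qed.

Lemma beta'_density_mixw (v : 'rV[R]_d) :
  (beta'_density beta v)%:E = \int[mu]_u (mixw (dotp v v) u)%:E.
Proof. by rewrite integral_mixw ?dotp_ge0// /beta'_density /enorm sqr_sqrtr ?dotp_ge0. Qed.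

Definition row_sq (x : 'rV[R]_(d.+1 * d)) (i : 'I_d.+1) : R :=
  dotp (row i (simplex x)) (row i (simplex x)).

Definition joint_density (x : 'rV[R]_(d.+1 * d)) : R :=
  (\prod_i beta'_density beta (row i (simplex x)))%R.

Definition joint_mix (x : 'rV[R]_(d.+1 * d)) (w : 'rV[R]_d.+1) : R :=
  (\prod_i mixw (row_sq x i) (w 0 i))%R.

Lemma measurable_row_sq e (T : measurableType e) i (x : T -> 'rV[R]_(d.+1 * d)) :
  measurable_fun setT x -> measurable_fun setT (fun z => row_sq (x z) i).
Proof.
move=> mx; apply: measurable_sum => j.
by apply: measurable_funM; under eq_fun do rewrite mxE; exact: measurable_simplex.
Qed.

Lemma joint_mix_ge0 x w : (0 <= joint_mix x w)%R.
Proof. by apply: prodr_ge0 => i _; exact: mixw_ge0. Qed.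

Lemma measurable_joint_mix e (T : measurableType e) (x : T -> 'rV[R]_(d.+1 * d))
    (w : T -> 'rV[R]_d.+1) :
  measurable_fun setT x -> measurable_fun setT w ->
  measurable_fun setT (fun z => joint_mix (x z) (w z)).
Proof.
move=> mx mw; apply: measurable_prod => i _; apply: measurable_mixw.
  exact: measurable_row_sq.
exact: measurable_coordT.
Qed.

Lemma joint_density_mix x :
  (joint_density x)%:E = \int[lam d.+1]_w (joint_mix x w)%:E.
Proof.
rewrite /joint_mix (ge0_integral_prod (h := fun i u => mixw (row_sq x i) u)).
- rewrite /joint_density -prodEFin; apply: eq_bigr => i _.
  exact: beta'_density_mixw.
- by move=> i; exact: measurable_mixw.
- by move=> i u; exact: mixw_ge0.
Qed.

Lemma joint_density_ge0 x : (0 <= joint_density x)%R.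
Proof.
rewrite -lee_fin joint_density_mix; apply: integral_ge0 => w _.
by rewrite lee_fin joint_mix_ge0.
Qed.

Lemma measurable_joint_density : measurable_fun setT joint_density.
Proof.
apply: measurable_prod => i _; apply: measurable_funM => //.
apply: measurable_fun_powR; apply: measurable_funD => //.
under eq_fun do rewrite /enorm sqr_sqrtr ?dotp_ge0//.
exact: measurable_row_sq.
Qed.

Definition mix_weight (w : 'rV[R]_d.+1) : R :=
  (\prod_i (mix_const * gammaw beta 1 (w 0%R i)))%R.

Lemma joint_mixE x w :
  joint_mix x w = (mix_weight w * expR (- sq_size w x))%R.
Proof.
rewrite /joint_mix /mixw big_split/=; congr (_ * _)%R.
rewrite -expR_sum; congr expR; rewrite sumrN /sq_size; congr (- _)%R.
apply: eq_bigr => i _; congr (_ * _)%R; apply: eq_bigr => j _.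
by rewrite [row i _ _ j]mxE expr2.
Qed.

Lemma mix_weight_ge0 w : (0 <= mix_weight w)%R.
Proof.
by apply: prodr_ge0 => i _; rewrite mulr_ge0 ?gammaw_ge0// ltW// mix_const_gt0.
Qed.

Variable k : nat.
Hypotheses (d_gt0 : (0 < d)%N) (k_gt0 : (0 < k)%N).

Let p : R := (beta - (d%:R - 1) / 2)%R.

Let p12 : (2^-1 < p)%R.
Proof. by rewrite /p; move: hb; lra. Qed.

Let gauss_norm (u : R) : R := (Num.sqrt pi * u `^ (- 2^-1))%R.

Let gauss_norm_gt0 u : (0 < u)%R -> (0 < gauss_norm u)%R.
Proof. by move=> u0; rewrite mulr_gt0 ?powR_gt0// sqrtr_gt0 pi_gt0. Qed.

Lemma mean_int_above (w : 'rV[R]_d.+1) : mean_int w (aboveE w k) (@gauss_weight R) = slice_int k w.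
Proof. by apply: eq_integral => t _; rewrite /slice EFinM. Qed.

(** The reference case [cone_int_all] contributes [d] Gaussian norms per vertex. Dividing by the
    Gaussian integral over the slab, given by [mean_int_gauss], removes one of them and introduces
    the norm of the total weight. *)
Lemma cone_intE (w : 'rV[R]_d.+1) : wpos w ->
  cone_int w k = slice_int k w * lam d (unit_ball d) *
    (\prod_i gauss_norm (w 0%R i) ^+ d.-1 * gauss_norm (wsum w))%:E.
Proof.
move=> wp; have wi i : (0 < w 0%R i)%R by exact: (forallP wp).
set s := (\prod_i gauss_norm (w 0%R i))%R.
have s0 : (0 < s)%R by rewrite prodr_gt0// => i _; exact: gauss_norm_gt0.
have := cone_int_slice d_gt0 wp k_gt0.
rewrite mean_int_above cone_int_all// => E.
have G : mean_int w (fun=> 1) (@gauss_weight R) * (gauss_norm (wsum w))%:E = s%:E.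
  exact: mean_int_gauss.
apply: (@mule_fin_inj _ s%:E); rewrite ?lte_fin ?ltry//.
rewrite muleC -{1}G muleA E -!muleA; rewrite -!EFinM.
rewrite [RHS]muleCA; congr (_ * _).
rewrite [RHS]muleCA; congr (_ * _); rewrite -!EFinM; congr EFin.
rewrite [RHS]mulrA; congr (_ * _)%R.
rewrite /s -big_split/=; apply: eq_bigr => i _.
by rewrite -exprS prednK.
Qed.

Lemma integral_rho_above w : wpos w ->
  \int[lam d.+1]_t (rho p w t * (above k w t)%:R)%:E =
  slice_int k w * (gprod p w * expR (- wsum w) * gauss_norm (wsum w))%:E.
Proof.
move=> wp; have w0 := wsum_gt0 (ltn0Sn d) wp.
have g0 : (0 <= gprod p w * expR (- wsum w))%R by rewrite mulr_ge0 ?gprod_ge0 ?expR_ge0.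
have me : measurable_fun setT (fun x : R => (expR (- (wsum w * x ^+ 2)))%:E).
  apply/measurable_EFinP; apply: measurableT_comp => //; apply: measurable_funN.
  by apply: measurable_funM => //; exact: measurable_funX.
have e0 (x : R) : 0 <= (expR (- (wsum w * x ^+ 2)))%:E by rewrite lee_fin expR_ge0.
have ms : measurable_fun setT (slice k w) by exact: measurable_slice.
have mm : measurable_fun setT (fun t : 'rV[R]_d.+1 => wmean w t) by exact: measurable_wmean.
transitivity ((gprod p w * expR (- wsum w))%:E * \int[lam d.+1]_t
    (slice k w t * (expR (- (wsum w * wmean w t ^+ 2)))%:E)).
  rewrite -ge0_integralZl; last 4 first.
  - by [].
  - by apply: emeasurable_funM => //; exact: (measurableT_comp me mm).
  - by move=> t _; rewrite mule_ge0 ?slice_ge0.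
  - by rewrite lee_fin.
  apply: eq_integral => t _; rewrite /slice -!EFinM rhoE//; congr EFin.
  rewrite mulrDr mulr1 opprD expRD; ring.
have s0 t : 0 <= slice k w t by exact: slice_ge0.
have ss t l : slice k w (t + const_mx l)%R = slice k w t.
  by rewrite /slice above_shift// wvar_shift.
rewrite (integral_wmean w0 ms s0 ss me e0).
rewrite -/(slice_int k w) integral_gauss// muleCA -EFinM.
by rewrite -/(gauss_norm _).
Qed.

(** The [d - 1] Gaussian norms of each vertex lower the power of its weight from [beta - 1] to
    [p - 1]. The constants agree because [p - 2^-1] equals [beta - d%:R / 2]: the weights have the
    same law in both mixtures. *)
Lemma mix_weight_rho w : wpos w ->
  (mix_weight w * \prod_i gauss_norm (w 0 i) ^+ d.-1 =
   (mass p ^+ d.+1)^-1 * (gprod p w * expR (- wsum w)))%R.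
Proof.
move=> wp; have wi i : (0 < w 0%R i)%R by exact: (forallP wp).
rewrite /gprod wp mul1r /wsum -sumrN expR_sum -big_split/=.
rewrite -[X in (mass p ^+ X)%R](card_ord d.+1) -prodr_const -prodfV -!big_split/=.
apply: eq_bigr => i _; move: (w 0%R i) (wi i) => u u0.
rewrite mix_constE /gammaw u0 mul1r mul1r /gauss_norm exprMn /mass.
have sp : (Num.sqrt pi = pi `^ 2^-1 :> R)%R by rewrite powR12_sqrt// pi_ge0.
have d1 : (d.-1%:R = d%:R - 1 :> R)%R by rewrite -[in RHS](prednK d_gt0) -natr1 addrK.
rewrite sp -!powR_mulrn ?powR_ge0// -!powRrM d1.
have -> : (p - 2^-1 = beta - d%:R / 2)%R by rewrite /p; field.
have pp : (0 < pi :> R)%R := pi_gt0 R.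
have E1 : ((pi : R) `^ (d%:R / 2) = pi `^ 2^-1 * pi `^ (2^-1 * (d%:R - 1)))%R.
  by rewrite -powRD ?(gt_eqF pp) ?implybT//; congr (_ `^ _)%R; field.
have E2 : (u `^ (beta - 1) * u `^ (- 2^-1 * (d%:R - 1)) = u `^ (p - 1))%R.
  by rewrite -powRD ?(gt_eqF u0) ?implybT//; congr (_ `^ _)%R; rewrite /p; field.
rewrite E1 -E2.
have G0 : (Gamma (beta - d%:R / 2) != 0)%R by rewrite gt_eqF// Gamma_gt0// subr_gt0.
have A0 : ((pi : R) `^ 2^-1 != 0)%R by rewrite gt_eqF// powR_gt0.
have B0 : ((pi : R) `^ (2^-1 * (d%:R - 1)) != 0)%R by rewrite gt_eqF// powR_gt0.
by field; rewrite A0 B0 G0.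
Qed.

(** For fixed positive weights the two sides carry the same factor [slice_int]; by [mix_weight_rho]
    the other factors agree up to the volume of the ball and a power of [mass]. Elsewhere both
    integrands vanish. *)
Lemma integral_cone_vol_density :
  \int[lam _]_x (cone_vol k x * (joint_density x)%:E) =
  lam d (unit_ball d) * (prob_above p d.+1 k)%:E.
Proof.
have mcv := @measurable_cone_vol R d k.
have cv0 (x : 'rV[R]_(d.+1 * d)) : 0 <= cone_vol k x by exact: cone_vol_ge0.
have B0 : 0 <= lam d (unit_ball d) by exact: measure_ge0.
have m0 : (0 < mass p)%R by exact: mass_gt0.
have mjm : measurable_fun setT (fun z : 'rV[R]_(d.+1 * d) * 'rV[R]_d.+1 =>
    cone_vol k z.1 * (joint_mix z.1 z.2)%:E).
  apply: emeasurable_funM; first exact: (measurableT_comp mcv measurable_fst).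
  by apply/measurable_EFinP; exact: measurable_joint_mix.
transitivity (\int[lam _]_x \int[lam d.+1]_w (cone_vol k x * (joint_mix x w)%:E)).
  apply: eq_integral => x _; rewrite joint_density_mix ge0_integralZl; last 4 first.
  - by [].
  - by apply/measurable_EFinP; exact: measurable_joint_mix.
  - by move=> w _; rewrite lee_fin joint_mix_ge0.
  - exact: cv0.
  by [].
rewrite tonelli; last 2 first.
- exact: mjm.
- by move=> x w; rewrite mule_ge0// lee_fin joint_mix_ge0.
pose A (w : 'rV[R]_d.+1) := \int[lam d.+1]_t (rho p w t * (above k w t)%:R)%:E.
have A0 w : 0 <= A w by apply: integral_ge0 => t _; rewrite lee_fin mulr_ge0 ?rho_ge0.
have mA : measurable_fun setT A.
  have mr : measurable_fun setT (fun z : 'rV[R]_d.+1 * 'rV[R]_d.+1 =>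
      (rho p z.1 z.2 * (above k z.1 z.2)%:R)%:E).
    apply/measurable_EFinP; apply: measurable_funM; first exact: measurable_rho.
    by apply: measurable_bool_real; exact: measurable_above.
  have r0 (w t : 'rV[R]_d.+1) : 0 <= (rho p w t * (above k w t)%:R)%:E.
    by rewrite lee_fin mulr_ge0 ?rho_ge0.
  exact: (measurable_tonelli1 (f := fun w t => (rho p w t * (above k w t)%:R)%:E) (lam _) mr r0).
transitivity (\int[lam d.+1]_w (lam d (unit_ball d) * ((mass p ^+ d.+1)^-1%:E * A w))).
  apply: eq_integral => w _.
  transitivity ((mix_weight w)%:E * cone_int w k).
    rewrite -ge0_integralZl; last 4 first.
    - by [].
    - apply: emeasurable_funM => //; apply/measurable_EFinP.
      apply: measurableT_comp => //; apply: measurable_funN; apply: measurable_sum => i.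
      apply: measurable_funM => //; apply: measurable_sum => j.
      by apply: measurable_funX; exact: measurable_simplex.
    - by move=> x _; rewrite mule_ge0// lee_fin expR_ge0.
    - by rewrite lee_fin mix_weight_ge0.
    by apply: eq_integral => x _; rewrite joint_mixE EFinM muleC -muleA.
  have [wp|wp] := boolP (wpos w).
    rewrite cone_intE// /A integral_rho_above//.
    rewrite [slice_int k w * _]muleC -!muleA [LHS]muleCA; congr (_ * _).
    rewrite [LHS]muleCA [RHS]muleCA; congr (_ * _).
    rewrite -!EFinM; congr EFin; rewrite mulrA mix_weight_rho//.
    by rewrite !mulrA.
  rewrite (_ : mix_weight w = 0%R) ?mul0e; last first.
    have /forallPn[i /negbTE wi] := wp.
    by rewrite /mix_weight (bigD1 i)//= /gammaw wi mul0r mulr0 mul0r.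
  rewrite (_ : A w = 0) ?mule0//; apply: integral0_eq => t _.
  by rewrite rhoE// /gprod (negbTE wp) !mul0r.
have c0 : 0 <= (mass p ^+ d.+1)^-1%:E by rewrite lee_fin invr_ge0 exprn_ge0// ltW.
rewrite ge0_integralZl; last 4 first.
- by [].
- exact: emeasurable_funM.
- by move=> w _; exact: mule_ge0.
- exact: B0.
rewrite ge0_integralZl; [|by []|by []|by []|by []].
rewrite -/(above_int p d.+1 k) above_intE// -EFinM mulrCA mulVf ?mulr1//.
by rewrite expf_neq0// gt_eqF.
Qed.

End mixture.

(** * Joint density of the vertices on boxes *)

Section gaussian_box.
Context {R : realType}.
Notation mu := (@lebesgue_measure R).
Notation lam := (lebesgue_rV R).
Local Open Scope ereal_scope.

Definition gauss_on (B : set R) (u y : R) : R := (\1_B y * expR (- (u * y ^+ 2)))%R.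

Definition gauss_mass (B : set R) (u : R) : R := fine (\int[mu]_y (gauss_on B u y)%:E).

Lemma gauss_on_ge0 B u y : (0 <= gauss_on B u y)%R.
Proof. by rewrite mulr_ge0 ?expR_ge0. Qed.

Lemma measurable_gauss_on B e (T : measurableType e) (u y : T -> R) :
  measurable B -> measurable_fun setT u -> measurable_fun setT y ->
  measurable_fun setT (fun z => gauss_on B (u z) (y z)).
Proof.
move=> mB mu' my; apply: measurable_funM.
  exact: (measurableT_comp (measurable_indic mB) my).
apply: measurableT_comp => //; apply: measurable_funN; apply: measurable_funM => //.
exact: measurable_funX.
Qed.

Lemma gauss_massE B u : measurable B -> (0 < u)%R ->
  \int[mu]_y (gauss_on B u y)%:E = (gauss_mass B u)%:E.
Proof.
move=> mB u0; rewrite /gauss_mass fineK// ge0_fin_numE; last first.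
  by apply: integral_ge0 => y _; rewrite lee_fin gauss_on_ge0.
apply: (@le_lt_trans _ _ (\int[mu]_y (expR (- (u * y ^+ 2)))%:E)); last first.
  by rewrite integral_gauss// ltry.
apply: ge0_le_integral => //.
- by move=> y _; rewrite lee_fin gauss_on_ge0.
- by apply/measurable_EFinP; exact: measurable_gauss_on.
- apply/measurable_EFinP; apply: measurableT_comp => //; apply: measurable_funN.
  by apply: measurable_funM => //; exact: measurable_funX.
- by move=> y _; rewrite lee_fin /gauss_on ler_piMl ?expR_ge0// indicE.
Qed.

Lemma gauss_mass_ge0 B u : (0 <= gauss_mass B u)%R.
Proof.
by rewrite fine_ge0//; apply: integral_ge0 => y _; rewrite lee_fin gauss_on_ge0.
Qed.

Lemma measurable_gauss_mass B : measurable B -> measurable_fun setT (gauss_mass B).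
Proof.
move=> mB; apply: (measurableT_comp (f := fine)) => //.
have m : measurable_fun setT (fun z : R * R => (gauss_on B z.1 z.2)%:E).
  by apply/measurable_EFinP; exact: measurable_gauss_on.
have g0 (u y : R) : 0 <= (gauss_on B u y)%:E by rewrite lee_fin gauss_on_ge0.
exact: (measurable_tonelli1 (f := fun u y => (gauss_on B u y)%:E) mu m g0).
Qed.

Lemma indic_box N (B : 'I_N -> set R) (x : 'rV[R]_N) :
  (\1_(box B) x = \prod_i \1_(B i) (x 0%R i) :> R)%R.
Proof.
have [Bx|nBx] := pselect (box B x).
  by rewrite indicE mem_set// big1// => i _; rewrite indicE mem_set.
rewrite indicE memNset//.
have [i Bi] : exists i, ~ B i (x 0%R i).
  by apply: contrapT => H; apply: nBx => i; apply: contrapT => Bi; apply: H; exists i.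
by rewrite (bigD1 i)//= indicE memNset ?mul0r.
Qed.

Lemma integral_gauss_box N (B : 'I_N -> set R) (u : 'I_N -> R) :
  (forall i, measurable (B i)) -> (forall i, 0 < u i)%R ->
  \int[lam N]_x (\1_(box B) x * expR (- \sum_i u i * x 0 i ^+ 2))%R%:E =
  (\prod_i gauss_mass (B i) (u i))%:E.
Proof.
move=> mB u0; rewrite -prodEFin.
rewrite -(eq_bigr _ (fun i _ => gauss_massE (mB i) (u0 i))).
rewrite -(ge0_integral_prod (h := fun i => gauss_on (B i) (u i))).
- apply: eq_integral => x _; rewrite indic_box -sumrN expR_sum.
  by rewrite /gauss_on big_split.
- by move=> i; exact: measurable_gauss_on.
- by move=> i y; exact: gauss_on_ge0.
Qed.

Variables (d : nat) (beta : R).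
Hypothesis hb : (d%:R / 2 < beta)%R.

(** The contribution of the weight [u] to the probability that one vertex lies in a box. *)
Definition mix_box (B : 'I_d -> set R) (u : R) : R :=
  (mix_const d beta * gammaw beta 1 u * \prod_j gauss_mass (B j) u)%R.

Lemma mix_box_ge0 B u : (0 <= mix_box B u)%R.
Proof.
rewrite /mix_box mulr_ge0 ?prodr_ge0// => [|j _]; last exact: gauss_mass_ge0.
by rewrite mulr_ge0 ?gammaw_ge0// ltW// mix_const_gt0.
Qed.

Lemma measurable_mix_box B : (forall j, measurable (B j)) ->
  measurable_fun setT (mix_box B).
Proof.
move=> mB; apply: measurable_funM.
  by apply: measurable_funM => //; exact: measurable_gammaw.
by apply: measurable_prod => j _; exact: measurable_gauss_mass.
Qed.

Lemma integral_beta'_density_box (B : 'I_d -> set R) : (forall j, measurable (B j)) ->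
  \int[lam d]_(v in box B) (beta'_density beta v)%:E = \int[mu]_u (mix_box B u)%:E.
Proof.
move=> mB; have mbox := measurable_box mB.
have md : measurable_fun setT (fun v : 'rV[R]_d => dotp v v).
  by apply: measurable_sum => j; apply: measurable_funM; exact: measurable_coord.
pose F (v : 'rV[R]_d) u := (\1_(box B) v * mixw d beta (dotp v v) u)%R%:E.
have F0 v u : 0 <= F v u by rewrite lee_fin mulr_ge0// mixw_ge0.
have mF : measurable_fun setT (fun z => F z.1 z.2).
  apply/measurable_EFinP; apply: measurable_funM.
    exact: (measurableT_comp (measurable_indic mbox) measurable_fst).
  apply: measurable_mixw => //; exact: (measurableT_comp md measurable_fst).
transitivity (\int[lam d]_v \int[mu]_u F v u).
  rewrite integral_mkcond; apply: eq_integral => v _.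
  rewrite patchE /F indicE; case: (v \in _); last first.
    by rewrite integral0_eq// => u _; rewrite mul0r.
  by under eq_integral do rewrite mul1r; exact: beta'_density_mixw.
rewrite tonelli//; apply: eq_integral => u _; rewrite /F /mixw /mix_box.
have [u0|u0] := boolP (0 < u)%R; last first.
  rewrite /gammaw (negbTE u0) mul0r mulr0 mul0r.
  by rewrite integral0_eq// => v _; rewrite mul0r mulr0.
set c := (mix_const d beta * _)%R.
have c0 : (0 <= c)%R by rewrite mulr_ge0 ?gammaw_ge0// ltW// mix_const_gt0.
transitivity (\int[lam d]_v (c%:E * (\1_(box B) v * expR (- \sum_i u * v 0 i ^+ 2))%R%:E)).
  apply: eq_integral => v _; rewrite -EFinM mulrCA; congr (_ * (_ * expR (- _)))%R%:E.
  by rewrite /dotp mulr_sumr; apply: eq_bigr => j _; rewrite expr2.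
rewrite ge0_integralZl; last 4 first.
- by [].
- apply/measurable_EFinP; apply: measurable_funM; first exact: measurable_indic.
  apply: measurableT_comp => //; apply: measurable_funN; apply: measurable_sum => j.
  by apply: measurable_funM => //; apply: measurable_funX; exact: measurable_coord.
- by move=> v _; rewrite lee_fin mulr_ge0 ?expR_ge0.
- by rewrite lee_fin.
by rewrite (integral_gauss_box (u := fun=> u) mB)// EFinM.
Qed.

(** The beta' density is not a product over the coordinates, but for fixed weights the Gaussian
    integrand is. Integrals over boxes therefore factor inside the integral over the weights, and
    then over the vertices. *)
Lemma integral_joint_density_box (B : 'I_(d.+1 * d) -> set R) :
  (forall i, measurable (B i)) ->
  \int[lam _]_(x in box B) (joint_density beta x)%:E =
  \prod_(i < d.+1) \int[mu]_u (mix_box (fun j => B (mxvec_index i j)) u)%:E.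
Proof.
move=> mB; have mbox := measurable_box mB.
pose F (x : 'rV[R]_(d.+1 * d)) w := (\1_(box B) x * joint_mix beta x w)%R%:E.
have F0 v u : 0 <= F v u by rewrite lee_fin mulr_ge0// joint_mix_ge0.
have mF : measurable_fun setT (fun z => F z.1 z.2).
  apply/measurable_EFinP; apply: measurable_funM.
    exact: (measurableT_comp (measurable_indic mbox) measurable_fst).
  exact: measurable_joint_mix.
transitivity (\int[lam _]_x \int[lam d.+1]_w F x w).
  rewrite integral_mkcond; apply: eq_integral => x _.
  rewrite patchE /F indicE; case: (x \in _); last first.
    by rewrite integral0_eq// => w _; rewrite mul0r.
  by under eq_integral do rewrite mul1r; exact: joint_density_mix.
rewrite tonelli//.
rewrite -(ge0_integral_prod (h := fun i => mix_box (fun j => B (mxvec_index i j)))); last 2 first.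
- by move=> i; exact: measurable_mix_box.
- by move=> i u; exact: mix_box_ge0.
apply: eq_integral => w _; rewrite /F.
under eq_integral do rewrite joint_mixE mulrCA EFinM.
rewrite ge0_integralZl; last 4 first.
- by [].
- apply/measurable_EFinP; apply: measurable_funM; first exact: measurable_indic.
  apply: measurableT_comp => //; apply: measurable_funN; apply: measurable_sum => i.
  apply: measurable_funM => //; apply: measurable_sum => j.
  by apply: measurable_funX; exact: measurable_simplex.
- by move=> x _; rewrite lee_fin mulr_ge0 ?expR_ge0.
- by rewrite lee_fin mix_weight_ge0.
rewrite /mix_box big_split/= -/(mix_weight beta w) EFinM.
have [wp|wp] := boolP (wpos w); last first.
  rewrite (_ : mix_weight beta w = 0%R) ?mul0e//.
  have /forallPn[i /negbTE wi] := wp.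
  by rewrite /mix_weight (bigD1 i)//= /gammaw wi mul0r mulr0 mul0r.
congr (_ * _).
pose W : 'rV[R]_(d.+1 * d) := mxvec (\matrix_(i, j) w 0%R i).
have W0 k : (0 < W 0%R k)%R.
  by rewrite /W; case/mxvec_indexP: k => i j; rewrite mxvecE mxE; exact: (forallP wp).
transitivity (\int[lam _]_x (\1_(box B) x * expR (- \sum_i W 0 i * x 0 i ^+ 2))%R%:E).
  apply: eq_integral => x _; congr (_ * expR (- _))%R%:E.
  rewrite big_mxvec; apply: eq_bigr => i _; rewrite mulr_sumr; apply: eq_bigr => j _.
  by rewrite mxvecE !mxE.
rewrite (integral_gauss_box mB W0) big_mxvec_prod; congr EFin.
by apply: eq_bigr => i _; apply: eq_bigr => j _; rewrite mxvecE mxE.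
Qed.

End gaussian_box.

(** * The law of the random simplex *)

Section law.
Context {R : realType} e (T : measurableType e) (P : probability T R).
Notation lam := (lebesgue_rV R).
Local Open Scope ereal_scope.
Variables (d : nat) (beta : R) (X : 'I_d.+1 -> {RV P >-> 'rV[R]_d}).
Hypothesis hb : (d%:R / 2 < beta)%R.
Hypothesis X_indep : mutually_independent X.
Hypothesis X_density : forall i, has_density (X i) (@beta'_density R d beta).

Definition vertices (a : T) : 'rV[R]_(d.+1 * d) := mxvec (\matrix_(i, j) X i a 0%R j).

Lemma measurable_vertices : measurable_fun setT vertices.
Proof.
apply: measurable_fun_rV => k; case/mxvec_indexP: k => i j.
under eq_fun do rewrite mxvecE mxE.
exact: measurable_coordT (measurable_funP (X i)).
Qed.

(** Independence and the densities of the single vertices determine the probabilities of boxes, and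
    these determine the law. *)
Lemma integral_vertices (f : 'rV[R]_(d.+1 * d) -> \bar R) :
  measurable_fun setT f -> (forall x, 0 <= f x) ->
  \int[P]_a f (vertices a) = \int[lam _]_x (f x * (joint_density beta x)%:E).
Proof.
move=> mf f0; have mW := measurable_vertices.
have mg : measurable_fun setT (fun x : 'rV[R]_(d.+1 * d) => (joint_density beta x)%:E).
  by apply/measurable_EFinP; exact: measurable_joint_density.
have g0 (x : 'rV[R]_(d.+1 * d)) : 0 <= (joint_density beta x)%:E.
  by rewrite lee_fin joint_density_ge0.
rewrite -(ge0_integral_density (lam _) mg g0)//.
transitivity (\int[image_measure P mW]_x f x).
  by rewrite ge0_integral_pushforward// preimage_setT.
apply: eq_measure_integral => A mA _; apply: rV_measure_unique => //; last first.
  move=> K; apply: (@le_lt_trans _ _ 1); last exact: ltry.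
  apply: (probability_le1 P); rewrite -[X in measurable X]setTI.
  by apply: mW => //; exact: measurable_box.
move=> B mB.
transitivity (P (\bigcap_i (X i @^-1` box (fun j => B (mxvec_index i j))))).
  congr (P _); apply/seteqP; split => a /=.
    move=> H i _ j; have := H (mxvec_index i j).
    by rewrite /vertices mxvecE mxE.
  move=> H k; case/mxvec_indexP: k => i j; rewrite /vertices mxvecE mxE.
  exact: H.
rewrite X_indep; last by move=> i; exact: measurable_box.
transitivity (\prod_i \int[@lebesgue_measure R]_u (mix_box beta (fun j => B (mxvec_index i j))
  u)%:E).
  apply: eq_bigr => i _; rewrite X_density; last exact: measurable_box.
  exact: integral_beta'_density_box.
by rewrite -integral_joint_density_box.
Qed.

End law.

(** * Internal angles of simplices *)

Section hulls.
Context {R : realType} (d n : nat).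
Implicit Types (x : 'I_n -> 'rV[R]_d) (D : pred 'I_n).

(** A convex combination may use a vertex several times; grouping the terms by vertex leaves one
    coefficient for each. *)
Lemma conv_hull_family x D y : conv_hull [set x i | i in [set i | D i]] y ->
  exists a : 'I_n -> R, [/\ \sum_i a i = 1, forall i, 0 <= a i,
    forall i, ~~ D i -> a i = 0 & y = \sum_i a i *: x i].
Proof.
move=> [m [a [z [a0 a1 zD ->]]]].
have /choice[f fP] : forall l, exists i, D i /\ x i = z l.
  by move=> l; have [i Di <-] := zD l; exists i.
exists (fun i => \sum_(l | f l == i) a l); split.
- by rewrite -a1 [RHS](partition_big f xpredT).
- by move=> i; exact: sumr_ge0.
- move=> i Di; rewrite big1// => l /eqP fi.
  by have [Dl _] := fP l; rewrite -fi Dl in Di.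
- rewrite (partition_big f xpredT)//=; apply: eq_bigr => i _.
  rewrite scaler_suml; apply: eq_bigr => l /eqP <-.
  by have [_ ->] := fP l.
Qed.

Lemma aff_hull_family x D y :
  aff_hull (conv_hull [set x i | i in [set i | D i]]) y ->
  exists a : 'I_n -> R, [/\ \sum_i a i = 1, forall i, ~~ D i -> a i = 0 &
    y = \sum_i a i *: x i].
Proof.
move=> [m [a [z [a1 zF ->]]]].
have /choice[c cP] : forall l, exists c : 'I_n -> R,
    [/\ \sum_i c i = 1, forall i, ~~ D i -> c i = 0 & z l = \sum_i c i *: x i].
  by move=> l; have /conv_hull_family[c [c1 _ cD zE]] := zF l; exists c.
exists (fun i => \sum_l a l * c l i); split.
- rewrite exchange_big/= -a1; apply: eq_bigr => l _; rewrite -mulr_sumr.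
  by have [-> _ _] := cP l; rewrite mulr1.
- by move=> i Di; rewrite big1// => l _; have [_ -> //] := cP l; rewrite mulr0.
- under [RHS]eq_bigr do rewrite scaler_suml.
  rewrite exchange_big/=; apply: eq_bigr => l _; have [_ _ ->] := cP l.
  by rewrite scaler_sumr; apply: eq_bigr => i _; rewrite scalerA.
Qed.

(** All points of a combination in [conv_hull] must lie in the given set, so the indices outside
    [D], whose coefficients vanish, borrow the point [x i0]. *)
Lemma family_conv_hull x D (i0 : 'I_n) (a : 'I_n -> R) : D i0 ->
  \sum_i a i = 1 -> (forall i, 0 <= a i) -> (forall i, ~~ D i -> a i = 0) ->
  conv_hull [set x i | i in [set i | D i]] (\sum_i a i *: x i).
Proof.
move=> Di0 a1 a0 aD; exists n, a, (fun i => if D i then x i else x i0); split => //.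
- by move=> i; case: ifP => Di /=; [exists i|exists i0].
- by apply: eq_bigr => i _; case: ifPn => // /aD ->; rewrite !scale0r.
Qed.

End hulls.

Section simplex_geometry.
Context {R : realType}.
Variables (d k : nat) (X : 'M[R]_(d.+1, d)).
Hypothesis X_nondeg : \det (edge_mx X) != 0.
Hypotheses (k_gt0 : (0 < k)%N) (k_le : (k <= d)%N).

Let x (i : 'I_d.+1) : 'rV[R]_d := row i X.
Let F := conv_hull [set x i | i in [set i : 'I_d.+1 | (i < k)%N]].
Let P := conv_hull [set x i | i in [set: 'I_d.+1]].

Lemma edge_coordZ (c : R) v : edge_coord X (c *: v) = c *: edge_coord X v.
Proof. by rewrite /edge_coord -scalemxAl !scalerA mulrC. Qed.

Lemma edge_coord_sum (c : 'I_d.+1 -> R) j : \sum_i c i = 0 ->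
  edge_coord X (\sum_i c i *: x i) 0 j = c (lift ord0 j).
Proof.
move=> c0; suff -> : \sum_i c i *: x i = (\row_i c (lift ord0 i)) *m edge_mx X.
  by rewrite mul_edge_mxK// mxE.
apply/rowP => l; rewrite mxE summxE.
under [RHS]eq_bigr do rewrite !mxE mulrBr.
rewrite sumrB -mulr_suml big_ord_recl !mxE.
have -> : \sum_i c (lift ord0 i) = - c ord0.
  by apply/eqP; rewrite -addr_eq0 addrC; rewrite big_ord_recl in c0; apply/eqP.
rewrite mulNr opprK addrC; congr (_ + _).
by apply: eq_bigr => i _; rewrite !mxE.
Qed.

(** The coefficients of sum zero that express [v] by the vertices, as differences of barycentric
    coordinates do. *)
Definition coords (v : 'rV[R]_d) (i : 'I_d.+1) : R :=
  if unlift ord0 i is Some j then edge_coord X v 0 j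
  else - \sum_j edge_coord X v 0 j.

Lemma coords0 v : coords v ord0 = - \sum_j edge_coord X v 0 j.
Proof. by rewrite /coords unlift_none. Qed.

Lemma coordsS v j : coords v (lift ord0 j) = edge_coord X v 0 j.
Proof. by rewrite /coords liftK. Qed.

Lemma sum_coords v : \sum_i coords v i = 0.
Proof.
rewrite big_ord_recl coords0; under [X in _ + X]eq_bigr do rewrite coordsS.
by rewrite addNr.
Qed.

Lemma coordsK v : \sum_i coords v i *: x i = v.
Proof.
have E : edge_coord X (\sum_i coords v i *: x i) = edge_coord X v.
  by apply/rowP => j; rewrite edge_coord_sum ?sum_coords// coordsS.
by rewrite -[LHS](edge_coordK _ X_nondeg) E edge_coordK.
Qed.

Lemma edge_coord_diff (a b : 'I_d.+1 -> R) j : \sum_i a i = 1 -> \sum_i b i = 1 ->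
  edge_coord X (\sum_i a i *: x i - \sum_i b i *: x i) 0 j =
  a (lift ord0 j) - b (lift ord0 j).
Proof.
move=> a1 b1; rewrite -sumrB; under eq_bigr do rewrite -scalerBl.
by rewrite edge_coord_sum// sumrB a1 b1 subrr.
Qed.

(** The last vertex separates the two sets: its last coefficient is 1, but would be 0 in the face,
    and nondegeneracy makes the coefficients unique. *)
Lemma face_neq : F <> P.
Proof.
move=> FP; have : P (x ord_max).
  have := @family_conv_hull R d d.+1 x xpredT ord_max (fun i => (i == ord_max)%:R) isT.
  rewrite (bigD1 ord_max)//= eqxx big1 ?addr0 => [|i /negbTE -> //].
  move=> /(_ erefl) H; rewrite /P.
  have := H _ _; rewrite (bigD1 ord_max)//= eqxx scale1r big1 ?addr0; last first.
    by move=> i /negbTE ->; rewrite scale0r.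
  rewrite (_ : [set i | true] = setT); last by apply/seteqP; split.
  by apply => // i; exact: ler0n.
rewrite -FP => /conv_hull_family[a [a1 _ aD E]].
have d0 : (0 < d)%N by exact: leq_trans k_gt0 k_le.
have dm : (d.-1 < d)%N by rewrite prednK.
have mE : ord_max = lift ord0 (Ordinal dm) :> 'I_d.+1.
  by apply: val_inj; rewrite /= /bump/= add1n prednK.
have amax : a ord_max = 0 by apply: aD; rewrite -leqNgt.
have b1 : \sum_(i < d.+1) (i == ord_max)%:R = 1 :> R.
  by rewrite (bigD1 ord_max)//= eqxx big1 ?addr0// => i /negbTE ->.
have xE : x ord_max = \sum_i (i == ord_max)%:R *: x i.
  rewrite (bigD1 ord_max)//= eqxx scale1r big1 ?addr0// => i /negbTE ->.
  by rewrite scale0r.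
have := edge_coord_diff (Ordinal dm) a1 b1.
rewrite -E -xE subrr -mE amax eqxx /edge_coord mul0mx scaler0 mxE.
by move/eqP; rewrite eq_sym subr_eq0 eq_sym oner_eq0.
Qed.

Lemma norm_coord_le (v : 'rV[R]_d) l : `|v 0 l| <= enorm v.
Proof.
rewrite /enorm -sqrtr_sqr ler_wsqrtr// /dotp (bigD1 l)//= -expr2 lerDl.
by apply: sumr_ge0 => i _; rewrite -expr2 sqr_ge0.
Qed.

(** The coordinates are linear in [v], hence controlled by its Euclidean norm, in which [relint] is
    stated. *)
Lemma coords_bound : exists2 K : R, 0 <= K & forall v i, `|coords v i| <= K * enorm v.
Proof.
pose N l j := (\det (edge_mx X))^-1 * (\adj (edge_mx X)) l j.
pose K j := \sum_l `|N l j|.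
have K0 j : 0 <= K j by exact: sumr_ge0.
have jK v j : `|edge_coord X v 0 j| <= K j * enorm v.
  rewrite !mxE mulr_sumr; apply: le_trans (ler_norm_sum _ _ _) _.
  rewrite mulr_suml; apply: ler_sum => l _.
  by rewrite mulrCA normrM mulrC ler_wpM2l// norm_coord_le.
exists (\sum_j K j); first exact: sumr_ge0.
move=> v i; case: (unliftP ord0 i) => [j|] ->.
  rewrite coordsS; apply: le_trans (jK v j) _; rewrite ler_wpM2r ?sqrtr_ge0//.
  by rewrite (bigD1 j)//= lerDl sumr_ge0.
rewrite coords0 normrN; apply: le_trans (ler_norm_sum _ _ _) _.
by rewrite mulr_suml; apply: ler_sum => j _; exact: jK.
Qed.

Let S : R := \sum_(i < d.+1) (i < k)%N%:R.

Let S0 : 0 < S.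
Proof. by rewrite /S (bigD1 ord0)//= k_gt0 ltr_pwDl// sumr_ge0. Qed.

Let bw (i : 'I_d.+1) : R := (i < k)%N%:R / S.

Let bw1 : \sum_i bw i = 1.
Proof. by rewrite -mulr_suml divff// gt_eqF. Qed.

Let bw_ge0 i : 0 <= bw i.
Proof. by rewrite divr_ge0// ltW. Qed.

Let bw0 (i : 'I_d.+1) : ~~ (i < k)%N -> bw i = 0.
Proof. by rewrite /bw => /negbTE ->; rewrite mul0r. Qed.

Let bary : 'rV[R]_d := \sum_i bw i *: x i.


Let PE : P = conv_hull [set x i | i in [set i | xpredT i]].
Proof. by rewrite (_ : [set i | xpredT i] = setT)//; apply/seteqP; split. Qed.

Lemma coords_diff (a b : 'I_d.+1 -> R) i : \sum_i a i = 1 -> \sum_i b i = 1 ->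
  coords (\sum_i a i *: x i - \sum_i b i *: x i) i = a i - b i.
Proof.
move=> a1 b1; case: (unliftP ord0 i) => [j|] ->; first by rewrite coordsS edge_coord_diff.
rewrite coords0; under eq_bigr do rewrite edge_coord_diff//.
have E : \sum_i (a i - b i) = 0 by rewrite sumrB a1 b1 subrr.
by move: E; rewrite big_ord_recl => /eqP; rewrite addr_eq0 => /eqP ->.
Qed.

Lemma coordsZ (c : R) v i : coords (c *: v) i = c * coords v i.
Proof.
case: (unliftP ord0 i) => [j|] ->; first by rewrite !coordsS edge_coordZ mxE.
rewrite !coords0 mulrN mulr_sumr; congr (- _).
by apply: eq_bigr => j _; rewrite edge_coordZ mxE.
Qed.

Let relint_bary : relint F bary.
Proof.
split; first exact: (@family_conv_hull _ _ _ x (fun i : 'I_d.+1 => (i < k)%N) ord0).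
have [K K0 Kle] := coords_bound.
(* The barycenter of the face has all its coordinates there equal to [S^-1]. Within this radius each
   changes by at most [S^-1] and stays nonnegative; the added 1 covers [K = 0]. *)
exists (S^-1 / (1 + K)); first by rewrite divr_gt0 ?invr_gt0// ltr_pwDl.
move=> y /(@aff_hull_family _ _ _ x (fun i : 'I_d.+1 => (i < k)%N))[a [a1 aD yE]] yr.
rewrite yE; apply: (@family_conv_hull _ _ _ x (fun i : 'I_d.+1 => (i < k)%N) ord0) => // i.
have [ik|ik] := boolP (i < k)%N; last by rewrite aD.
have := Kle (y - bary) i; rewrite yE coords_diff// -yE => H.
have {}H : `|a i - bw i| <= S^-1.
  apply: le_trans H _; apply: (@le_trans _ _ (K * (S^-1 / (1 + K)))).
    by rewrite ler_wpM2l// ltW.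
  rewrite mulrCA ler_piMr ?invr_ge0 ?(ltW S0)//.
  by rewrite ler_pdivrMr ?ltr_pwDl// mul1r lerDr.
move: H; rewrite ler_norml => /andP[+ _].
by rewrite /bw ik mul1r lerBrDr addNr.
Qed.

(** A point of the face has zero coefficients at the other vertices, and a point of the simplex has
    nonnegative ones there, so a tangent direction satisfies the sign conditions. Conversely, a
    direction in the cone can be followed for a while from the barycenter. *)
Lemma tangent_cone_simplex : tangent_cone F P = [set v | in_cone k X v].
Proof.
apply/seteqP; split => v /=.
  move=> [f0 [/(@conv_hull_family _ _ _ x (fun i : 'I_d.+1 => (i < k)%N))[a [a1 _ aD fE]] _]].
  move=> [e e0]; rewrite PE => /(@conv_hull_family _ _ _ x xpredT)[b [b1 b0 _ gE]].
  apply/forallP => j; apply/implyP => kj.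
  have := coords_diff (lift ord0 j) b1 a1.
  rewrite -gE -fE addrC addKr coordsZ coordsS.
  rewrite (aD (lift ord0 j)) -?leqNgt// subr0 => E.
  by rewrite -(pmulr_rge0 _ e0) E b0.
move=> /forallP vC; exists bary; first exact: relint_bary.
(* Small enough that no coordinate of [e *: v] exceeds [S^-1], the coordinate of the barycenter, in
   absolute value. *)
pose e := S^-1 / (1 + \sum_i `|coords v i|).
have e0 : 0 < e.
  by rewrite divr_gt0 ?invr_gt0// ltr_pwDl// sumr_ge0.
exists e => //; rewrite PE.
have -> : bary + e *: v = \sum_i (bw i + e * coords v i) *: x i.
  rewrite -[in LHS](coordsK v) scaler_sumr -big_split/=.
  by apply: eq_bigr => i _; rewrite scalerDl scalerA.
apply: (@family_conv_hull _ _ _ x xpredT ord0) => //.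
  by rewrite big_split/= bw1 -mulr_sumr sum_coords mulr0 addr0.
move=> i; have [ik|ik] := boolP (i < k)%N; last first.
  rewrite bw0// add0r pmulr_rge0//; move: ik.
  case: (unliftP ord0 i) => [j|] ->; last by rewrite k_gt0.
  rewrite -leqNgt => kj; rewrite coordsS.
  by have /implyP := vC j; apply.
rewrite /bw ik mul1r -lerBlDl sub0r lerNl -mulrN.
apply: (@le_trans _ _ (e * \sum_i `|coords v i|)).
  rewrite ler_pM2l//; apply: (@le_trans _ _ `|coords v i|).
    by rewrite lerNl; have := lerNnormlW (lexx `|coords v i|).
  by rewrite (bigD1 i)//= lerDl sumr_ge0.
rewrite /e -mulrA ler_piMr ?invr_ge0 ?(ltW S0)//.
rewrite mulrC ler_pdivrMr ?mul1r ?lerDr//.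
by rewrite ltr_pwDl// sumr_ge0.
Qed.

(** The cone contains every edge vector from vertex 0, and these span the space. *)
Lemma lspan_in_cone (L : {vspace 'rV[R]_d}) :
  (forall v, in_cone k X v -> v \in L) -> L = fullv.
Proof.
move=> CL; apply/vspaceP => v; rewrite memvf.
rewrite -[v](edge_coordK _ X_nondeg) mulmx_sum_row; apply: memv_suml => j _.
apply: memvZ; apply: CL; apply/forallP => i; apply/implyP => _.
by rewrite rowE mul_edge_mxK// mxE ler0n.
Qed.

End simplex_geometry.

(** * Solid angle of a cone that spans the space *)

Section solid_angle.
Context {R : realType}.
Notation lam := (lebesgue_rV R).
Variables (d : nat) (C : set 'rV[R]_d).
Hypothesis mC : measurable C.
Hypothesis CZ : forall (c : R) v, 0 < c -> C v -> C (c *: v).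

Lemma enorm_le1 N (v : 'rV[R]_N) : (enorm v <= 1) = ballb v.
Proof. by rewrite /ballb -[in LHS](sqrtr1 R) ler_sqrt// ltr01. Qed.

Lemma enorm_eq0 N (v : 'rV[R]_N) : enorm v = 0 -> v = 0.
Proof.
move=> v0; apply/rowP => i; rewrite mxE; apply/eqP; rewrite -normr_le0 -v0.
rewrite /enorm -sqrtr_sqr ler_wsqrtr// /dotp (bigD1 i)//= -expr2 lerDl.
by apply: sumr_ge0 => j _; rewrite -expr2 sqr_ge0.
Qed.

(** [N] is kept apart from [d] because it is to be [\dim fullv], which equals [d] only by a proof.
    The orthogonal matrix preserves the ball and Lebesgue measure; invariance of [C] under dilations
    removes the normalisation of the vectors. *)
Lemma sphere_unif_orthonormal N (e : N.-tuple 'rV[R]_d) : N = d ->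
  (forall i j, dotp (tnth e i) (tnth e j) = (i == j)%:R) ->
  sphere_unif [set u : 'rV[R]_N | C (\sum_i u 0 i *: tnth e i)] =
  fine (lam d [set v | ballb v /\ C v]) / fine (lam d (unit_ball d)).
Proof.
move=> Nd; subst N => eO.
pose E : 'M[R]_d := \matrix_i tnth e i.
have EE : E *m E^T = 1%:M.
  apply/matrixP => i j; rewrite !mxE -eO; apply: eq_bigr => l _.
  by rewrite !mxE.
have EE' : E^T *m E = 1%:M by exact: mulmx1C.
have phiE (u : 'rV[R]_d) : \sum_i u 0 i *: tnth e i = u *m E.
  rewrite mulmx_sum_row; apply: eq_bigr => i _; congr (_ *: _).
  by apply/rowP => j; rewrite !mxE.
have mphi : measurable_fun setT (fun u : 'rV[R]_d => u *m E).
  apply: measurable_fun_rV => j; under eq_fun do rewrite mxE.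
  by apply: measurable_sum => i; apply: measurable_funM => //; exact: measurable_coord.
have dotE (u : 'rV[R]_d) : dotp (u *m E) (u *m E) = dotp u u.
  have dE (a b : 'rV[R]_d) : dotp a b = (a *m b^T) 0 0.
    by rewrite mxE; apply: eq_bigr => i _; rewrite mxE.
  by rewrite !dE trmx_mul mulmxA -(mulmxA u) EE mulmx1.
have mB : measurable [set v : 'rV[R]_d | ballb v /\ C v].
  by apply: measurableI => //; exact: measurable_unit_ball.
have phi_inv (A : set 'rV[R]_d) : measurable A ->
    lam d ((fun u : 'rV[R]_d => u *m E) @^-1` A) = lam d A.
  move=> mA; have mA' : measurable ((fun u : 'rV[R]_d => u *m E) @^-1` A).
    by rewrite -[X in measurable X]setTI; exact: mphi.
  rewrite -[in RHS](setIT A) -[in LHS](setIT (_ @^-1` A)) -!integral_indic//.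
  apply: (@ge0_integral_isometry R d (const_mx 1) (fun u => u *m E)
    (fun v => v *m E^T) (fun v => (\1_A v : R)%:E)).
  - by apply/forallP => i; rewrite mxE ltr01.
  - by move=> u v; rewrite mulmxDl.
  - exact: mphi.
  - by move=> v; rewrite -mulmxA EE' mulmx1.
  - move=> u; have sE (v : 'rV[R]_d) : \sum_i const_mx 1 0 i * v 0 i ^+ 2 = dotp v v.
      by apply: eq_bigr => i _; rewrite mxE mul1r expr2.
    by rewrite !sE dotE.
  - by apply/measurable_EFinP; exact: measurable_indic.
  - by move=> v; rewrite lee_fin.
have BE : [set u : 'rV[R]_d | enorm u <= 1] = unit_ball d.
  by apply/seteqP; split => u /=; rewrite enorm_le1.
rewrite /sphere_unif BE.
have -> : [set u : 'rV[R]_d | enorm u <= 1 /\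
    C (\sum_i ((enorm u)^-1 *: u) 0 i *: tnth e i)] =
    (fun u : 'rV[R]_d => u *m E) @^-1` [set v | ballb v /\ C v].
  apply/seteqP; split => u /=; rewrite enorm_le1 phiE /ballb dotE -scalemxAl.
    move=> [uB uC]; split => //.
    (* At the origin the inverse norm is 0 by convention, and both conditions reduce to whether [C]
       contains 0. *)
    have [u0|u0] := eqVneq (enorm u) 0.
      by move: uC; rewrite (enorm_eq0 u0) mul0mx scaler0.
    have un : 0 < enorm u by rewrite lt_neqAle eq_sym u0 sqrtr_ge0.
    by have := CZ un uC; rewrite scalerA divff// scale1r.
  move=> [uB uC]; split => //.
  have [u0|u0] := eqVneq (enorm u) 0.
    by move: uC; rewrite (enorm_eq0 u0) mul0mx scaler0.
  have un : 0 < enorm u by rewrite lt_neqAle eq_sym u0 sqrtr_ge0.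
  by apply: CZ => //; rewrite invr_gt0.
by rewrite phi_inv.
Qed.

Hypothesis C_full : forall L : {vspace 'rV[R]_d}, (forall v, C v -> v \in L) -> L = fullv.

(** The default value of [xget] in [lspan] is [fullv], so both cases give the full space. *)
Lemma lspan_full : lspan C = fullv.
Proof.
rewrite /lspan; have [H|H] := pselect (exists L, is_lspan C L).
  by have [CL _] := xgetPex fullv H; exact: C_full.
by rewrite xgetPN// => L CL; apply: H; exists L.
Qed.

Lemma dim_rV : \dim (fullv : {vspace 'rV[R]_d}) = d.
Proof. by rewrite dimvf dim_matrix; exact: mul1n. Qed.

(** The specification of [xget] applies as soon as some orthonormal basis exists; the standard
    basis, reindexed by [\dim], is one. *)
Lemma orthonormal_basis_full i j :
  dotp (tnth (orthonormal_basis (fullv : {vspace 'rV[R]_d})) i)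
       (tnth (orthonormal_basis (fullv : {vspace 'rV[R]_d})) j) = (i == j)%:R.
Proof.
pose L : {vspace 'rV[R]_d} := fullv.
suff H : exists e : (\dim L).-tuple 'rV[R]_d, basis_of L e /\
    forall i j, dotp (tnth e i) (tnth e j) = (i == j)%:R.
  by have [_] := xgetPex (vbasis L) H; exact.
pose e := [tuple (delta_mx 0 (cast_ord dim_rV i) : 'rV[R]_d) | i < \dim L].
exists e; split; last first.
  move=> a b; rewrite !tnth_mktuple /dotp (bigD1 (cast_ord dim_rV a))//= !mxE !eqxx/=.
  rewrite mul1r big1 ?addr0; last by move=> l /negbTE la; rewrite mxE la/= mul0r.
  by rewrite (inj_eq (@cast_ord_inj _ _ _)).
rewrite basisEdim size_tuple leqnn andbT; apply/subvP => v _.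
rewrite [v]row_sum_delta; apply: memv_suml => l _; apply: memvZ.
apply: memv_span; apply/tnthP; exists (cast_ord (esym dim_rV) l).
by rewrite tnth_mktuple cast_ordKV.
Qed.

Lemma solid_angle_cone : solid_angle C =
  fine (lam d [set v | ballb v /\ C v]) / fine (lam d (unit_ball d)).
Proof.
rewrite /solid_angle lspan_full; apply: sphere_unif_orthonormal.
  exact: dim_rV.
exact: orthonormal_basis_full.
Qed.

End solid_angle.

Section simplex_angle.
Context {R : realType}.
Notation lam := (lebesgue_rV R).
Variables (d k : nat) (x : 'rV[R]_(d.+1 * d)).
Hypothesis x_nondeg : \det (edge_mx (simplex x)) != 0.
Hypotheses (k_gt0 : (0 < k)%N) (k_le : (k <= d)%N).

Lemma internal_angle_simplex :
  internal_angle
    (conv_hull [set row i (simplex x) | i in [set i : 'I_d.+1 | (i < k)%N]])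
    (conv_hull [set row i (simplex x) | i in [set: 'I_d.+1]]) =
  fine (cone_vol k x) / fine (lam d (unit_ball d)).
Proof.
rewrite /internal_angle asboolF; last exact: face_neq.
rewrite tangent_cone_simplex// solid_angle_cone.
- congr (fine _ / _); rewrite /cone_vol.
  have mB : measurable [set v : 'rV[R]_d | ballb v /\ in_cone k (simplex x) v].
    have mb : measurable_fun setT (fun v : 'rV[R]_d => ballb v && in_cone k (simplex x) v).
      by apply: measurable_and; [exact: measurable_ballb|exact: measurable_in_cone].
    rewrite -[X in measurable X]setTI (_ : [set v | _ /\ _] =
      (fun v : 'rV[R]_d => ballb v && in_cone k (simplex x) v) @^-1` [set true]).
      exact: mb.
    by apply/seteqP; split => v /= /andP.
  rewrite -[X in lam d X]setIT -integral_indic//; apply: eq_integral => v _.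
  rewrite indicE; congr (_%:R%:E); congr nat_of_bool.
  by apply/idP/andP => [/set_mem|/mem_set].
- have mb : measurable_fun setT (fun v : 'rV[R]_d => in_cone k (simplex x) v).
    exact: measurable_in_cone.
  rewrite -[X in measurable X]setTI (_ : [set v | _] =
    (fun v : 'rV[R]_d => in_cone k (simplex x) v) @^-1` [set true]).
    exact: mb.
  by apply/seteqP; split.
- move=> c v c0 /= /forallP vC; apply/forallP => j; apply/implyP => kj.
  by rewrite edge_coordZ mxE mulr_ge0 ?(ltW c0)//; exact: (implyP (vC j)).
- by move=> L CL; exact: (lspan_in_cone x_nondeg CL).
Qed.

End simplex_angle.

Import HBNNSimple.

Section nonmeasurable.
Local Open Scope ereal_scope.

(* The lower integral of a nonnegative function ignores null sets even when the
   function is not measurable. *)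
Lemma ge0_integral_off_null e (T : measurableType e) (R : realType)
    (m : {measure set T -> \bar R}) (f g : T -> \bar R) (N : set T) :
  measurable N -> m N = 0 -> measurable_fun setT g ->
  (forall x, 0 <= f x) -> (forall x, 0 <= g x) ->
  (forall x, ~ N x -> f x = g x) ->
  \int[m]_x f x = \int[m]_x g x.
Proof.
move=> mN N0 mg f0 g0 fg; apply/eqP; rewrite eq_le; apply/andP; split.
  rewrite ge0_integralTE//; apply: ge_ereal_sup => _ [h /= hf <-].
  rewrite -integralT_nnsfun; apply: ae_ge0_le_integral => //.
  - by move=> x _; rewrite lee_fin; exact: fun_ge0.
  - exact/measurable_EFinP.
  - exists N; split => // x /= H; apply: contrapT => Nx; apply: H => _.
    by rewrite -fg.
pose g1 := g \_ (~` N).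
have g10 x : 0 <= g1 x by rewrite /g1 patchE; case: ifP.
have mg1 : measurable_fun setT g1.
  apply/(measurable_restrictT g (measurableC mN)).
  exact: measurable_funTS.
have -> : \int[m]_x g x = \int[m]_x g1 x.
  apply: ge0_ae_eq_integral => //; exists N; split => // x /= H.
  apply: contrapT => Nx; apply: H => _.
  by rewrite /g1 patchE mem_set.
rewrite !ge0_integralTE//; apply: le_ereal_sup => _ [h /= hg <-]; exists h => // x.
apply: le_trans (hg x) _; rewrite /g1 patchE.
by case: ifPn => [/set_mem Nx|_]; [rewrite fg|exact: f0].
Qed.

End nonmeasurable.

(** * Unrolling the recursion *)

Section recursion_unrolled.
Context {R : realType}.
Variables (p : R) (k : nat).
Hypotheses (p12 : 2^-1 < p) (k_gt0 : (0 < k)%N).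

Lemma mul_bin_bin n m : (k <= m <= n)%N ->
  ('C(n, m) * 'C(m, k) = 'C(n, k) * 'C(n - k, m - k))%N.
Proof.
move=> /andP[km mn]; have kn := leq_trans km mn.
have mkn : (m - k <= n - k)%N by rewrite leq_sub2r.
have E1 := bin_fact mn; have E2 := bin_fact km; have E3 := bin_fact kn.
have := bin_fact mkn; rewrite subnBA// subnK// => E4.
apply/eqP; rewrite -(eqn_pmul2r (_ : 0 < k`! * (m - k)`! * (n - m)`!)%N); last first.
  by rewrite !muln_gt0 !fact_gt0.
apply/eqP; transitivity n`!.
  rewrite -E1 -E2; lia.
rewrite -E3 -E4; lia.
Qed.

Lemma tildeI_diag n : (0 < n)%N -> tildeI n n (2 * p - 1) = 1 :> R.
Proof.
move=> n0; have a0 : 0 < 2 * p - 1 by move: p12; lra.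
apply: EFin_inj; rewrite tildeIE// subnn.
under eq_integral do rewrite expr0 mulr1.
apply: integral_bdens; have : 0 < (2 * p - 1) * n%:R by rewrite mulr_gt0// ltr0n.
by move: (_ * _) => z z0; lra.
Qed.

(** Multiplied by ['C(n, k)], the recursion becomes a system with matrix [bbI] and unknowns
    ['C(m, k)] times [prob_above p m k], because of [mul_bin_bin]; its diagonal is 1 by
    [tildeI_diag]. *)
Lemma prob_above_chain n : (k <= n)%N ->
  'C(n, k)%:R * prob_above p n k =
  \sum_(0 <= l < (n - k).+1) (-1) ^+ l *
    chain_sum k (fun a b => bbI a b (2 * p - 1)) n n l.
Proof.
move=> kn; apply/esym.
apply: (@chain_inversion _ k (fun a b => bbI a b (2 * p - 1))
  (fun m => 'C(m, k)%:R * prob_above p m k) n) => //; last by rewrite kn leqnn.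
  move=> m km; rewrite /bbI binn mul1r tildeI_diag//; exact: leq_trans km.
move=> m km; have E := prob_above_recursion p12 (introT andP (conj k_gt0 km)).
rewrite -[RHS]mulr1 -[X in _ = _ * X]E {E}.
rewrite mulr_sumr; apply: eq_big_nat => j /andP[kj jm]; rewrite /bbI.
rewrite mulrACA -natrM mul_bin_bin ?kj// natrM.
by rewrite -[LHS]mulrA [tildeI _ _ _ * _]mulrC.
Qed.

End recursion_unrolled.

(** * The expected internal angle *)

Section expected_angle.
Context {R : realType} e (T : measurableType e) (P : probability T R).
Notation lam := (lebesgue_rV R).
Local Open Scope ereal_scope.
Variables (d k : nat) (beta : R) (X : 'I_d.+1 -> {RV P >-> 'rV[R]_d}).
Hypotheses (hb : (d%:R / 2 < beta)%R) (hk : (0 < k <= d.+1)%N).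
Hypothesis X_indep : mutually_independent X.
Hypothesis X_density : forall i, has_density (X i) (@beta'_density R d beta).

Let p : R := (beta - (d%:R - 1) / 2)%R.

Let p12 : (2^-1 < p)%R.
Proof. by rewrite /p; move: hb; lra. Qed.

Lemma prob_above_all n : prob_above p n n = 1%R.
Proof.
rewrite /prob_above (_ : above_int p n n = (mass p ^+ n)%:E).
  by rewrite divff// expf_neq0// gt_eqF// mass_gt0.
rewrite -(integral_rho p12); apply: eq_integral => w _; apply: eq_integral => t _.
rewrite (_ : above n w t = true) ?mulr1//.
by apply/forallP => i; rewrite leqNgt ltn_ord.
Qed.

Let ball_vol : R := fine (lam d (unit_ball d)).

Let ball_vol_gt0 : (0 < ball_vol)%R.
Proof.
have [B0 Boo] := @unit_ball_fin R d.
by rewrite /ball_vol fine_gt0// B0.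
Qed.

Let ball_volE : lam d (unit_ball d) = ball_vol%:E.
Proof.
have [B0 Boo] := @unit_ball_fin R d.
by rewrite /ball_vol fineK// ge0_fin_numE// ltW.
Qed.

Let cone_vol_fin (x : 'rV[R]_(d.+1 * d)) : cone_vol k x \is a fin_num.
Proof.
rewrite ge0_fin_numE ?cone_vol_ge0//; apply: (@le_lt_trans _ _ (lam d (unit_ball d))).
  rewrite -integral_ballb; apply: ge0_le_integral => //.
  - apply/measurable_EFinP; apply: measurable_bool_real; apply: measurable_and.
      exact: measurable_ballb.
    exact: measurable_in_cone.
  - by apply/measurable_EFinP; apply: measurable_bool_real; exact: measurable_ballb.
  - by move=> v _; rewrite lee_fin; case: (ballb v); case: (in_cone _ _ _).
by rewrite ball_volE ltry.
Qed.

Let angle (x : 'rV[R]_(d.+1 * d)) : \bar R := (ball_vol^-1)%:E * cone_vol k x.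

Let measurable_angle : measurable_fun setT angle.
Proof. by apply: emeasurable_funM => //; exact: measurable_cone_vol. Qed.

Let angle_ge0 x : 0 <= angle x.
Proof. by rewrite mule_ge0 ?cone_vol_ge0// lee_fin invr_ge0 ltW. Qed.

Lemma internal_angle_ge0 N (F G : set 'rV[R]_N) : (0 <= internal_angle F G)%R.
Proof.
rewrite /internal_angle; case: ifP => // _.
by rewrite divr_ge0// fine_ge0.
Qed.

Lemma expected_internal_angle_prob :
  expected_internal_angle X k = (prob_above p d.+1 k)%:E.
Proof.
rewrite /expected_internal_angle expectation.unlock.
have /andP[k_gt0 kd] := hk.
(* When the face is the whole simplex the angle is 1 by definition; this case also contains [d = 0],
   so that [0 < d] may be used afterwards. *)
have [kd1|kd1] := eqVneq k d.+1.
  rewrite kd1 prob_above_all -(probability_setT P) -[RHS]mul1e -integral_cst//.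
  apply: eq_integral => a _; rewrite /internal_angle asboolT//.
  congr (conv_hull (_ @` _)); apply/seteqP; split => // i _ /=.
  exact: ltn_ord.
have k_le : (k <= d)%N by rewrite -ltnS ltn_neqAle kd1.
have d_gt0 : (0 < d)%N by exact: leq_trans k_le.
pose D := [set x : 'rV[R]_(d.+1 * d) | \det (edge_mx (simplex x)) == 0%R].
have mD : measurable D by exact: measurable_degenerate.
have rowE a i : row i (simplex (vertices X a)) = X i a.
  by rewrite /simplex /vertices mxvecK; apply/rowP => j; rewrite !mxE.
transitivity (\int[P]_a angle (vertices X a)).
  (* On degenerate simplices the angle is not controlled, and its measurability as a function on [T]
     is not known; it is replaced by [angle], which is measurable and agrees with it elsewhere. *)
  apply: (@ge0_integral_off_null _ _ _ _ _ _ (vertices X @^-1` D)).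
  - by rewrite -[X in measurable X]setTI; exact: measurable_vertices.
  - have mi : measurable_fun setT (fun x => (\1_D x : R)%:E).
      by apply/measurable_EFinP; exact: measurable_indic.
    have i0 x : 0 <= (\1_D x : R)%:E by rewrite lee_fin.
    have := integral_vertices hb X_indep X_density mi i0.
    have -> : \int[P]_a (\1_D (vertices X a) : R)%:E = P (vertices X @^-1` D).
      rewrite -[in RHS](setIT (vertices X @^-1` D)) -integral_indic//.
      by rewrite -[X in measurable X]setTI; exact: measurable_vertices.
    move=> H; apply: etrans H _; rewrite -[RHS](integral0 (lam (d.+1 * d)) setT).
    apply: ge0_ae_eq_integral => //.
    + apply: emeasurable_funM => //; apply/measurable_EFinP.
      exact: measurable_joint_density.
    + by move=> x _; rewrite mule_ge0// lee_fin joint_density_ge0.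
    + exists D; split => //; first exact: degenerate_negligible.
      move=> x /= H; apply: contrapT => xD; apply: H => _.
      by rewrite indicE memNset// mul0e.
  - exact: (measurableT_comp measurable_angle (measurable_vertices X)).
  - by move=> a; rewrite lee_fin internal_angle_ge0.
  - by move=> a; exact: angle_ge0.
  - move=> a /negP aD.
    have E (K : set 'I_d.+1) : [set X i a | i in K] =
        [set row i (simplex (vertices X a)) | i in K].
      by apply: eq_imagel => i _; rewrite rowE.
    rewrite !E internal_angle_simplex// EFinM fineK//.
    by rewrite muleC.
rewrite (integral_vertices hb X_indep X_density measurable_angle angle_ge0).
have mc : measurable_fun setT (fun x : 'rV[R]_(d.+1 * d)
  => cone_vol k x * (joint_density beta x)%:E).
  apply: emeasurable_funM; first exact: measurable_cone_vol.
  by apply/measurable_EFinP; exact: measurable_joint_density.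
have c0 (x : 'rV[R]_(d.+1 * d)) : 0 <= cone_vol k x * (joint_density beta x)%:E.
  by rewrite mule_ge0 ?cone_vol_ge0// lee_fin joint_density_ge0.
under eq_integral do rewrite -muleA.
rewrite ge0_integralZl; [|by []|exact: mc|by move=> x _; exact: c0|by rewrite lee_fin invr_ge0 ltW].
rewrite (integral_cone_vol_density hb d_gt0 k_gt0) ball_volE muleA -(EFinM _ ball_vol).
by rewrite (mulVf (lt0r_neq0 ball_vol_gt0)) mul1e.
Qed.

End expected_angle.

Theorem theorem2p4 (R : realType) (n k : nat) (beta : R)
    (d : measure_display) (T : measurableType d) (P : probability T R)
    (X : 'I_n -> {RV P >-> 'rV[R]_(n.-1)})
    (hk : (1 <= k <= n)%N) (hbeta : (n%:R - 1) / 2 < beta)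
    (X_indep : mutually_independent X)
    (X_density : forall i, has_density (X i) (@beta'_density R n.-1 beta)) :
  ('C(n, k)%:R%:E * expected_internal_angle X k)%E =
  (\sum_(0 <= l < (n - k).+1) (-1) ^+ l *
     \sum_(s : {ffun 'I_l.+1 -> 'I_n.+1} | is_chain k s)
       (\prod_(i < l) bbI (s (widen_ord (leqnSn l) i)) (s (lift ord0 i))
                          (2 * beta - n%:R + 1)) *
       'C(s ord_max, k)%:R)%:E.
Proof.
(* Once [n] is a successor, [n.-1] reduces to the dimension [d] of the preceding section; [n = 0]
   contradicts [hk]. *)
case: n X hk hbeta X_indep X_density => [|m] X hk hbeta X_indep X_density.
  by case/andP: hk => k1 /(leq_trans k1).
have hb : m%:R / 2 < beta by move: hbeta; rewrite -natr1 addrK.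
have /andP[k_gt0 km] := hk.
rewrite (expected_internal_angle_prob hb hk X_indep X_density) -EFinM.
have p12 : 2^-1 < beta - (m%:R - 1) / 2 by move: hb; lra.
apply: (congr1 EFin); apply: etrans (prob_above_chain p12 k_gt0 km) _.
(* The parameter [2 * p - 1] for [p = beta - (m%:R - 1) / 2] and [n = m.+1]. *)
have -> : 2 * (beta - (m%:R - 1) / 2) - 1 = 2 * beta - m.+1%:R + 1.
  by rewrite -natr1; field.
by [].
Qed.
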